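(* Let $(M,\omega)$ be a compact $6$-dimensional symplectic manifold and let $\rho_A$ be a given source $3$-form. Consider the Type IIA flow $$\partial_t\varphi=d\Lambda d(|\varphi|^2\star\varphi)-\rho_A$$ for positive, primitive, closed $3$-forms $\varphi$ on $M$. This flow can be rewritten as the following flow $$\partial_t\varphi=-dd^\dagger(|\varphi|^2\varphi)+2\,d(|\varphi|^2N^\dagger\cdot\varphi)-\rho_A,$$ where $d^\dagger$ is the adjoint of $d$ with respect to the metric $g_\varphi$, and $N^\dagger$ is the operator from $\Lambda^3(M)$ to $\Lambda^2(M)$ defined by $$(N^\dagger\cdot\varphi)_{kj}=N^\mu{}_j{}^\lambda\varphi_{\mu k\lambda}-N^\mu{}_k{}^\lambda\varphi_{\mu j\lambda},$$ with $N^m{}_{\gamma\beta}$ the Nijenhuis tensor of $J_\varphi$ and indices raised using $g_\varphi$.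
   Context: Type IIA conventions. $M$ is oriented by $\omega^3$. For a $3$-form $\varphi$ set, pointwise, $K_\varphi(v)=-\sum_i e_i\otimes(e^i\wedge\iota_v\varphi\wedge\varphi)\in TM\otimes\Lambda^6T^*M$ ($\{e_i\}$ any basis, $\{e^i\}$ its dual) and $\lambda_\varphi=\frac16\mathrm{tr}\,K_\varphi^2\in(\Lambda^6T^*M)^{\otimes 2}$. If $\lambda_\varphi<0$, then $J_\varphi=K_\varphi/\sqrt{-\lambda_\varphi}$ (positive root with respect to the orientation) is an almost-complex structure (Hitchin's construction). $\Lambda:A^k(M)\to A^{k-2}(M)$ is contraction with $\omega$: $(\Lambda\alpha)_{k\cdots}=\frac12\omega^{ji}\alpha_{ijk\cdots}$, where $\omega^{jk}\omega_{kl}=\delta^j{}_l$. The form $\varphi$ is primitive if $\Lambda\varphi=0$; in that case $\omega$ is $J_\varphi$-invariant and $g_\varphi(X,Y)=\omega(X,J_\varphi Y)$ is symmetric. $\varphi$ is positive if $\lambda_\varphi<0$ and $g_\varphi$ is positive definite. $\star$ is the Hodge star and $|\varphi|$ the norm of $\varphi$ (with $|\varphi|^2=\frac16\varphi_{ijk}\varphi^{ijk}$) with respect to $g_\varphi$. The source $\rho_A$ is the Poincar\'e dual of a finite linear combination of special Lagrangians calibrated by $\varphi$. Components of forms: $\varphi=\frac1{3!}\varphi_{ijk}dx^i\wedge dx^j\wedge dx^k$, and similarly for $2$-forms. The Nijenhuis tensor of $J$ is $N(X,Y)=\frac14([JX,JY]-J[JX,Y]-J[X,JY]-[X,Y])$,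 with components $N(X,Y)^m=N^m{}_{ij}X^iY^j$ and $N_{kij}=g_{km}N^m{}_{ij}$ (the upper index is lowered to the first slot). *)

(* Defs.v *)
From HB Require Import structures.
From mathcomp Require Import all_boot all_order all_algebra all_fingroup.
From mathcomp Require Import all_classical all_reals all_analysis.

Set Implicit Arguments.
Unset Strict Implicit.
Unset Printing Implicit Defensive.

Import Order.TTheory GRing.Theory Num.Theory.
Import numFieldNormedType.Exports.

Local Open Scope classical_set_scope.
Local Open Scope ring_scope.

(* MathComp-Analysis has no manifolds, so a geometric object on M is given by
   its components in the charts of an atlas, as functions on R^6; their values
   outside the image of the chart are irrelevant. *)

Section Calculus.
Variables (R : realType) (n : nat).
Implicit Types (U : set 'rV[R]_n) (f : 'rV[R]_n -> R).

Definition partial (i : 'I_n) f : 'rV[R]_n -> R :=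
  fun x => 'D_(delta_mx 0 i) f x.

Fixpoint Ck (k : nat) U f : Prop :=
  (forall x, U x -> {for x, continuous f}) /\
  match k with
  | 0 => True
  | k'.+1 => forall i,
      (forall x, U x -> derivable f x (delta_mx 0 i)) /\ Ck k' U (partial i f)
  end.

Definition smooth_on U f : Prop := forall k, Ck k U f.

End Calculus.

(* Iterated Lebesgue integral over R^n, first coordinate outermost.  It is only
   applied to continuous functions with compact support, for which it is the
   integral against n-dimensional Lebesgue measure. *)
Fixpoint integral_rV (R : realType) (n : nat) : ('rV[R]_n -> R) -> R :=
  match n return ('rV[R]_n -> R) -> R with
  | 0 => fun f => f 0
  | n'.+1 => fun f =>
      \int[@lebesgue_measure R]_t
        integral_rV (fun v : 'rV[R]_n' => f (row_mx (t%:M : 'rV[R]_1) v))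
  end.

Section PointwiseAlgebra.
Variable R : realType.

(* A covariant k-tensor at a point of a chart; a k-form alpha is represented by
   its alternating components alpha_{i_1 .. i_k}, so that
   alpha = 1/k! alpha_{i_1 .. i_k} dx^{i_1} ^ .. ^ dx^{i_k}. *)
Definition tensor (k : nat) := k.-tuple 'I_6 -> R.

Definition alternating k (al : tensor k) : Prop :=
  forall (s : 'S_k) (I : k.-tuple 'I_6),
    al [tuple tnth I (s m) | m < k] = (-1) ^+ s * al I.

Definition wedge k l (al : tensor k) (be : tensor l) : tensor (k + l) :=
  fun I => (k`! * l`!)%:R^-1 *
    \sum_(s : 'S_(k + l)) (-1) ^+ s
      * al [tuple tnth I (s (lshift l m)) | m < k]
      * be [tuple tnth I (s (rshift k m)) | m < l].

Definition dx (a : 'I_6) : tensor 1 := fun I => (tnth I ord0 == a)%:R.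

(* Contraction with the coordinate vector field of index b. *)
Definition contract k (b : 'I_6) (al : tensor k.+1) : tensor k :=
  fun I => al [tuple of b :: I].

(* Coefficient of dx^1 ^ .. ^ dx^6. *)
Definition top_coef (al : tensor 6) : R := al (ord_tuple 6).

Definition form_mx (om : tensor 2) : 'M[R]_6 := \matrix_(i, j) om [tuple i; j].

(* omega^{jk} omega_{kl} = delta^j_l. *)
Definition form_inv (om : tensor 2) : 'M[R]_6 := invmx (form_mx om).

Definition Lambda (om : tensor 2) k (al : tensor k.+2) : tensor k :=
  fun I => 2^-1 *
    \sum_(i < 6) \sum_(j < 6) form_inv om j i * al [tuple of i :: j :: I].

(* Sign of the chart relative to the orientation omega^3: charts are not
   required to be oriented. *)
Definition orient (om : tensor 2) : R :=
  Num.sg (top_coef (wedge om (wedge om om))).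

(* K_phi and lambda_phi after trivialising Lambda^6 T^*M by dx^1 ^ .. ^ dx^6;
   column b of the matrix is K_phi applied to the b-th coordinate vector. *)
Definition hitchin_K (ph : tensor 3) : 'M[R]_6 :=
  \matrix_(a, b) - top_coef (wedge (dx a) (wedge (contract b ph) ph)).

Definition hitchin_lambda (ph : tensor 3) : R :=
  6^-1 * \tr (hitchin_K ph *m hitchin_K ph).

Definition almost_complex (om : tensor 2) (ph : tensor 3) : 'M[R]_6 :=
  (orient om * Num.sqrt (- hitchin_lambda ph))^-1 *: hitchin_K ph.

(* g_{ij} = omega_{il} J^l_j. *)
Definition metric (om : tensor 2) (ph : tensor 3) : 'M[R]_6 :=
  form_mx om *m almost_complex om ph.

Definition positive_at (om : tensor 2) (ph : tensor 3) : Prop :=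
  hitchin_lambda ph < 0 /\
  forall v : 'cV[R]_6, v != 0 -> 0 < (v^T *m metric om ph *m v) 0 0.

Definition raise_indices (g : 'M[R]_6) k (al : tensor k) : tensor k :=
  fun I => \sum_(J : k.-tuple 'I_6)
    (\prod_(m < k) invmx g (tnth I m) (tnth J m)) * al J.

Definition inner (g : 'M[R]_6) k (al be : tensor k) : R :=
  k`!%:R^-1 * \sum_(I : k.-tuple 'I_6) al I * raise_indices g be I.

Definition normsq (om : tensor 2) (ph : tensor 3) : R :=
  inner (metric om ph) ph ph.

(* The determinant is the Levi-Civita symbol of I. *)
Definition vol_form (om : tensor 2) (g : 'M[R]_6) : tensor 6 :=
  fun I => orient om * Num.sqrt (\det g) *
           \det (\matrix_(r < 6, c < 6) ((tnth I r == c)%:R : R)).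

(* Normalised by al ^ star be = <al, be> vol. *)
Definition hodge_star (om : tensor 2) (g : 'M[R]_6) (be : tensor 3)
  : tensor 3 :=
  fun J => 3`!%:R^-1 *
    \sum_(I : 3.-tuple 'I_6)
      raise_indices g be I * vol_form om g [tuple of I ++ J].

End PointwiseAlgebra.

Section LocalFields.
Variable R : realType.

Definition local_field (k : nat) := 'rV[R]_6 -> tensor R k.

Definition ext_d k (al : local_field k) : local_field k.+1 :=
  fun x I => \sum_(j < k.+1) (-1) ^+ j *
    partial (tnth I j) (fun y => al y [tuple tnth I (lift j m) | m < k]) x.

Definition vector_field := 'rV[R]_6 -> 'cV[R]_6.

Definition lie_bracket (X Y : vector_field) : vector_field :=
  fun x => \col_m \sum_(l < 6)
    (X x l 0 * partial l (fun y => Y y m 0) x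
     - Y x l 0 * partial l (fun y => X y m 0) x).

Definition nijenhuis (J : 'rV[R]_6 -> 'M[R]_6) (X Y : vector_field)
  : vector_field :=
  let JX := fun y => J y *m X y in
  let JY := fun y => J y *m Y y in
  fun x => 4^-1 *: (lie_bracket JX JY x - J x *m lie_bracket JX Y x
                    - J x *m lie_bracket X JY x - lie_bracket X Y x).

Definition coord_field (i : 'I_6) : vector_field := fun=> delta_mx i 0.

(* N^m_{ij}. *)
Definition nijenhuis_comp (J : 'rV[R]_6 -> 'M[R]_6) (x : 'rV[R]_6)
    (m i j : 'I_6) : R :=
  nijenhuis J (coord_field i) (coord_field j) x m 0.

(* N^m_j^l = N^m_{js} g^{sl}. *)
Definition nijenhuis_raised (J : 'rV[R]_6 -> 'M[R]_6) (g : 'M[R]_6)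
    (x : 'rV[R]_6) (m j l : 'I_6) : R :=
  \sum_(s < 6) nijenhuis_comp J x m j s * invmx g s l.

Definition N_dagger (om : local_field 2) (ph : local_field 3) : local_field 2 :=
  fun x I =>
    let J := fun y => almost_complex (om y) (ph y) in
    let N := nijenhuis_raised J (metric (om x) (ph x)) x in
    let k := tnth I ord0 in
    let j := tnth I ord_max in
    \sum_(m < 6) \sum_(l < 6)
      (N m j l * ph x [tuple m; k; l] - N m k l * ph x [tuple m; j; l]).

End LocalFields.

(* A smooth atlas of 6-dimensional charts; chart_inv c is the inverse of
   chart c on the image of its domain. *)
Record atlas (R : realType) (M : topologicalType) := Atlas {
  chart_index : Type;
  chart_dom : chart_index -> set M;
  chart : chart_index -> M -> 'rV[R]_6;
  chart_inv : chart_index -> 'rV[R]_6 -> M;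
  chart_dom_open : forall c, open (chart_dom c);
  chart_cover : forall p, exists c, chart_dom c p;
  chart_img_open : forall c, open (chart c @` chart_dom c);
  chartK : forall c p, chart_dom c p -> chart_inv c (chart c p) = p;
  chart_cont : forall c p, chart_dom c p -> {for p, continuous (chart c)};
  chart_inv_cont : forall c x, (chart c @` chart_dom c) x ->
    {for x, continuous (chart_inv c)};
  transition_smooth : forall (c c' : chart_index) (m : 'I_6),
    smooth_on (chart c @` (chart_dom c `&` chart_dom c'))
      (fun x => chart c' (chart_inv c x) 0 m)
}.

Section Manifold.
Variables (R : realType) (M : topologicalType) (A : atlas R M).

Definition chart_img (c : chart_index A) : set 'rV[R]_6 :=
  chart c @` chart_dom c.

Definition chart_overlap (c c' : chart_index A) : set 'rV[R]_6 :=
  chart c @` (chart_dom c `&` chart_dom c').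

Definition transition (c c' : chart_index A) : 'rV[R]_6 -> 'rV[R]_6 :=
  fun x => chart c' (chart_inv c x).

Definition tensor_field (k : nat) := chart_index A -> local_field R k.

(* al is a smooth k-form on M: its components are smooth and alternating, and
   those in two charts are related by pull-back along the transition map. *)
Definition is_form k (al : tensor_field k) : Prop :=
  [/\ forall c I, smooth_on (chart_img c) (fun x => al c x I),
      forall c x, chart_img c x -> alternating (al c x) &
      forall c c' x I, chart_overlap c c' x ->
        al c x I = \sum_(J : k.-tuple 'I_6)
          (\prod_(m < k) partial (tnth I m)
              (fun y => transition c c' y 0 (tnth J m)) x)
          * al c' (transition c c' x) J].

Definition closed_form k (al : tensor_field k) : Prop :=
  forall c x, chart_img c x -> forall I, ext_d (al c) x I = 0.

Definition symplectic (om : tensor_field 2) : Prop :=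
  [/\ is_form om, closed_form om &
      forall c x, chart_img c x -> form_mx (om c x) \in unitmx].

Definition primitive_form (om : tensor_field 2) (ph : tensor_field 3) : Prop :=
  forall c x, chart_img c x -> forall I, Lambda (om c x) (ph c x) I = 0.

Definition positive_form (om : tensor_field 2) (ph : tensor_field 3) : Prop :=
  forall c x, chart_img c x -> positive_at (om c x) (ph c x).

Definition metric_of (om : tensor_field 2) (ph : tensor_field 3)
  : chart_index A -> 'rV[R]_6 -> 'M[R]_6 :=
  fun c x => metric (om c x) (ph c x).

(* A smooth k-form with compact support contained in the domain of c, written
   in the chart c (where it extends by 0 to all of R^6). *)
Definition test_form k (c : chart_index A) (al : local_field R k) : Prop :=
  [/\ forall I, smooth_on setT (fun x => al x I),
      forall x, alternating (al x) &
      exists2 K : set 'rV[R]_6, compact K /\ K `<=` chart_img c &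
        forall x I, ~ K x -> al x I = 0].

(* D maps (k+1)-forms to k-forms and is the L^2 adjoint of d for the metric g:
   \int <d al, be> dvol = \int <al, D be> dvol.  By a partition of unity it is
   enough to let al range over the forms supported in a single chart, where the
   integrals are over R^6 and dvol = sqrt (det g) dx. *)
Definition adjoint_of_d (g : chart_index A -> 'rV[R]_6 -> 'M[R]_6) k
    (D : tensor_field k.+1 -> tensor_field k) : Prop :=
  forall be : tensor_field k.+1, is_form be ->
    is_form (D be) /\
    forall c (al : local_field R k), test_form c al ->
      integral_rV (fun x =>
        inner (g c x) (ext_d al x) (be c x) * Num.sqrt (\det (g c x))) =
      integral_rV (fun x =>
        inner (g c x) (al x) (D be c x) * Num.sqrt (\det (g c x))).

Definition normsq_mul (om : tensor_field 2) (ph : tensor_field 3) k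
    (al : tensor_field k) : tensor_field k :=
  fun c x I => normsq (om c x) (ph c x) * al c x I.

Definition star_form (om : tensor_field 2) (ph : tensor_field 3)
  : tensor_field 3 :=
  fun c x => hodge_star (om c x) (metric_of om ph c x) (ph c x).

Definition d_form k (al : tensor_field k) : tensor_field k.+1 :=
  fun c => ext_d (al c).

Definition Lambda_form (om : tensor_field 2) k (al : tensor_field k.+2)
  : tensor_field k :=
  fun c x => Lambda (om c x) (al c x).

Definition N_dagger_form (om : tensor_field 2) (ph : tensor_field 3)
  : tensor_field 2 :=
  fun c => N_dagger (om c) (ph c).

(* The time derivative of ph, at every time t in T, is F t. *)
Definition evolves (T : set R) (ph F : R -> tensor_field 3) : Prop :=
  forall t, T t -> forall c x, chart_img c x -> forall I,
    is_derive (t : R) (1 : R) (fun s : R => ph s c x I : R) (F t c x I).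

Definition type_IIA_flow (T : set R) (om : tensor_field 2)
    (rho ph : R -> tensor_field 3)
  : Prop :=
  evolves T ph (fun t c x I =>
    d_form (Lambda_form om
      (d_form (normsq_mul om (ph t) (star_form om (ph t))))) c x I
    - rho t c x I).

(* codiff t is the operator d^dagger of the metric at time t. *)
Definition rewritten_flow (T : set R) (om : tensor_field 2)
    (rho ph : R -> tensor_field 3)
    (codiff : R -> tensor_field 3 -> tensor_field 2) : Prop :=
  evolves T ph (fun t c x I =>
    - d_form (codiff t (normsq_mul om (ph t) (ph t))) c x I
    + 2 * d_form (normsq_mul om (ph t) (N_dagger_form om (ph t))) c x I
    - rho t c x I).

End Manifold.

(* Main.v *)
Require Import Defs.
From mathcomp Require Import all_boot all_order all_algebra all_fingroup.
From mathcomp Require Import all_classical all_reals all_analysis.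
From mathcomp Require Import ring lra.
Set Implicit Arguments.
Unset Strict Implicit.
Unset Printing Implicit Defensive.
Import Order.TTheory GRing.Theory Num.Theory.
Import numFieldNormedType.Exports.
Local Open Scope classical_set_scope.
Local Open Scope ring_scope.

(** Put f = |phi|^2. Both flows have the same right-hand side because of an
    identity between 2-forms, to which d is then applied:
      Lambda d (f star phi) = - d^dagger (f phi) + 2 f (N^dagger . phi).

    At a point, everything follows from contractions with the Levi-Civita
    symbol. Letting an endomorphism act as a derivation on the six slots of
    such a contraction multiplies it by the trace ([top6_derivation]), and for
    an endomorphism of rank one this says that alternating over seven slots
    gives zero ([top6_insert]). These relations show that phi(K x, y, z) is
    alternating in x, y, z, that K^2 is a scalar and, for primitive phi, that
    omega(x, K y) is symmetric. So J^2 = -1, the form phi is the real part of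
    a form of type (3,0), and star phi = - phi(J x, y, z). Moreover det J = 1,
    which makes the Riemannian volume the absolute value of the Pfaffian of
    omega, that is the Liouville volume.

    Put psi = f star phi, eta = f phi and beta = Lambda d psi. Two facts about
    beta give the identity.

    First, beta + beta(J x, J y) = 2 f (N^dagger . phi) ([beta_type11]). The
    form psi - i eta has type (3,0), so its exterior derivative on two vectors
    of type (0,1) is given by the Nijenhuis tensor ([structure_equation]); the
    contraction with omega reads beta = - (Lambda d eta)(J x, y) + (Nijenhuis
    term). As phi is closed and primitive, Lambda d eta is phi contracted with
    a vector, so that (Lambda d eta)(J x, y) changes sign when J is applied to
    x and y, while the Nijenhuis term is unchanged.

    Secondly, d^dagger (f phi) = beta(J x, J y) ([codifferentialE]). Raising
    the indices of f phi with the metric is raising those of psi with omega,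
    and omega^{-1} is divergence free for the Liouville volume
    ([poisson_divergence]). So the divergence which gives d^dagger is the
    symplectic codifferential of psi, and this is - Lambda d on primitive
    forms ([symplectic_codifferential]). The operator d^dagger is known only
    through its pairings with test forms; integration by parts against bump
    functions recovers the divergence at each point ([weak_divergence]).

    Finally f phi is a form on M, because |phi|^2 does not depend on the chart
    ([normsq_pullback]), and this is what allows d^dagger to be applied. *)

(** * The Levi-Civita symbol *)

Section LeviCivita.
Variable R : comUnitRingType.
Local Notation ord := 'I_6.
Implicit Types (I J : 6.-tuple ord) (G : 6.-tuple ord -> R).

Definition o0 : ord := @Ordinal 6 0 isT.
Definition o1 : ord := @Ordinal 6 1 isT.
Definition o2 : ord := @Ordinal 6 2 isT.
Definition o3 : ord := @Ordinal 6 3 isT.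
Definition o4 : ord := @Ordinal 6 4 isT.
Definition o5 : ord := @Ordinal 6 5 isT.

Lemma big_ord6 (T : Type) (idx : T) (op : Monoid.law idx) (F : ord -> T) :
  \big[op/idx]_i F i = op (F o0) (op (F o1) (op (F o2) (op (F o3) (op (F o4) (F o5))))).
Proof.
rewrite !big_ord_recl big_ord0 Monoid.mulm1.
by do !congr (op _ _); congr F; apply: val_inj.
Qed.

Lemma ord6P (P : ord -> Prop) : P o0 -> P o1 -> P o2 -> P o3 -> P o4 -> P o5 -> forall i, P i.
Proof.
move=> h0 h1 h2 h3 h4 h5 [[|[|[|[|[|[|//]]]]]] h].
- by rewrite (_ : Ordinal h = o0)//; apply: val_inj.
- by rewrite (_ : Ordinal h = o1)//; apply: val_inj.
- by rewrite (_ : Ordinal h = o2)//; apply: val_inj.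
- by rewrite (_ : Ordinal h = o3)//; apply: val_inj.
- by rewrite (_ : Ordinal h = o4)//; apply: val_inj.
- by rewrite (_ : Ordinal h = o5)//; apply: val_inj.
Qed.

Definition rows_mx (P : 'M[R]_6) I : 'M[R]_6 := \matrix_(r, c) P (tnth I r) c.

Definition levi_civita I : R := \det (\matrix_(r < 6, c < 6) ((tnth I r == c)%:R : R)).

(** The full contraction of a six-tensor with the Levi-Civita symbol; on six-forms
    it is 6! times the coefficient of dx^1 ^ .. ^ dx^6. *)
Definition top G : R := \sum_I levi_civita I * G I.

Lemma sum_delta (T : finType) (a : T) (F : T -> R) : \sum_i (a == i)%:R * F i = F a.
Proof.
rewrite (bigD1 a)//= eqxx mul1r big1 ?addr0// => i.
by rewrite eq_sym => /negbTE ->; rewrite mul0r.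
Qed.

Lemma rows_mxE P I : rows_mx P I = rows_mx 1%:M I *m P.
Proof.
apply/matrixP => r c; rewrite mxE [RHS]mxE -[LHS](sum_delta _ (P^~ c)).
by apply: eq_bigr => k _; rewrite !mxE.
Qed.

Lemma levi_civitaE I : levi_civita I = \det (rows_mx 1%:M I).
Proof. by congr (\det _); apply/matrixP => r c; rewrite !mxE. Qed.

Lemma levi_civita_sum I :
  levi_civita I = \sum_(s : 'S_6) (-1) ^+ s * ([tuple s m | m < 6] == I)%:R.
Proof.
rewrite /levi_civita /determinant; apply: eq_bigr => s _; congr (_ * _).
under eq_bigr do rewrite mxE.
have [<-|ne] := eqVneq.
  by rewrite big1// => i _; rewrite tnth_mktuple eqxx.
have [i ni] : exists i, tnth I i != s i.
  apply/existsP; rewrite -negb_forall; apply: contra ne => /forallP h.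
  by apply/eqP/eq_from_tnth => i; rewrite tnth_mktuple (eqP (h i)).
by rewrite (bigD1 i)//= (negbTE ni) mul0r.
Qed.

Lemma topE G : top G = \sum_(s : 'S_6) (-1) ^+ s * G [tuple s m | m < 6].
Proof.
rewrite /top/=; under eq_bigr do rewrite levi_civita_sum mulr_suml.
rewrite exchange_big/=; apply: eq_bigr => s _.
under eq_bigr do rewrite -mulrA.
by rewrite -mulr_sumr sum_delta.
Qed.

Definition permute (s : 'S_6) I := [tuple tnth I (s m) | m < 6].

Lemma top_permute (s : 'S_6) G : top (fun I => G (permute s I)) = (-1) ^+ s * top G.
Proof.
rewrite !topE mulr_sumr (reindex_inj (mulgI s^-1))%g /=; apply: eq_bigr => t _.
rewrite odd_permM odd_permV signr_addb mulrA; congr (_ * G _).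
by apply: eq_from_tnth => i; rewrite !tnth_mktuple permM permK.
Qed.

Definition update I r m : 6.-tuple ord := [tuple if i == r then m else tnth I i | i < 6].

(** The reindexing that exchanges the old and the new value of a slot in a
    double sum over both. *)
Lemma update_involutive r : involutive
  (fun p : 6.-tuple ord * ord => (update p.1 r p.2, tnth p.1 r)).
Proof.
move=> [I m] /=; congr (_, _); last by rewrite tnth_mktuple eqxx.
by apply: eq_from_tnth => i; rewrite !tnth_mktuple; case: eqP => // ->.
Qed.

(** Replacing row r of the matrix M with rows e_{I r} by a unit row is a cofactor
    of M, so the sum is tr (M A adj M) = tr A * det M. *)
Lemma levi_civita_update (A : 'M[R]_6) I :
  \sum_r \sum_c A (tnth I r) c * levi_civita (update I r c) = \tr A * levi_civita I.
Proof.
set M := rows_mx 1%:M I.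
have E r c : levi_civita (update I r c) = cofactor M r c.
  rewrite levi_civitaE (expand_det_row _ r) (bigD1 c)//= !mxE tnth_mktuple !eqxx mul1r.
  rewrite big1 ?addr0 => [|k kc].
    rewrite /cofactor; congr (_ * \det _); apply/matrixP => i j; rewrite !mxE tnth_mktuple.
    by rewrite [lift _ _ == _]eq_sym (negbTE (neq_lift _ _)).
  by rewrite !mxE tnth_mktuple eqxx eq_sym (negbTE kc) mul0r.
transitivity (\tr (M *m A *m \adj M)).
  apply: eq_bigr => r _; rewrite mxE; apply: eq_bigr => c _.
  by rewrite E -rows_mxE !mxE.
by rewrite mxtrace_mulC mulmxA mul_adj_mx -/M mul_scalar_mx mxtraceZ levi_civitaE mulrC.
Qed.

(** Levi-Civita contraction turns a derivation of the tensor algebra into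
    multiplication by the trace. *)
Lemma top_derivation (A : 'M[R]_6) G :
  \sum_r top (fun I => \sum_m A m (tnth I r) * G (update I r m)) = \tr A * top G.
Proof.
transitivity (\sum_I (\sum_r \sum_c A (tnth I r) c * levi_civita (update I r c)) * G I);
  last by rewrite mulr_sumr; apply: eq_bigr => I _; rewrite levi_civita_update mulrA.
under [RHS]eq_bigr do rewrite mulr_suml.
rewrite [RHS]exchange_big/=; apply: eq_bigr => r _.
rewrite /top/=; under eq_bigr do rewrite mulr_sumr.
rewrite pair_big/= (reindex_inj (inv_inj (@update_involutive r)))/=.
under [RHS]eq_bigr do rewrite mulr_suml.
rewrite [RHS]pair_big/=; apply: eq_bigr => -[I m] _ /=.
rewrite [tnth (update I r m) r]tnth_mktuple eqxx.
have -> : update (update I r m) r (tnth I r) = I.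
  by have /(congr1 fst) := update_involutive r (I, m).
by rewrite mulrCA mulrA.
Qed.

Lemma top_pullback (P : 'M[R]_6) G :
  top (fun I => \sum_J (\prod_r P (tnth I r) (tnth J r)) * G J) = \det P * top G.
Proof.
rewrite /top/=; under eq_bigr do rewrite mulr_sumr.
rewrite exchange_big mulr_sumr; apply: eq_bigr => J _ /=.
under eq_bigr do rewrite mulrA; rewrite -mulr_suml [RHS]mulrA; congr (_ * _).
rewrite (_ : \sum_I _ = top (fun I => \prod_r P (tnth I r) (tnth J r)))// topE.
transitivity (\det (rows_mx P^T J)); last first.
  by rewrite rows_mxE det_mulmx det_tr -levi_civitaE mulrC.
by apply: eq_bigr => s _; congr (_ * _); apply: eq_bigr => r _; rewrite tnth_mktuple !mxE.
Qed.

End LeviCivita.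
Arguments levi_civita {R} I.

Section Top6.
Variable R : realFieldType.
Local Notation ord := 'I_6.
Implicit Types (F : ord -> ord -> ord -> ord -> ord -> ord -> R).

Definition curry6 F (I : 6.-tuple ord) : R :=
  F (tnth I o0) (tnth I o1) (tnth I o2) (tnth I o3) (tnth I o4) (tnth I o5).

Definition top6 F : R := top (curry6 F).

Lemma eq_top6 F F' : (forall a b c d e f, F a b c d e f = F' a b c d e f) -> top6 F = top6 F'.
Proof. by move=> h; apply: eq_bigr => I _; rewrite /curry6 h. Qed.

Lemma top6Z k F : top6 (fun a b c d e f => k * F a b c d e f) = k * top6 F.
Proof. by rewrite /top6 /top mulr_sumr; apply: eq_bigr => I _; rewrite /curry6 mulrCA. Qed.

Lemma top6N F : top6 (fun a b c d e f => - F a b c d e f) = - top6 F.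
Proof. by rewrite -mulN1r -top6Z; apply: eq_top6 => *; rewrite mulN1r. Qed.

Lemma top6D F F' :
  top6 (fun a b c d e f => F a b c d e f + F' a b c d e f) = top6 F + top6 F'.
Proof. by rewrite /top6 /top -big_split; apply: eq_bigr => I _; rewrite /curry6 mulrDr. Qed.

Lemma top6_sum (T : finType) (F : T -> ord -> ord -> ord -> ord -> ord -> ord -> R) :
  top6 (fun a b c d e f => \sum_m F m a b c d e f) = \sum_m top6 (F m).
Proof.
rewrite /top6 /top exchange_big; apply: eq_bigr => I _ /=.
by rewrite /curry6 mulr_sumr.
Qed.

Lemma top6_tperm (i j : ord) F : i != j ->
  top (fun I => curry6 F (permute (tperm i j) I)) = - top6 F.
Proof. by move=> ij; rewrite top_permute odd_tperm ij mulN1r. Qed.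

Local Tactic Notation "swap" constr(i) constr(j) := rewrite -[RHS](@top6_tperm i j)//; apply: eq_bigr => I _;
  by rewrite /curry6 !tnth_mktuple !permE.

Lemma top6_s01 F : top6 (fun a b c d e f => F b a c d e f) = - top6 F.
Proof. swap o0 o1. Qed.
Lemma top6_s12 F : top6 (fun a b c d e f => F a c b d e f) = - top6 F.
Proof. swap o1 o2. Qed.
Lemma top6_s23 F : top6 (fun a b c d e f => F a b d c e f) = - top6 F.
Proof. swap o2 o3. Qed.
Lemma top6_s34 F : top6 (fun a b c d e f => F a b c e d f) = - top6 F.
Proof. swap o3 o4. Qed.
Lemma top6_s45 F : top6 (fun a b c d e f => F a b c d f e) = - top6 F.
Proof. swap o4 o5. Qed.

Lemma top6_derivation (A : 'M[R]_6) F :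
  top6 (fun a b c d e f => \sum_m A m a * F m b c d e f) +
  top6 (fun a b c d e f => \sum_m A m b * F a m c d e f) +
  top6 (fun a b c d e f => \sum_m A m c * F a b m d e f) +
  top6 (fun a b c d e f => \sum_m A m d * F a b c m e f) +
  top6 (fun a b c d e f => \sum_m A m e * F a b c d m f) +
  top6 (fun a b c d e f => \sum_m A m f * F a b c d e m) = \tr A * top6 F.
Proof.
rewrite -top_derivation big_ord6 /= !addrA.
by do !congr (_ + _); apply: eq_bigr => I _; congr (_ * _); apply: eq_bigr => m _;
  rewrite /curry6 !tnth_mktuple.
Qed.

(** Alternating over seven slots in six dimensions gives zero: the case of a
    derivation of rank one. *)
Lemma top6_elementary (v a : ord) F :
  (v == a)%:R * top6 F =
  top6 (fun c0 c1 c2 c3 c4 c5 => (a == c0)%:R * F v c1 c2 c3 c4 c5) +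
  top6 (fun c0 c1 c2 c3 c4 c5 => (a == c1)%:R * F c0 v c2 c3 c4 c5) +
  top6 (fun c0 c1 c2 c3 c4 c5 => (a == c2)%:R * F c0 c1 v c3 c4 c5) +
  top6 (fun c0 c1 c2 c3 c4 c5 => (a == c3)%:R * F c0 c1 c2 v c4 c5) +
  top6 (fun c0 c1 c2 c3 c4 c5 => (a == c4)%:R * F c0 c1 c2 c3 v c5) +
  top6 (fun c0 c1 c2 c3 c4 c5 => (a == c5)%:R * F c0 c1 c2 c3 c4 v).
Proof.
have -> : (v == a)%:R = \tr (\matrix_(k, l) ((v == k)%:R * (a == l)%:R) : 'M[R]_6).
  by rewrite /mxtrace; under eq_bigr do rewrite mxE; rewrite sum_delta eq_sym.
rewrite -top6_derivation.
by do !congr (_ + _); apply: eq_top6 => c0 c1 c2 c3 c4 c5;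
  under eq_bigr do rewrite mxE -mulrA; rewrite sum_delta.
Qed.

Lemma top6_insert (G : ord -> ord -> ord -> ord -> ord -> ord -> ord -> R) z :
  top6 (G z) =
  top6 (fun c0 c1 c2 c3 c4 c5 => G c0 z c1 c2 c3 c4 c5) +
  top6 (fun c0 c1 c2 c3 c4 c5 => G c1 c0 z c2 c3 c4 c5) +
  top6 (fun c0 c1 c2 c3 c4 c5 => G c2 c0 c1 z c3 c4 c5) +
  top6 (fun c0 c1 c2 c3 c4 c5 => G c3 c0 c1 c2 z c4 c5) +
  top6 (fun c0 c1 c2 c3 c4 c5 => G c4 c0 c1 c2 c3 z c5) +
  top6 (fun c0 c1 c2 c3 c4 c5 => G c5 c0 c1 c2 c3 c4 z).
Proof.
rewrite -[LHS](sum_delta z (fun m => top6 (G m))).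
under eq_bigr do rewrite top6_elementary.
rewrite !big_split /= -!top6_sum.
have flip (c : ord) (H : ord -> R) : \sum_m (m == c)%:R * H m = H c.
  by rewrite -[RHS](sum_delta c); apply: eq_bigr => m _; rewrite eq_sym.
by do !congr (_ + _); apply: eq_top6 => c0 c1 c2 c3 c4 c5; rewrite (flip _ (fun m => G m _ _ _ _ _ _)).
Qed.

End Top6.

(** * Hitchin's endomorphism of a three-form *)

Section HitchinAlgebra.
Variable R : realFieldType.
Local Notation ord := 'I_6.

Definition alternating2 (w : ord -> ord -> R) := forall i j, w j i = - w i j.

Definition alternating3 (p : ord -> ord -> ord -> R) :=
  (forall i j k, p j i k = - p i j k) /\ (forall i j k, p i k j = - p i j k).

(** Hitchin's K in components: the factor 12 = 1! 2! 3! turns the sum over all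
    indices into the wedge product of a 1-, a 2- and a 3-form. *)
Definition stable_form (p : ord -> ord -> ord -> R) : 'M[R]_6 := \matrix_(a, b) (- 12^-1 *
  top6 (fun c0 c1 c2 c3 c4 c5 => (a == c0)%:R * (p b c1 c2 * p c3 c4 c5))).

Definition insert1 (A : 'M[R]_6) (p : ord -> ord -> ord -> R) i j k := \sum_m A m i * p m j k.

Variable p : ord -> ord -> ord -> R.
Hypothesis altp : alternating3 p.
Local Notation K := (stable_form p).

Let p01 i j k : p j i k = - p i j k. Proof. exact: altp.1. Qed.
Let p12 i j k : p i k j = - p i j k. Proof. exact: altp.2. Qed.

Let pc i j k : p k i j = p i j k. Proof. by rewrite p01 p12 opprK. Qed.

Lemma sum_K (X : ord -> R) b : \sum_m X m * K m b =
  - 12^-1 * top6 (fun c0 c1 c2 c3 c4 c5 => X c0 * (p b c1 c2 * p c3 c4 c5)).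
Proof.
rewrite -top6Z; under eq_bigr do rewrite mxE -!top6Z.
rewrite -top6_sum; apply: eq_top6 => c0 c1 c2 c3 c4 c5.
rewrite -[X c0](sum_delta c0 X) mulr_suml mulr_sumr.
by apply: eq_bigr => m _; rewrite eq_sym; ring.
Qed.

Let T v y z := top6 (fun a b c d e f => p a y z * (p v b c * p d e f)).

Lemma insert1_K v y z : insert1 K p v y z = - 12^-1 * T v y z.
Proof. by rewrite -sum_K; apply: eq_bigr => m _; rewrite mulrC. Qed.

Let S y v z := top6 (fun a b c d e f => p y a b * (p v c d * p z e f)).

(** The alternation of z with the six free slots of p(y, _, _), p(v, _, _) and p,
    which vanishes. *)
Let insertion v y z : T v y z *+ 2 + T y v z *+ 2 + S y v z *+ 3 = 0.
Proof.
have := top6_insert (fun d0 d1 d2 d3 d4 d5 d6 => p y d0 d1 * (p v d2 d3 * p d4 d5 d6)) z.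
rewrite (@eq_top6 _ _ (fun a b c d e f => p a y z * (p v b c * p d e f))); last first.
  by move=> *; rewrite (pc y z).
rewrite -/(T v y z).
have -> : top6 (fun c0 c1 c2 c3 c4 c5 => p y c0 z * (p v c1 c2 * p c3 c4 c5)) = - T v y z.
  by rewrite -top6N; apply: eq_top6 => a *; rewrite (p12 y z a) (pc y z) mulNr.
have -> : top6 (fun c0 c1 c2 c3 c4 c5 => p y c1 c0 * (p v z c2 * p c3 c4 c5)) = - T y v z.
  rewrite (@eq_top6 _ _ (fun c0 c1 c2 c3 c4 c5 => p c2 v z * (p y c1 c0 * p c3 c4 c5)));
    last by move=> *; rewrite (pc v z); ring.
  rewrite (top6_s12 (fun c0 c1 c2 c3 c4 c5 => p c1 v z * (p y c2 c0 * p c3 c4 c5))).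
  rewrite (top6_s01 (fun c0 c1 c2 c3 c4 c5 => p c0 v z * (p y c2 c1 * p c3 c4 c5))).
  by rewrite (top6_s12 (fun c0 c1 c2 c3 c4 c5 => p c0 v z * (p y c1 c2 * p c3 c4 c5))) opprK.
have -> : top6 (fun c0 c1 c2 c3 c4 c5 => p y c2 c0 * (p v c1 z * p c3 c4 c5)) = - T y v z.
  rewrite (@eq_top6 _ _ (fun c0 c1 c2 c3 c4 c5 => - (p c1 v z * (p y c2 c0 * p c3 c4 c5))));
    last by move=> a b *; rewrite (p01 b v); ring.
  rewrite top6N; congr (- _).
  rewrite (top6_s01 (fun c0 c1 c2 c3 c4 c5 => p c0 v z * (p y c2 c1 * p c3 c4 c5))).
  by rewrite (top6_s12 (fun c0 c1 c2 c3 c4 c5 => p c0 v z * (p y c1 c2 * p c3 c4 c5))) opprK.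
have -> : top6 (fun c0 c1 c2 c3 c4 c5 => p y c3 c0 * (p v c1 c2 * p z c4 c5)) = - S y v z.
  rewrite (top6_s23 (fun c0 c1 c2 c3 c4 c5 => p y c2 c0 * (p v c1 c3 * p z c4 c5))).
  rewrite (top6_s12 (fun c0 c1 c2 c3 c4 c5 => p y c1 c0 * (p v c2 c3 * p z c4 c5))).
  by rewrite (top6_s01 (fun c0 c1 c2 c3 c4 c5 => p y c0 c1 * (p v c2 c3 * p z c4 c5))) opprK.
have -> : top6 (fun c0 c1 c2 c3 c4 c5 => p y c4 c0 * (p v c1 c2 * p c3 z c5)) = - S y v z.
  rewrite (@eq_top6 _ _ (fun c0 c1 c2 c3 c4 c5 => - (p y c4 c0 * (p v c1 c2 * p z c3 c5))));
    last by move=> a b c d e f; rewrite (p01 z d); ring.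
  rewrite top6N; congr (- _).
  rewrite (top6_s34 (fun c0 c1 c2 c3 c4 c5 => p y c3 c0 * (p v c1 c2 * p z c4 c5))).
  rewrite (top6_s23 (fun c0 c1 c2 c3 c4 c5 => p y c2 c0 * (p v c1 c3 * p z c4 c5))).
  rewrite (top6_s12 (fun c0 c1 c2 c3 c4 c5 => p y c1 c0 * (p v c2 c3 * p z c4 c5))).
  by rewrite (top6_s01 (fun c0 c1 c2 c3 c4 c5 => p y c0 c1 * (p v c2 c3 * p z c4 c5))) !opprK.
have -> : top6 (fun c0 c1 c2 c3 c4 c5 => p y c5 c0 * (p v c1 c2 * p c3 c4 z)) = - S y v z.
  rewrite (@eq_top6 _ _ (fun c0 c1 c2 c3 c4 c5 => p y c5 c0 * (p v c1 c2 * p z c3 c4)));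
    last by move=> a b c d e f; rewrite (pc d e).
  rewrite (top6_s45 (fun c0 c1 c2 c3 c4 c5 => p y c4 c0 * (p v c1 c2 * p z c3 c5))).
  rewrite (top6_s34 (fun c0 c1 c2 c3 c4 c5 => p y c3 c0 * (p v c1 c2 * p z c4 c5))).
  rewrite (top6_s23 (fun c0 c1 c2 c3 c4 c5 => p y c2 c0 * (p v c1 c3 * p z c4 c5))).
  rewrite (top6_s12 (fun c0 c1 c2 c3 c4 c5 => p y c1 c0 * (p v c2 c3 * p z c4 c5))).
  by rewrite (top6_s01 (fun c0 c1 c2 c3 c4 c5 => p y c0 c1 * (p v c2 c3 * p z c4 c5))) !opprK.
lra.
Qed.

Let S01 y v z : S v y z = S y v z.
Proof.
rewrite /S.
rewrite (@eq_top6 _ _ (fun a b c d e f => p y c d * (p v a b * p z e f)));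
  last by move=> *; ring.
rewrite (top6_s12 (fun a b c d e f => p y b d * (p v a c * p z e f))).
rewrite (top6_s01 (fun a b c d e f => p y a d * (p v b c * p z e f))).
rewrite (top6_s23 (fun a b c d e f => p y a c * (p v b d * p z e f))).
by rewrite (top6_s12 (fun a b c d e f => p y a b * (p v c d * p z e f))) !opprK.
Qed.

Let S12 y v z : S y z v = S y v z.
Proof.
rewrite /S.
rewrite (@eq_top6 _ _ (fun a b c d e f => p y a b * (p v e f * p z c d)));
  last by move=> *; ring.
rewrite (top6_s34 (fun a b c d e f => p y a b * (p v d f * p z c e))).
rewrite (top6_s23 (fun a b c d e f => p y a b * (p v c f * p z d e))).
rewrite (top6_s45 (fun a b c d e f => p y a b * (p v c e * p z d f))).
by rewrite (top6_s34 (fun a b c d e f => p y a b * (p v c d * p z e f))) !opprK.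
Qed.

Let T12 v y z : T v z y = - T v y z.
Proof. by rewrite -top6N; apply: eq_top6 => *; rewrite p12 mulNr. Qed.

(** T is skew in its last two arguments and S is symmetric. In the sum of the
    insertion identity over the cyclic permutations of v, y, z the terms T
    cancel, so S = 0, and then the identity says that T is skew in v, y. *)
Let T01 v y z : T y v z = - T v y z.
Proof.
have h1 := insertion v y z; have h2 := insertion v z y; have h3 := insertion y z v.
have e1 : S z v y = S y v z by rewrite S01 S12 S01.
have e2 : S z y v = S y v z by rewrite S01 S12.
rewrite e1 in h2; rewrite e2 in h3.
have := T12 z v y; have := T12 v y z; have := T12 y v z; lra.
Qed.

(** The form phi has type (3,0)+(0,3) with respect to K. *)
Lemma insert1_K_alt : alternating3 (insert1 K p).
Proof. by split=> i j k; rewrite !insert1_K; [rewrite (T01 i j)|rewrite (T12 i j)]; ring. Qed.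

Lemma insert1_Kl a i j : \sum_m K m i * p a m j = insert1 K p a i j.
Proof.
have [h _] := insert1_K_alt; rewrite h /insert1 -sumrN; apply: eq_bigr => m _.
by rewrite p01 mulrN.
Qed.

Lemma insert1_Kr a b i : \sum_m K m i * p a b m = insert1 K p a b i.
Proof.
have [_ h] := insert1_K_alt; rewrite h -insert1_Kl -sumrN; apply: eq_bigr => m _.
by rewrite p12 mulrN.
Qed.

Let top6_blocks (F : ord -> ord -> ord -> ord -> ord -> ord -> R) :
  top6 (fun a b c d e f => F d e f a b c) = - top6 F.
Proof.
rewrite (top6_s23 (fun a b c d e f => F c e f a b d)).
rewrite (top6_s12 (fun a b c d e f => F b e f a c d)).
rewrite (top6_s01 (fun a b c d e f => F a e f b c d)).
rewrite (top6_s34 (fun a b c d e f => F a d f b c e)).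
rewrite (top6_s23 (fun a b c d e f => F a c f b d e)).
rewrite (top6_s12 (fun a b c d e f => F a b f c d e)).
rewrite (top6_s45 (fun a b c d e f => F a b e c d f)).
rewrite (top6_s34 (fun a b c d e f => F a b d c e f)).
by rewrite (top6_s23 F) !opprK.
Qed.

(** The trace contracts p ^ p, which vanishes for a form of odd degree. *)
Lemma trace_stable_form : \tr K = 0.
Proof.
have -> : \tr K = - 12^-1 * top6 (fun a b c d e f => p a b c * p d e f).
  rewrite /mxtrace -top6Z; under eq_bigr do rewrite mxE -!top6Z.
  rewrite -top6_sum; apply: eq_top6 => c0 c1 c2 c3 c4 c5.
  rewrite -mulr_sumr; congr (_ * _); rewrite -(sum_delta c0 (fun m => p m c1 c2 * p c3 c4 c5)).
  by apply: eq_bigr => m _; rewrite eq_sym.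
set X := top6 _; suff : X = - X by lra.
by rewrite {2}/X -top6_blocks; apply: eq_top6 => *; rewrite mulrC.
Qed.

Let X (q r : ord -> ord -> ord -> R) a b :=
  top6 (fun c0 c1 c2 c3 c4 c5 => (a == c0)%:R * (q b c1 c2 * r c3 c4 c5)).

(** K acts as a derivation on the contraction that defines K itself, and kills
    it because tr K = 0. Together with the alternation over seven slots of
    p(K _, _, _) ^ p this expresses K^2 by the single number that contracts the
    latter six-form. *)
Lemma stable_form_square : exists mu, K *m K = mu%:M.
Proof.
set q := insert1 K p; have [q01 q12] := insert1_K_alt; rewrite -/q in q01 q12.
have sq1 a v : (K *m K) a v = - 12^-1 * X q p a v.
  rewrite mxE /X -top6Z; under eq_bigr do rewrite mxE -top6Z mulrC -top6Z.
  rewrite -top6_sum; apply: eq_top6 => c0 c1 c2 c3 c4 c5.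
  rewrite /q /insert1 mulr_suml !mulr_sumr; apply: eq_bigr => m _; ring.
have sq2 a v : (K *m K) a v = - 12^-1 *
    top6 (fun c0 c1 c2 c3 c4 c5 => K a c0 * (p v c1 c2 * p c3 c4 c5)).
  by rewrite mxE sum_K.
have der a v := top6_derivation K
  (fun c0 c1 c2 c3 c4 c5 => (a == c0)%:R * (p v c1 c2 * p c3 c4 c5)).
have {}der a v : (K *m K) a v + - 12^-1 * (X q p a v *+ 2 + X p q a v *+ 3) = 0.
  have := der a v; rewrite trace_stable_form mul0r.
  rewrite (@eq_top6 _ _ (fun c0 c1 c2 c3 c4 c5 => K a c0 * (p v c1 c2 * p c3 c4 c5)));
    last first.
    move=> *; rewrite -(sum_delta a (fun m => K m _ * _)).
    by apply: eq_bigr => m _; ring.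
  have pull (c : R) (f g : ord -> R) (d : R) : \sum_m f m * (c * (g m * d)) =
      c * ((\sum_m f m * g m) * d).
    by rewrite mulr_suml mulr_sumr; apply: eq_bigr => m _; ring.
  have pull' (c : R) (f g : ord -> R) (d : R) : \sum_m f m * (c * (d * g m)) =
      c * (d * (\sum_m f m * g m)).
    by rewrite !mulr_sumr; apply: eq_bigr => m _; ring.
  have -> : top6 (fun c0 c1 c2 c3 c4 c5 => \sum_m K m c1 *
      ((a == c0)%:R * (p v m c2 * p c3 c4 c5))) = X q p a v.
    by apply: eq_top6 => *; rewrite (pull _ _ (fun m => p v m _)) insert1_Kl.
  have -> : top6 (fun c0 c1 c2 c3 c4 c5 => \sum_m K m c2 *
      ((a == c0)%:R * (p v c1 m * p c3 c4 c5))) = X q p a v.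
    by apply: eq_top6 => *; rewrite (pull _ _ (fun m => p v _ m)) insert1_Kr.
  have -> : top6 (fun c0 c1 c2 c3 c4 c5 => \sum_m K m c3 *
      ((a == c0)%:R * (p v c1 c2 * p m c4 c5))) = X p q a v.
    by apply: eq_top6 => *; rewrite (pull' _ _ (fun m => p m _ _)).
  have -> : top6 (fun c0 c1 c2 c3 c4 c5 => \sum_m K m c4 *
      ((a == c0)%:R * (p v c1 c2 * p c3 m c5))) = X p q a v.
    by apply: eq_top6 => *; rewrite (pull' _ _ (fun m => p _ m _)) insert1_Kl.
  have -> : top6 (fun c0 c1 c2 c3 c4 c5 => \sum_m K m c5 *
      ((a == c0)%:R * (p v c1 c2 * p c3 c4 m))) = X p q a v.
    by apply: eq_top6 => *; rewrite (pull' _ _ (fun m => p _ _ m)) insert1_Kr.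
  by rewrite sq2 => h; lra.
have el a v : (v == a)%:R * top6 (fun a b c d e f => q a b c * p d e f) =
    X q p a v *+ 3 - X p q a v *+ 3.
  rewrite (top6_elementary v a).
  have e1 : top6 (fun c0 c1 c2 c3 c4 c5 => (a == c1)%:R * (q c0 v c2 * p c3 c4 c5)) = X q p a v.
    rewrite (top6_s01 (fun c0 c1 c2 c3 c4 c5 => (a == c0)%:R * (q c1 v c2 * p c3 c4 c5))).
    by rewrite -top6N; apply: eq_top6 => c0 c1 *; rewrite (q01 v c1); ring.
  have e2 : top6 (fun c0 c1 c2 c3 c4 c5 => (a == c2)%:R * (q c0 c1 v * p c3 c4 c5)) = X q p a v.
    rewrite (top6_s12 (fun c0 c1 c2 c3 c4 c5 => (a == c1)%:R * (q c0 c2 v * p c3 c4 c5))) -[RHS]e1 -top6N.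
    by apply: eq_top6 => c0 c1 c2 *; rewrite (q12 c0 v); ring.
  have e3 : top6 (fun c0 c1 c2 c3 c4 c5 => (a == c3)%:R * (q c0 c1 c2 * p v c4 c5)) = - X p q a v.
    by rewrite -top6_blocks; apply: eq_top6 => *; ring.
  have e4 : top6 (fun c0 c1 c2 c3 c4 c5 => (a == c4)%:R * (q c0 c1 c2 * p c3 v c5)) = - X p q a v.
    rewrite (top6_s34 (fun c0 c1 c2 c3 c4 c5 => (a == c3)%:R * (q c0 c1 c2 * p c4 v c5))) -[RHS]e3 -top6N.
    by apply: eq_top6 => c0 c1 c2 c3 c4 c5; rewrite (p01 v c4); ring.
  have e5 : top6 (fun c0 c1 c2 c3 c4 c5 => (a == c5)%:R * (q c0 c1 c2 * p c3 c4 v)) = - X p q a v.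
    rewrite (top6_s45 (fun c0 c1 c2 c3 c4 c5 => (a == c4)%:R * (q c0 c1 c2 * p c3 c5 v))) -[RHS]e4 -top6N.
    by apply: eq_top6 => c0 c1 c2 c3 c4 c5; rewrite (p12 c3 v); ring.
  by rewrite -/(X q p a v) e1 e2 e3 e4 e5; ring.
exists (- 72^-1 * top6 (fun a b c d e f => q a b c * p d e f)).
apply/matrixP => a v; rewrite [RHS]mxE -mulr_natr eq_sym.
by have := der a v; have := el a v; rewrite sq1; lra.
Qed.

(** The bivector dual to omega ^ omega, a multiple of the inverse of omega. *)
Definition omega_square (w : ord -> ord -> R) : 'M[R]_6 := \matrix_(a, b)
  top6 (fun c0 c1 c2 c3 c4 c5 => (a == c0)%:R * ((b == c1)%:R * (w c2 c3 * w c4 c5))).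

Section Primitive.
Variable w : ord -> ord -> R.
Hypothesis altw : alternating2 w.
Local Notation W := (\matrix_(i, j) w i j : 'M[R]_6).
Hypothesis unitW : W \in unitmx.
Hypothesis prim : forall k, \sum_i \sum_j invmx W i j * p i j k = 0.

Local Notation Q := (omega_square w).

Let pairs12 (F : ord -> ord -> ord -> ord -> ord -> ord -> R) :
  top6 (fun a b c d e f => F c d a b e f) = top6 F.
Proof.
rewrite (top6_s12 (fun a b c d e f => F b d a c e f)).
rewrite (top6_s01 (fun a b c d e f => F a d b c e f)).
rewrite (top6_s23 (fun a b c d e f => F a c b d e f)).
by rewrite (top6_s12 F) !opprK.
Qed.

Let pairs23 (F : ord -> ord -> ord -> ord -> ord -> ord -> R) :
  top6 (fun a b c d e f => F a b e f c d) = top6 F.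
Proof.
rewrite (top6_s34 (fun a b c d e f => F a b d f c e)).
rewrite (top6_s23 (fun a b c d e f => F a b c f d e)).
rewrite (top6_s45 (fun a b c d e f => F a b c e d f)).
by rewrite (top6_s34 F) !opprK.
Qed.

(** The Pfaffian analogue of A * adj A = det A: the right-hand side contracts
    omega^3. *)
Lemma omega_square_inverse :
  W *m Q = (- 6^-1 * top6 (fun a b c d e f => w a b * (w c d * w e f)))%:M.
Proof.
apply/matrixP => v b; rewrite [RHS]mxE -mulr_natr.
pose Y := top6 (fun c0 c1 c2 c3 c4 c5 => (b == c0)%:R * (w v c1 * (w c2 c3 * w c4 c5))).
have -> : (W *m Q) v b = - Y.
  rewrite mxE -(top6_s01 (fun c0 c1 c2 c3 c4 c5 => (b == c0)%:R * (w v c1 * (w c2 c3 * w c4 c5)))).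
  under eq_bigr do rewrite !mxE -top6Z.
  rewrite -top6_sum; apply: eq_top6 => c0 c1 c2 c3 c4 c5.
  rewrite -(sum_delta c0 (w v)) !(mulr_suml, mulr_sumr).
  by apply: eq_bigr => m _; rewrite eq_sym; ring.
have := top6_elementary v b (fun c0 c1 c2 c3 c4 c5 => w c0 c1 * (w c2 c3 * w c4 c5)).
have -> : top6 (fun c0 c1 c2 c3 c4 c5 => (b == c1)%:R * (w c0 v * (w c2 c3 * w c4 c5))) = Y.
  rewrite (top6_s01 (fun c0 c1 c2 c3 c4 c5 => (b == c0)%:R * (w c1 v * (w c2 c3 * w c4 c5)))).
  by rewrite -top6N; apply: eq_top6 => c0 c1 *; rewrite (altw v c1); ring.
have -> : top6 (fun c0 c1 c2 c3 c4 c5 => (b == c2)%:R * (w c0 c1 * (w v c3 * w c4 c5))) = Y.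
  by rewrite -[RHS]pairs12; apply: eq_top6 => *; ring.
have -> : top6 (fun c0 c1 c2 c3 c4 c5 => (b == c3)%:R * (w c0 c1 * (w c2 v * w c4 c5))) = Y.
  rewrite (top6_s23 (fun c0 c1 c2 c3 c4 c5 => (b == c2)%:R * (w c0 c1 * (w c3 v * w c4 c5)))).
  rewrite -[RHS]pairs12 -top6N.
  by apply: eq_top6 => c0 c1 c2 c3 *; rewrite (altw v c3); ring.
have e4 : top6 (fun c0 c1 c2 c3 c4 c5 => (b == c4)%:R * (w c0 c1 * (w c2 c3 * w v c5))) = Y.
  by rewrite -[RHS]pairs12 -[RHS]pairs23; apply: eq_top6 => *; ring.
have -> : top6 (fun c0 c1 c2 c3 c4 c5 => (b == c5)%:R * (w c0 c1 * (w c2 c3 * w c4 v))) = Y.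
  rewrite (top6_s45 (fun c0 c1 c2 c3 c4 c5 => (b == c4)%:R * (w c0 c1 * (w c2 c3 * w c5 v)))).
  rewrite -[RHS]e4 -top6N.
  by apply: eq_top6 => c0 c1 c2 c3 c4 c5; rewrite (altw v c5); ring.
by rewrite e4 -/Y; lra.
Qed.

(** The pairing of a 2-form with the inverse of omega is, up to a constant, its
    wedge product with omega ^ omega. *)
Let top6_traceless (al : ord -> ord -> R) : \sum_i \sum_j invmx W i j * al i j = 0 ->
  top6 (fun c0 c1 c2 c3 c4 c5 => al c0 c1 * (w c2 c3 * w c4 c5)) = 0.
Proof.
move=> h; have hmu := omega_square_inverse; set mu := (X in _ = X%:M) in hmu.
have QE : Q = mu *: invmx W by rewrite -[LHS](mulKmx unitW) hmu mul_mx_scalar.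
transitivity (\sum_i \sum_j Q i j * al i j).
  have E i j : Q i j * al i j = top6 (fun c0 c1 c2 c3 c4 c5 =>
      (i == c0)%:R * ((j == c1)%:R * (al i j * (w c2 c3 * w c4 c5)))).
    by rewrite mxE mulrC -top6Z; apply: eq_top6 => *; ring.
  rewrite (eq_bigr (fun i => top6 (fun c0 c1 c2 c3 c4 c5 => \sum_j
      (i == c0)%:R * ((j == c1)%:R * (al i j * (w c2 c3 * w c4 c5)))))); last first.
    by move=> i _; rewrite top6_sum; apply: eq_bigr => j _; rewrite E.
  rewrite -top6_sum; apply: eq_top6 => c0 c1 c2 c3 c4 c5.
  rewrite -[LHS](sum_delta c0 (fun i => al i c1 * (w c2 c3 * w c4 c5))); apply: eq_bigr => i _.
  rewrite -mulr_sumr (eq_sym i); congr (_ * _).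
  rewrite -[LHS](sum_delta c1 (fun j => al i j * (w c2 c3 * w c4 c5))); apply: eq_bigr => k _.
  by rewrite (eq_sym k).
transitivity (mu * \sum_i \sum_j invmx W i j * al i j); last by rewrite h mulr0.
rewrite QE mulr_sumr; apply: eq_bigr => i _.
by rewrite mulr_sumr; apply: eq_bigr => j _; rewrite mxE mulrA.
Qed.

Let primz z : \sum_i \sum_j invmx W i j * p z i j = 0.
Proof. by rewrite -[RHS](prim z); do 2 (apply: eq_bigr => ? _); rewrite pc. Qed.

(** Inserting z in the vanishing alternation of omega ^ omega ^ p over seven
    slots leaves a multiple of omega(z, _) ^ omega ^ p, since Lambda p = 0. *)
Let wedge_row z : top6 (fun c0 c1 c2 c3 c4 c5 => w z c0 * (w c1 c2 * p c3 c4 c5)) = 0.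
Proof.
set L := top6 _.
have M0 : top6 (fun c0 c1 c2 c3 c4 c5 => w c0 c1 * (w c2 c3 * p z c4 c5)) = 0.
  rewrite -(top6_traceless (primz z)).
  rewrite -[RHS]pairs12 -[RHS]pairs23; apply: eq_top6 => *; ring.
have := top6_insert (fun d0 d1 d2 d3 d4 d5 d6 => w d0 d1 * (w d2 d3 * p d4 d5 d6)) z.
rewrite -/L.
have -> : top6 (fun c0 c1 c2 c3 c4 c5 => w c0 z * (w c1 c2 * p c3 c4 c5)) = - L.
  by rewrite -top6N; apply: eq_top6 => c0 *; rewrite (altw z c0) mulNr.
have -> : top6 (fun c0 c1 c2 c3 c4 c5 => w c1 c0 * (w z c2 * p c3 c4 c5)) = - L.
  rewrite (top6_s12 (fun c0 c1 c2 c3 c4 c5 => w c2 c0 * (w z c1 * p c3 c4 c5))).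
  rewrite (top6_s01 (fun c0 c1 c2 c3 c4 c5 => w c2 c1 * (w z c0 * p c3 c4 c5))).
  rewrite (top6_s12 (fun c0 c1 c2 c3 c4 c5 => w c1 c2 * (w z c0 * p c3 c4 c5))) opprK.
  by congr (- _); apply: eq_top6 => *; ring.
have -> : top6 (fun c0 c1 c2 c3 c4 c5 => w c2 c0 * (w c1 z * p c3 c4 c5)) = - L.
  rewrite (top6_s01 (fun c0 c1 c2 c3 c4 c5 => w c2 c1 * (w c0 z * p c3 c4 c5))).
  by rewrite -!top6N; apply: eq_top6 => c0 c1 c2 *; rewrite (altw z c0) (altw c1 c2); ring.
have e3 : top6 (fun c0 c1 c2 c3 c4 c5 => w c3 c0 * (w c1 c2 * p z c4 c5)) = 0.
  rewrite (top6_s23 (fun c0 c1 c2 c3 c4 c5 => w c2 c0 * (w c1 c3 * p z c4 c5))).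
  rewrite (top6_s12 (fun c0 c1 c2 c3 c4 c5 => w c1 c0 * (w c2 c3 * p z c4 c5))).
  rewrite (top6_s01 (fun c0 c1 c2 c3 c4 c5 => w c0 c1 * (w c2 c3 * p z c4 c5))).
  by rewrite M0 !oppr0.
have e4 : top6 (fun c0 c1 c2 c3 c4 c5 => w c4 c0 * (w c1 c2 * p c3 z c5)) = 0.
  rewrite (top6_s34 (fun c0 c1 c2 c3 c4 c5 => w c3 c0 * (w c1 c2 * p c4 z c5))) -[RHS]e3 -top6N.
  by apply: eq_top6 => c0 c1 c2 c3 c4 c5; rewrite (p01 z c4); ring.
have e5 : top6 (fun c0 c1 c2 c3 c4 c5 => w c5 c0 * (w c1 c2 * p c3 c4 z)) = 0.
  rewrite (top6_s45 (fun c0 c1 c2 c3 c4 c5 => w c4 c0 * (w c1 c2 * p c3 c5 z))) -[RHS]e4 -top6N.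
  by apply: eq_top6 => c0 c1 c2 c3 c4 c5; rewrite (p12 c3 z); ring.
by rewrite e3 e4 e5; lra.
Qed.

(** This is omega ^ phi = 0, obtained from the covectors omega(z, _), which span
    because omega is nondegenerate. *)
Lemma primitive_wedge (th : ord -> R) :
  top6 (fun c0 c1 c2 c3 c4 c5 => th c0 * (w c1 c2 * p c3 c4 c5)) = 0.
Proof.
pose t := (\row_c th c) *m invmx W.
have thE c : th c = \sum_z t 0 z * w z c.
  have : (t *m W) 0 c = th c by rewrite mulmxKV// mxE.
  by rewrite mxE => <-; apply: eq_bigr => z _; rewrite [W _ _]mxE.
transitivity (\sum_z t 0 z *
    top6 (fun c0 c1 c2 c3 c4 c5 => w z c0 * (w c1 c2 * p c3 c4 c5))); last first.
  by rewrite big1// => z _; rewrite wedge_row mulr0.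
under eq_bigr => z _ do rewrite -top6Z.
rewrite -top6_sum; apply: eq_top6 => c0 c1 c2 c3 c4 c5.
by rewrite thE mulr_suml; apply: eq_bigr => z _; rewrite -!mulrA.
Qed.

Let A u v := top6 (fun c0 c1 c2 c3 c4 c5 => w u c0 * (p v c1 c2 * p c3 c4 c5)).
Let C u v := top6 (fun c0 c1 c2 c3 c4 c5 => w c0 c1 * (p v c2 c3 * p u c4 c5)).

(** Inserting u in omega ^ p(v, _, _) ^ p: the terms with the factor omega ^ p
    vanish. As C is symmetric, A is symmetric too. *)
Let AC u v : A u v *+ 2 + C u v *+ 3 = 0.
Proof.
have := top6_insert (fun d0 d1 d2 d3 d4 d5 d6 => w d0 d1 * (p v d2 d3 * p d4 d5 d6)) u.
rewrite -/(A u v).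
have -> : top6 (fun c0 c1 c2 c3 c4 c5 => w c0 u * (p v c1 c2 * p c3 c4 c5)) = - A u v.
  by rewrite -top6N; apply: eq_top6 => c0 *; rewrite (altw u c0) mulNr.
have e1 : top6 (fun c0 c1 c2 c3 c4 c5 => w c1 c0 * (p v u c2 * p c3 c4 c5)) = 0.
  rewrite (top6_s12 (fun c0 c1 c2 c3 c4 c5 => w c2 c0 * (p v u c1 * p c3 c4 c5))).
  rewrite (top6_s01 (fun c0 c1 c2 c3 c4 c5 => w c2 c1 * (p v u c0 * p c3 c4 c5))).
  rewrite opprK (@eq_top6 _ _ (fun c0 c1 c2 c3 c4 c5 => - (p v u c0 * (w c1 c2 * p c3 c4 c5)))).
    by rewrite top6N primitive_wedge oppr0.
  by move=> c0 c1 c2 *; rewrite (altw c1 c2); ring.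
have e2 : top6 (fun c0 c1 c2 c3 c4 c5 => w c2 c0 * (p v c1 u * p c3 c4 c5)) = 0.
  rewrite (top6_s12 (fun c0 c1 c2 c3 c4 c5 => w c1 c0 * (p v c2 u * p c3 c4 c5))) -[RHS]e1 -top6N.
  by apply: eq_top6 => c0 c1 c2 *; rewrite (p12 v u c2); ring.
have e3 : top6 (fun c0 c1 c2 c3 c4 c5 => w c3 c0 * (p v c1 c2 * p u c4 c5)) = - C u v.
  rewrite (top6_s23 (fun c0 c1 c2 c3 c4 c5 => w c2 c0 * (p v c1 c3 * p u c4 c5))).
  rewrite (top6_s12 (fun c0 c1 c2 c3 c4 c5 => w c1 c0 * (p v c2 c3 * p u c4 c5))).
  by rewrite (top6_s01 (fun c0 c1 c2 c3 c4 c5 => w c0 c1 * (p v c2 c3 * p u c4 c5))) opprK.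
have e4 : top6 (fun c0 c1 c2 c3 c4 c5 => w c4 c0 * (p v c1 c2 * p c3 u c5)) = - C u v.
  rewrite (top6_s34 (fun c0 c1 c2 c3 c4 c5 => w c3 c0 * (p v c1 c2 * p c4 u c5))) -[RHS]e3 -top6N.
  by apply: eq_top6 => c0 c1 c2 c3 c4 c5; rewrite (p01 u c4); ring.
have e5 : top6 (fun c0 c1 c2 c3 c4 c5 => w c5 c0 * (p v c1 c2 * p c3 c4 u)) = - C u v.
  rewrite (top6_s45 (fun c0 c1 c2 c3 c4 c5 => w c4 c0 * (p v c1 c2 * p c3 c5 u))) -[RHS]e4 -top6N.
  by apply: eq_top6 => c0 c1 c2 c3 c4 c5; rewrite (p12 c3 u); ring.
by rewrite e1 e2 e3 e4 e5; lra.
Qed.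

Lemma stable_form_symmetric : (W *m K)^T = W *m K.
Proof.
have WKE u v : (W *m K) u v = - 12^-1 * A u v.
  by rewrite mxE; under eq_bigr do rewrite [W _ _]mxE; rewrite sum_K.
have CC u v : C v u = C u v.
  by rewrite -[LHS]pairs23; apply: eq_top6 => *; ring.
apply/matrixP => u v; rewrite mxE !WKE.
by have := AC u v; have := AC v u; rewrite CC; lra.
Qed.

End Primitive.
End HitchinAlgebra.

(** * Components of forms and wedge products *)

Section Components.
Variable R : realType.
Local Notation ord := 'I_6.

Definition comp2 (al : tensor R 2) (i j : ord) : R := al [tuple i; j].
Definition comp3 (al : tensor R 3) (i j k : ord) : R := al [tuple i; j; k].

Lemma mktuple1 (T : Type) (F : 'I_1 -> T) : [tuple F m | m < 1] = [tuple F ord0].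
Proof. by apply: eq_from_tnth => i; rewrite tnth_mktuple (ord1 i). Qed.

Lemma mktuple2 (T : Type) (F : 'I_2 -> T) : [tuple F m | m < 2] = [tuple F ord0; F ord_max].
Proof.
apply: eq_from_tnth => -[[|[|//]] h]; rewrite tnth_mktuple /tnth /=;
  by congr F; apply: val_inj.
Qed.

Lemma mktuple3 (T : Type) (F : 'I_3 -> T) :
  [tuple F m | m < 3] = [tuple F ord0; F (lift ord0 ord0); F ord_max].
Proof.
apply: eq_from_tnth => -[[|[|[|//]]] h]; rewrite tnth_mktuple /tnth /=;
  by congr F; apply: val_inj.
Qed.

Lemma tuple2E (T : Type) (I : 2.-tuple T) : I = [tuple tnth I ord0; tnth I ord_max].
Proof. by rewrite -(mktuple2 (tnth I)); apply: eq_from_tnth => i; rewrite tnth_mktuple. Qed.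

Lemma alternating_comp2 (al : tensor R 2) : Defs.alternating al -> alternating2 (comp2 al).
Proof.
move=> h i j; have := h (tperm ord0 ord_max) [tuple i; j].
rewrite odd_tperm /= expr1 mulN1r => <-; congr (al _).
by rewrite mktuple2 tpermL tpermR.
Qed.

Lemma alternating_comp3 (al : tensor R 3) : Defs.alternating al -> alternating3 (comp3 al).
Proof.
move=> h; split=> i j k.
  have := h (tperm ord0 (lift ord0 ord0)) [tuple i; j; k].
  rewrite odd_tperm /= expr1 mulN1r => <-; congr (al _).
  by rewrite mktuple3 tpermL tpermR tpermD.
have := h (tperm (lift ord0 ord0) ord_max) [tuple i; j; k].
rewrite odd_tperm /= expr1 mulN1r => <-; congr (al _).
by rewrite mktuple3 tpermL tpermR tpermD.
Qed.

Lemma big_tuple_cons (T : finType) n (F : n.+1.-tuple T -> R) :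
  \sum_I F I = \sum_i \sum_(J : n.-tuple T) F [tuple of i :: J].
Proof.
rewrite pair_big /= (reindex (fun p : T * n.-tuple T => [tuple of p.1 :: p.2]))//=.
exists (fun I : n.+1.-tuple T => (thead I, [tuple of behead I])) => [[i J] _|I _] /=.
  by rewrite theadE; congr (_, _); apply: val_inj.
by rewrite [RHS]tuple_eta.
Qed.

Lemma big_tuple0 (T : finType) (F : 0.-tuple T -> R) : \sum_I F I = F [tuple].
Proof. by rewrite (big_pred1 [tuple]) // => I /=; apply/esym/eqP; rewrite [I]tuple0. Qed.

Lemma big_tuple2 (T : finType) (F : 2.-tuple T -> R) :
  \sum_I F I = \sum_i \sum_j F [tuple i; j].
Proof.
rewrite big_tuple_cons; apply: eq_bigr => i _; rewrite big_tuple_cons.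
by apply: eq_bigr => j _; rewrite big_tuple0; congr F; apply: val_inj.
Qed.

Lemma big_tuple3 (T : finType) (F : 3.-tuple T -> R) :
  \sum_I F I = \sum_i \sum_j \sum_k F [tuple i; j; k].
Proof.
rewrite big_tuple_cons; apply: eq_bigr => i _; rewrite big_tuple2.
by do 2 (apply: eq_bigr => ? _); congr F; apply: val_inj.
Qed.

(** Alternation is idempotent: alternating over a sub-block of slots of a
    full alternation only contributes the order of the block's symmetric
    group. *)
Lemma sum_perm_absorb m (ext : 'S_m -> 'S_6) (H : 'S_6 -> R) :
  (forall s, odd_perm (ext s) = odd_perm s) ->
  \sum_(s : 'S_6) (-1) ^+ s * (\sum_(t : 'S_m) (-1) ^+ t * H (ext t * s)%g) =
  (m`!)%:R * \sum_(s : 'S_6) (-1) ^+ s * H s.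
Proof.
move=> ho; under eq_bigr do rewrite mulr_sumr.
rewrite exchange_big /= mulr_natl -card_Sn -sumr_const; apply: eq_bigr => t _.
rewrite [RHS](reindex_inj (mulgI (ext t))); apply: eq_bigr => s _.
by rewrite odd_permM ho signr_addb mulrA [_ ^+ s * _]mulrC.
Qed.

Lemma top_coef_wedge3 (al : tensor R 1) (be : tensor R 2) (ga : tensor R 3) :
  top_coef (wedge al (wedge be ga)) = 12^-1 * top6 (fun a b c d e f =>
    al [tuple a] * (be [tuple b; c] * ga [tuple d; e; f])).
Proof.
rewrite /top6 topE /top_coef /wedge.
pose H (s : 'S_6) := curry6 (fun a b c d e f =>
    al [tuple a] * (be [tuple b; c] * ga [tuple d; e; f])) [tuple s m | m < 6].
transitivity ((1`! * 5`!)%:R^-1 * ((2`! * 3`!)%:R^-1 *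
    \sum_(s : 'S_6) (-1) ^+ s * \sum_(t : 'S_5) (-1) ^+ t * H (lift_perm ord0 ord0 t * s)%g)).
  congr (_ * _); rewrite mulr_sumr; apply: eq_bigr => s _.
  rewrite -mulrA [X in _ * X = _]mulrCA [LHS]mulrCA; congr (_ * (_ * _)).
  rewrite mulr_sumr; apply: eq_bigr => t _; rewrite -mulrA [LHS]mulrCA; congr (_ * _).
  rewrite /H /curry6 mktuple1 mktuple2 mktuple3 !tnth_mktuple !tnth_ord_tuple.
  have o0E : o0 = ord0 by exact: val_inj.
  rewrite !permM o0E lift_perm_id.
  have E (i : 'I_6) (j : 'I_5) : i = lift ord0 j -> lift_perm ord0 ord0 t i = rshift 1 (t j).
    by move=> ->; rewrite lift_perm_lift; apply: val_inj.
  rewrite (E o1 (@lshift 2 3 ord0)); last exact: val_inj.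
  rewrite (E o2 (@lshift 2 3 ord_max)); last exact: val_inj.
  rewrite (E o3 (@rshift 2 3 ord0)); last exact: val_inj.
  rewrite (E o4 (@rshift 2 3 (lift ord0 ord0))); last exact: val_inj.
  rewrite (E o5 (@rshift 2 3 ord_max)); last exact: val_inj.
  by rewrite (_ : @lshift 1 5 ord0 = ord0)//; exact: val_inj.
rewrite sum_perm_absorb; last by move=> t; rewrite odd_lift_perm.
rewrite (_ : 5`! = 120%N)// (_ : (1`! * 120 = 120)%N)// (_ : (2`! * 3`! = 12)%N)//.
by field.
Qed.

Lemma top_coef_wedge222 (al be ga : tensor R 2) :
  top_coef (wedge al (wedge be ga)) = 8^-1 * top6 (fun a b c d e f =>
    al [tuple a; b] * (be [tuple c; d] * ga [tuple e; f])).
Proof.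
rewrite /top6 topE /top_coef /wedge.
pose H (s : 'S_6) := curry6 (fun a b c d e f =>
    al [tuple a; b] * (be [tuple c; d] * ga [tuple e; f])) [tuple s m | m < 6].
pose ext (t : 'S_4) : 'S_6 := lift_perm ord0 ord0 (lift_perm ord0 ord0 t).
transitivity ((2`! * 4`!)%:R^-1 * ((2`! * 2`!)%:R^-1 *
    \sum_(s : 'S_6) (-1) ^+ s * \sum_(t : 'S_4) (-1) ^+ t * H (ext t * s)%g)).
  congr (_ * _); rewrite mulr_sumr; apply: eq_bigr => s _.
  rewrite -mulrA [X in _ * X = _]mulrCA [LHS]mulrCA; congr (_ * (_ * _)).
  rewrite mulr_sumr; apply: eq_bigr => t _; rewrite -mulrA [LHS]mulrCA; congr (_ * _).
  rewrite /H /curry6 !mktuple2 !tnth_mktuple !tnth_ord_tuple.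
  rewrite !permM.
  have E (i : 'I_6) (j : 'I_4) : i = lift ord0 (lift ord0 j) -> ext t i = rshift 2 (t j).
    by move=> ->; rewrite /ext !lift_perm_lift; apply: val_inj.
  rewrite (_ : ext t o0 = @lshift 2 4 ord0); last first.
    by rewrite (_ : o0 = ord0) ?lift_perm_id; apply: val_inj.
  rewrite (_ : ext t o1 = @lshift 2 4 ord_max); last first.
    rewrite (_ : o1 = lift ord0 ord0) ?lift_perm_lift ?lift_perm_id; last exact: val_inj.
    exact: val_inj.
  rewrite (E o2 (@lshift 2 2 ord0)); last exact: val_inj.
  rewrite (E o3 (@lshift 2 2 ord_max)); last exact: val_inj.
  rewrite (E o4 (@rshift 2 2 ord0)); last exact: val_inj.
  by rewrite (E o5 (@rshift 2 2 ord_max)); last exact: val_inj.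
rewrite sum_perm_absorb; last by move=> t; rewrite !odd_lift_perm.
rewrite (_ : 4`! = 24%N)// (_ : (2`! * 24 = 48)%N)// (_ : (2`! * 2`! = 4)%N)//.
by field.
Qed.

Lemma hitchin_KE (ph : tensor R 3) : hitchin_K ph = stable_form (comp3 ph).
Proof.
apply/matrixP => a b; rewrite !mxE top_coef_wedge3 -mulNr; congr (_ * _).
by apply: eq_top6 => c0 c1 c2 c3 c4 c5; rewrite /dx /tnth/= eq_sym.
Qed.

End Components.

(** * The Pfaffian *)

Section AlternatingTop.
Variable R : realFieldType.
Local Notation ord := 'I_6.
Implicit Types (I J : 6.-tuple ord) (G : 6.-tuple ord -> R).

Lemma permuteM (s t : 'S_6) I : permute (s * t) I = permute s (permute t I).
Proof. by apply: eq_from_tnth => i; rewrite !tnth_mktuple permM. Qed.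

Lemma alternating_permute G : (forall i j I, i != j -> G (permute (tperm i j) I) = - G I) ->
  forall (s : 'S_6) I, G (permute s I) = (-1) ^+ s * G I.
Proof.
move=> h s; have [ts -> dts] := prod_tpermP s.
elim: ts dts => [|[i j] ts IH] /= => [_|/andP[ij dts]] I.
  rewrite big_nil odd_perm1 mul1r; congr G.
  by apply: eq_from_tnth => i; rewrite tnth_mktuple perm1.
rewrite big_cons permuteM h//= IH// odd_permM odd_tperm ij /=.
by rewrite signrN mulNr.
Qed.

Lemma levi_civita_permute (s : 'S_6) I :
  levi_civita (permute s I) = (-1) ^+ s * levi_civita I :> R.
Proof.
rewrite -det_perm -det_mulmx; congr (\det _); apply/matrixP => r c.
rewrite -row_permE !mxE tnth_mktuple; congr (_%:R).
Qed.

Lemma levi_civita_ord : levi_civita (ord_tuple 6) = 1 :> R.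
Proof.
rewrite -[RHS](det1 _ 6); congr (\det _); apply/matrixP => r c.
by rewrite !mxE tnth_ord_tuple.
Qed.

(** Six-forms in dimension six are multiples of the Levi-Civita symbol: an index
    tuple is a permutation or has a repeated entry. *)
Lemma alternating_levi_civita G :
  (forall i j I, i != j -> G (permute (tperm i j) I) = - G I) ->
  forall I, G I = G (ord_tuple 6) * levi_civita I.
Proof.
move=> h I; have [/injectiveP inj|/injectivePn[i [j ij eij]]] := boolP (injectiveb (tnth I)).
  have -> : I = permute (perm inj) (ord_tuple 6).
    by apply: eq_from_tnth => i; rewrite tnth_mktuple tnth_ord_tuple permE.
  rewrite (alternating_permute h (perm inj) (ord_tuple 6)).
  by rewrite (levi_civita_permute (perm inj) (ord_tuple 6)) levi_civita_ord mulr1 mulrC.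
have fixI : permute (tperm i j) I = I.
  by apply: eq_from_tnth => k; rewrite tnth_mktuple; case: tpermP => // ->.
have -> : levi_civita I = 0 :> R.
  have := levi_civita_permute (tperm i j) I; rewrite fixI odd_tperm ij; lra.
by have := h _ _ I ij; rewrite fixI; lra.
Qed.

Lemma top_levi_civita : top (@levi_civita R) = 720.
Proof.
rewrite topE (eq_bigr (fun _ => 1)); last first.
  move=> s _; have -> : [tuple s m | m < 6] = permute s (ord_tuple 6).
    by apply: eq_from_tnth => i; rewrite !tnth_mktuple tnth_ord_tuple.
  by rewrite (levi_civita_permute s (ord_tuple 6)) levi_civita_ord mulr1 -signr_addb addbb.
by rewrite sumr_const card_Sn.
Qed.

Definition pfaffian4 (w : ord -> ord -> R) a b c d :=
  w a b * w c d - w a c * w b d + w a d * w b c.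

(** The sum over the fifteen perfect matchings of the six slots; at the
    indices 0, ..., 5 it is the Pfaffian of the skew matrix w. *)
Definition pfaffian6 (w : ord -> ord -> R) a b c d e f :=
  w a b * pfaffian4 w c d e f - w a c * pfaffian4 w b d e f + w a d * pfaffian4 w b c e f
  - w a e * pfaffian4 w b c d f + w a f * pfaffian4 w b c d e.

Definition pfaffian w := pfaffian6 w o0 o1 o2 o3 o4 o5.

Section Skew.
Variable w : ord -> ord -> R.
Hypothesis altw : alternating2 w.

Lemma pfaffian6_tperm i j I : i != j ->
  curry6 (pfaffian6 w) (permute (tperm i j) I) = - curry6 (pfaffian6 w) I.
Proof.
have sk x y : w (tnth I x) (tnth I y) = - w (tnth I y) (tnth I x) by exact: altw.
have sym k l : curry6 (pfaffian6 w) (permute (tperm k l) I) = - curry6 (pfaffian6 w) I ->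
   curry6 (pfaffian6 w) (permute (tperm l k) I) = - curry6 (pfaffian6 w) I.
  by rewrite tpermC.
wlog ij : i j / (i < j)%N => [H|].
  have [ij|ij|/val_inj ->] := ltngtP i j; [exact: H| |by rewrite eqxx].
  by move=> ne; apply: sym; apply: H => //; rewrite eq_sym.
move=> _; move: i j ij; do 2 apply: ord6P => //; move=> _;
  rewrite /curry6 !tnth_mktuple !permE /= /pfaffian6 /pfaffian4;
  rewrite ?(sk o1 o0) ?(sk o2 o0) ?(sk o3 o0) ?(sk o4 o0) ?(sk o5 o0) ?(sk o2 o1) ?(sk o3 o1)
    ?(sk o4 o1) ?(sk o5 o1) ?(sk o3 o2) ?(sk o4 o2) ?(sk o5 o2) ?(sk o4 o3) ?(sk o5 o3)
    ?(sk o5 o4); ring.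
Qed.

Lemma pfaffian6_levi_civita a b c d e f :
  pfaffian6 w a b c d e f = pfaffian w * levi_civita [tuple a; b; c; d; e; f].
Proof.
have := alternating_levi_civita (fun i j I => @pfaffian6_tperm i j I) [tuple a; b; c; d; e; f].
by rewrite /curry6 !tnth_ord_tuple => <-.
Qed.

(** Each of the fifteen matchings contributes the same contraction, and a
    full contraction of the Levi-Civita symbol with itself is 6! = 720. *)
Lemma top6_cube : top6 (fun a b c d e f => w a b * (w c d * w e f)) = 48 * pfaffian w.
Proof.
set S := top6 _.
have P4 : top6 (fun a b c d e f => w a b * pfaffian4 w c d e f) = 3 * S.
  have e1 : top6 (fun a b c d e f => w a b * (w c e * w d f)) = - S.
    by rewrite (top6_s34 (fun a b c d e f => w a b * (w c d * w e f))).
  have e2 : top6 (fun a b c d e f => w a b * (w c f * w d e)) = S.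
    rewrite (top6_s45 (fun a b c d e f => w a b * (w c e * w d f))) e1; ring.
  rewrite (@eq_top6 _ _ (fun a b c d e f => (w a b * (w c d * w e f) + -1 * (w a b * (w c e * w d f)))
    + w a b * (w c f * w d e))); last by move=> *; rewrite /pfaffian4; ring.
  by rewrite !top6D top6Z e1 e2 -/S; ring.
have e1 : top6 (fun a b c d e f => w a c * pfaffian4 w b d e f) = - (3 * S).
  by rewrite -P4 (top6_s12 (fun a b c d e f => w a b * pfaffian4 w c d e f)).
have e2 : top6 (fun a b c d e f => w a d * pfaffian4 w b c e f) = 3 * S.
  by rewrite (top6_s23 (fun a b c d e f => w a c * pfaffian4 w b d e f)) e1 opprK.
have e3 : top6 (fun a b c d e f => w a e * pfaffian4 w b c d f) = - (3 * S).
  by rewrite (top6_s34 (fun a b c d e f => w a d * pfaffian4 w b c e f)) e2.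
have e4 : top6 (fun a b c d e f => w a f * pfaffian4 w b c d e) = 3 * S.
  by rewrite (top6_s45 (fun a b c d e f => w a e * pfaffian4 w b c d f)) e3 opprK.
have : top6 (pfaffian6 w) = 15 * S.
  rewrite (@eq_top6 _ _ (fun a b c d e f => w a b * pfaffian4 w c d e f
    + -1 * (w a c * pfaffian4 w b d e f) + w a d * pfaffian4 w b c e f
    + -1 * (w a e * pfaffian4 w b c d f) + w a f * pfaffian4 w b c d e)); last first.
    by move=> *; rewrite /pfaffian6; ring.
  by rewrite !top6D !top6Z P4 e1 e2 e3 e4; ring.
have -> : top6 (pfaffian6 w) = pfaffian w * 720.
  rewrite -top_levi_civita /top6 /top mulr_sumr; apply: eq_bigr => I _.
  rewrite /curry6 pfaffian6_levi_civita mulrCA; congr (_ * (_ * levi_civita _)).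
  apply: eq_from_tnth; apply: ord6P; by rewrite /tnth.
lra.
Qed.

End Skew.

(** Laplace expansion along first rows, over natural-number indices so that it
    evaluates to a polynomial in the entries. *)
Fixpoint laplace n (f : nat -> nat -> R) : R :=
  match n with
  | 0 => 1
  | m.+1 => foldr (fun j acc =>
      (if odd j then - f 0%N j else f 0%N j) *
        laplace m (fun i k => f i.+1 (if Nat.leb j k then k.+1 else k)) + acc) 0 (iota 0 m.+1)
  end.

Lemma det_laplace n (f : nat -> nat -> R) : \det (\matrix_(i < n, j < n) f i j) = laplace n f.
Proof.
elim: n f => [|n IH] f; first by rewrite det_mx00.
rewrite (expand_det_row _ ord0).
transitivity (\sum_(j <- iota 0 n.+1) (if odd j then - f 0%N j else f 0%N j) *
  laplace n (fun i k => f i.+1 (if Nat.leb j k then k.+1 else k))).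
  rewrite -[iota 0 n.+1]/(index_iota 0 n.+1) big_mkord; apply: eq_bigr => j _.
  rewrite mxE -IH /cofactor add0n [LHS]mulrA; apply: (congr2 *%R); last congr (\det _).
    by rewrite mulrC -signr_odd; case: odd; rewrite ?mulN1r ?mul1r.
  by apply/matrixP => i k; rewrite !mxE /= /bump leq0n add1n (_ : Nat.leb j k = (j <= k)%N); [case: leqP|
    elim: (j : nat) (k : nat) => [|a IHa] [|b] //=].
rewrite /= big_cons; congr (_ + _).
by elim: (iota _ _) => [|j s IHs]; [rewrite big_nil|rewrite big_cons IHs].
Qed.

(** A polynomial identity in the fifteen independent entries. *)
Lemma det_skew (w : ord -> ord -> R) : alternating2 w ->
  \det (\matrix_(i, j) w i j) = pfaffian w ^+ 2.
Proof.
move=> altw.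
pose f (i j : nat) : R := match i, j with
  | 0%N, 1%N => w o0 o1 | 0%N, 2%N => w o0 o2 | 0%N, 3%N => w o0 o3 | 0%N, 4%N => w o0 o4 | 0%N, 5%N => w o0 o5
  | 1%N, 0%N => - w o0 o1 | 1%N, 2%N => w o1 o2 | 1%N, 3%N => w o1 o3 | 1%N, 4%N => w o1 o4 | 1%N, 5%N => w o1 o5
  | 2%N, 0%N => - w o0 o2 | 2%N, 1%N => - w o1 o2 | 2%N, 3%N => w o2 o3 | 2%N, 4%N => w o2 o4 | 2%N, 5%N => w o2 o5
  | 3%N, 0%N => - w o0 o3 | 3%N, 1%N => - w o1 o3 | 3%N, 2%N => - w o2 o3 | 3%N, 4%N => w o3 o4 | 3%N, 5%N => w o3 o5
  | 4%N, 0%N => - w o0 o4 | 4%N, 1%N => - w o1 o4 | 4%N, 2%N => - w o2 o4 | 4%N, 3%N => - w o3 o4 | 4%N, 5%N => w o4 o5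
  | 5%N, 0%N => - w o0 o5 | 5%N, 1%N => - w o1 o5 | 5%N, 2%N => - w o2 o5 | 5%N, 3%N => - w o3 o5 | 5%N, 4%N => - w o4 o5
  | _, _ => 0
  end.
have w0 i : w i i = 0 by have := altw i i; lra.
have -> : \matrix_(i, j) w i j = \matrix_(i < 6, j < 6) f i j.
  apply/matrixP => i j; rewrite !mxE; move: i j.
  by do 2 apply: ord6P; rewrite /f/= ?w0//; exact: altw.
rewrite det_laplace /pfaffian /pfaffian6 /pfaffian4.
cbv [laplace foldr iota odd negb Nat.leb f].
move: (w o0 o1) (w o0 o2) (w o0 o3) (w o0 o4) (w o0 o5) (w o1 o2) (w o1 o3) (w o1 o4) (w o1 o5)
  (w o2 o3) (w o2 o4) (w o2 o5) (w o3 o4) (w o3 o5) (w o4 o5) => *.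
ring.
Qed.

End AlternatingTop.

(** * The almost-complex structure, the metric and the star operator at a point *)

Section Slots.
Variable R : realFieldType.
Local Notation ord := 'I_6.
Implicit Types (p : ord -> ord -> ord -> R) (A B : 'M[R]_6).

Definition insert2 A p i j k := \sum_m A m j * p i m k.
Definition insert3 A p i j k := \sum_m A m k * p i j m.

Lemma eq_insert1 A p p' i j k : (forall i j k, p i j k = p' i j k) ->
  insert1 A p i j k = insert1 A p' i j k.
Proof. by move=> h; apply: eq_bigr => m _; rewrite h. Qed.

Lemma eq_insert2 A p p' i j k : (forall i j k, p i j k = p' i j k) ->
  insert2 A p i j k = insert2 A p' i j k.
Proof. by move=> h; apply: eq_bigr => m _; rewrite h. Qed.

Lemma eq_insert3 A p p' i j k : (forall i j k, p i j k = p' i j k) ->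
  insert3 A p i j k = insert3 A p' i j k.
Proof. by move=> h; apply: eq_bigr => m _; rewrite h. Qed.

Lemma sum_mulmx n (A : 'M[R]_6) (B : 'M[R]_(6, n)) (f : ord -> R) i :
  \sum_m B m i * (\sum_l A l m * f l) = \sum_l (A *m B) l i * f l.
Proof.
under eq_bigr do rewrite mulr_sumr; rewrite exchange_big; apply: eq_bigr => l _ /=.
by rewrite mxE mulr_suml; apply: eq_bigr => m _; rewrite mulrA [B m i * _]mulrC.
Qed.

Lemma insert1M A B p i j k : insert1 B (insert1 A p) i j k = insert1 (A *m B) p i j k.
Proof. exact: (sum_mulmx A B (fun l => p l j k)). Qed.

Lemma insert2M A B p i j k : insert2 B (insert2 A p) i j k = insert2 (A *m B) p i j k.
Proof. exact: (sum_mulmx A B (fun l => p i l k)). Qed.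

Lemma insert3M A B p i j k : insert3 B (insert3 A p) i j k = insert3 (A *m B) p i j k.
Proof. exact: (sum_mulmx A B (fun l => p i j l)). Qed.

Lemma exchange_slots (f g : ord -> R) (F : ord -> ord -> R) :
  \sum_m f m * (\sum_l g l * F m l) = \sum_l g l * (\sum_m f m * F m l).
Proof.
under eq_bigr do rewrite mulr_sumr; rewrite exchange_big; apply: eq_bigr => l _ /=.
by rewrite mulr_sumr; apply: eq_bigr => m _; rewrite mulrCA.
Qed.

Lemma insert12 A B p i j k : insert1 A (insert2 B p) i j k = insert2 B (insert1 A p) i j k.
Proof. exact: exchange_slots. Qed.

Lemma insert13 A B p i j k : insert1 A (insert3 B p) i j k = insert3 B (insert1 A p) i j k.
Proof. exact: exchange_slots. Qed.

Lemma insert23 A B p i j k : insert2 A (insert3 B p) i j k = insert3 B (insert2 A p) i j k.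
Proof. exact: exchange_slots. Qed.

Lemma sum2_pull (T : finType) (V : T -> T -> R) (c : T -> R) (F : T -> T -> T -> R) :
  \sum_i \sum_j V i j * (\sum_m c m * F i j m) =
  \sum_m c m * \sum_i \sum_j V i j * F i j m.
Proof.
under [RHS]eq_bigr do rewrite mulr_sumr.
rewrite [RHS]exchange_big; apply: eq_bigr => i _ /=.
under [RHS]eq_bigr do rewrite mulr_sumr.
rewrite [RHS]exchange_big; apply: eq_bigr => j _ /=.
by rewrite mulr_sumr; apply: eq_bigr => m _; rewrite mulrCA.
Qed.

Definition insert123 A p := insert1 A (insert2 A (insert3 A p)).

Lemma eq_insert123 A p p' i j k : (forall i j k, p i j k = p' i j k) ->
  insert123 A p i j k = insert123 A p' i j k.
Proof.
by move=> h; apply: eq_insert1 => *; apply: eq_insert2 => *; apply: eq_insert3.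
Qed.

Lemma insert123M A B p i j k : insert123 B (insert123 A p) i j k = insert123 (A *m B) p i j k.
Proof.
rewrite /insert123 -insert1M; apply: eq_insert1 => {}i {}j {}k.
transitivity (insert2 B (insert1 A (insert3 B (insert2 A (insert3 A p)))) i j k).
  by apply: eq_insert2 => *; rewrite -insert13.
rewrite -insert12; apply: eq_insert1 => {}i {}j {}k.
rewrite -insert2M; apply: eq_insert2 => {}i {}j {}k.
by rewrite -insert23; apply: eq_insert2 => *; rewrite insert3M.
Qed.

Lemma insert1_scalar (c : R) p i j k : insert1 c%:M p i j k = c * p i j k.
Proof.
rewrite /insert1 (bigD1 i)//= mxE eqxx mulr1n big1 ?addr0// => m mi.
by rewrite mxE (negbTE mi) mulr0n mul0r.
Qed.

Lemma insert2_scalar (c : R) p i j k : insert2 c%:M p i j k = c * p i j k.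
Proof. exact: (insert1_scalar c (fun m i k => p i m k)). Qed.

Lemma insert3_scalar (c : R) p i j k : insert3 c%:M p i j k = c * p i j k.
Proof. exact: (insert1_scalar c (fun m i j => p i j m)). Qed.

Lemma insert123_scalar (c : R) p i j k : insert123 c%:M p i j k = c ^+ 3 * p i j k.
Proof. by rewrite /insert123 insert1_scalar insert2_scalar insert3_scalar; ring. Qed.

Lemma insert1Z (c : R) A p i j k : insert1 (c *: A) p i j k = c * insert1 A p i j k.
Proof. by rewrite mulr_sumr; apply: eq_bigr => m _; rewrite mxE mulrA. Qed.

Definition sum3 p : R := \sum_a \sum_b \sum_c p a b c.

Lemma eq_sum3 p p' : (forall a b c, p a b c = p' a b c) -> sum3 p = sum3 p'.
Proof. by move=> h; do 3 (apply: eq_bigr => ? _). Qed.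

Lemma sum3D p p' : sum3 (fun a b c => p a b c + p' a b c) = sum3 p + sum3 p'.
Proof.
rewrite -big_split; apply: eq_bigr => a _; rewrite -big_split; apply: eq_bigr => b _.
by rewrite -big_split.
Qed.

Lemma sum3Z k p : sum3 (fun a b c => k * p a b c) = k * sum3 p.
Proof. by rewrite mulr_sumr; do 2 (apply: eq_bigr => ? _; rewrite mulr_sumr). Qed.

Lemma sum3_swap12 p : sum3 (fun a b c => p b a c) = sum3 p.
Proof. exact: exchange_big. Qed.

Lemma sum3_swap23 p : sum3 (fun a b c => p a c b) = sum3 p.
Proof. by apply: eq_bigr => a _; exact: exchange_big. Qed.

Lemma insert123E A p i j k :
  insert123 A p i j k = sum3 (fun a b c => A a i * (A b j * (A c k * p a b c))).
Proof.
apply: eq_bigr => a _; rewrite mulr_sumr; apply: eq_bigr => b _.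
by rewrite /insert3 !mulr_sumr.
Qed.

Lemma insert123_alt A p : alternating3 p -> alternating3 (insert123 A p).
Proof.
move=> [h1 h2]; split=> i j k; rewrite !insert123E -mulN1r -sum3Z.
  by rewrite -sum3_swap12; apply: eq_sum3 => a b c; rewrite (h1 a b); ring.
by rewrite -sum3_swap23; apply: eq_sum3 => a b c; rewrite (h2 a b); ring.
Qed.

(* For a three-form of type (3,0)+(0,3), J may be moved from slot to slot. *)
Section TypeThreeZero.
Variables (J : 'M[R]_6) (p : ord -> ord -> ord -> R).
Hypothesis JJ : J *m J = - 1%:M.
Hypothesis altp : alternating3 p.
Hypothesis altJp : alternating3 (insert1 J p).

Lemma insert2_type i j k : insert2 J p i j k = insert1 J p i j k.
Proof.
have := altJp.1 i j k; rewrite /insert2 /insert1 => /(congr1 -%R); rewrite opprK => <-.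
by rewrite -sumrN; apply: eq_bigr => m _; rewrite (altp.1 i m) mulrN opprK.
Qed.

Lemma insert3_type i j k : insert3 J p i j k = insert1 J p i j k.
Proof.
have := altJp.2 i j k; rewrite -insert2_type /insert3 /insert2 => /(congr1 -%R); rewrite opprK => <-.
by rewrite -sumrN; apply: eq_bigr => m _; rewrite (altp.2 i j m) mulrN opprK.
Qed.

(** Moving all three J to the first slot gives J^3 = - J. *)
Lemma insert123_type i j k : insert123 J p i j k = - insert1 J p i j k.
Proof.
rewrite /insert123.
transitivity (insert1 J (insert2 J (insert2 J p)) i j k).
  by apply: eq_insert1 => *; apply: eq_insert2 => *; rewrite insert3_type insert2_type.
transitivity (insert1 J (insert2 (- 1%:M) p) i j k).
  by apply: eq_insert1 => *; rewrite insert2M JJ.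
rewrite /insert1 -sumrN; apply: eq_bigr => m _; rewrite -mulrN; congr (_ * _).
by rewrite -scalemx1 -scaleN1r scalerA mulr1 scalemx1 insert2_scalar mulN1r.
Qed.

End TypeThreeZero.
End Slots.

Section PointwiseStructure.
Variable R : realType.
Local Notation ord := 'I_6.
Variables (om : tensor R 2) (ph : tensor R 3).
Hypotheses (alt_om : Defs.alternating om) (alt_ph : Defs.alternating ph).
Hypothesis unit_om : form_mx om \in unitmx.
Hypothesis prim : forall I, Lambda om ph I = 0.
Hypothesis lambda_lt0 : hitchin_lambda ph < 0.

Local Notation w := (comp2 om).
Local Notation p := (comp3 ph).
Local Notation W := (form_mx om).
Local Notation V := (form_inv om).
Local Notation J := (almost_complex om ph).
Local Notation g := (metric om ph).

Let altw : alternating2 w := alternating_comp2 alt_om.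
Let altp : alternating3 p := alternating_comp3 alt_ph.

Lemma form_mxE i j : W i j = w i j.
Proof. by rewrite mxE. Qed.

Lemma form_mx_comp : W = \matrix_(i, j) w i j.
Proof. by []. Qed.

Lemma form_mx_skew : W^T = - W.
Proof. by apply/matrixP => i j; rewrite !mxE; exact: altw. Qed.

Lemma form_inv_skew : V^T = - V.
Proof.
have : W *m V^T = - 1%:M.
  rewrite -[W]opprK -form_mx_skew mulNmx -trmx_mul.
  by rewrite /form_inv mulVmx// trmx1.
by move=> /(congr1 (mulmx V)); rewrite mulmxN mulmx1 mulKmx.
Qed.

Lemma primitive_comp k : \sum_i \sum_j V i j * p i j k = 0.
Proof.
have := prim [tuple k]; rewrite /Lambda => /eqP.
rewrite mulf_eq0 invr_eq0 pnatr_eq0 /= exchange_big => /eqP h; apply: oppr_inj; rewrite oppr0 -[RHS]h -sumrN.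
apply: eq_bigr => i _; rewrite -sumrN; apply: eq_bigr => j _.
rewrite -mulrN -(altp.1 i j); congr (_ * ph _); exact: val_inj.
Qed.

Lemma pfaffian_neq0 : pfaffian w != 0.
Proof.
move: unit_om; rewrite unitmxE form_mx_comp (det_skew altw) unitfE.
by apply: contra => /eqP ->; rewrite expr0n.
Qed.

Lemma orientE : orient om = Num.sg (pfaffian w).
Proof.
rewrite /orient top_coef_wedge222 top6_cube // mulrA sgrM.
by rewrite (gtr0_sg (_ : 0 < 8^-1 * 48)) ?mul1r//; lra.
Qed.

Lemma stable_square : hitchin_K ph *m hitchin_K ph = (hitchin_lambda ph)%:M.
Proof.
rewrite /hitchin_lambda hitchin_KE; have [mu ->] := stable_form_square altp.
by rewrite mxtrace_scalar -[mu *+ 6]mulr_natr; congr (_%:M); field.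
Qed.

Lemma almost_complex_square : J *m J = - 1%:M.
Proof.
rewrite /almost_complex -scalemxAl -scalemxAr scalerA stable_square scale_scalar_mx.
rewrite (_ : - 1%:M = (-1)%:M); last by rewrite -scaleN1r scalemx1.
congr (_%:M).
have s0 : orient om != 0 by rewrite orientE sgr_eq0 pfaffian_neq0.
have sq : Num.sqrt (- hitchin_lambda ph) ^+ 2 = - hitchin_lambda ph.
  by rewrite sqr_sqrtr// oppr_ge0 ltW.
have o1 : orient om ^+ 2 = 1.
  by rewrite orientE sqr_sg pfaffian_neq0.
rewrite -invfM -expr2 exprMn o1 sq mul1r invrN mulNr mulVf// lt_eqF//.
Qed.

Lemma almost_complex_type : alternating3 (insert1 J p).
Proof.
have [h1 h2] := insert1_K_alt altp.
by split=> i j k; rewrite /almost_complex hitchin_KE !insert1Z; [rewrite (h1 i j)|rewrite (h2 i j)]; rewrite mulrN.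
Qed.

Lemma metric_sym : g^T = g.
Proof.
have h : forall k, \sum_i \sum_j invmx (\matrix_(i, j) w i j) i j * p i j k = 0.
  exact: primitive_comp.
rewrite /metric /almost_complex -scalemxAr hitchin_KE linearZ/=.
by rewrite (stable_form_symmetric altp altw unit_om h).
Qed.

Lemma almost_complex_unit : J \in unitmx.
Proof.
have : - J *m J = 1%:M by rewrite mulNmx almost_complex_square opprK.
by case/mulmx1_unit.
Qed.

Lemma metric_unit : g \in unitmx.
Proof. by rewrite unitmx_mul unit_om almost_complex_unit. Qed.

(** Symmetry of g = omega J means that J is skew for omega, and J^-1 = - J. *)
Lemma metric_inv : invmx g = V *m J^T.
Proof.
have -> : V *m J^T = - (J *m V).
  apply: (can_inj (mulmxK unit_om)); apply: (can_inj (mulKmx unit_om)).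
  rewrite !mulmxA !mulmxV// mul1mx mulmxN mulNmx -mulmxA -[_ *m V *m _]mulmxA mulVmx// mulmx1.
  have := metric_sym; rewrite /metric trmx_mul form_mx_skew mulmxN => <-.
  by rewrite opprK.
apply: (can_inj (mulKmx metric_unit)); rewrite mulmxV ?metric_unit//.
rewrite mulmxN /metric mulmxA -[_ *m J *m J]mulmxA almost_complex_square.
by rewrite mulmxN mulmx1 mulNmx opprK mulmxV.
Qed.

(** (1 + J)^2 = 2 J makes det J positive, and J^2 = -1 makes its square one. *)
Lemma det_almost_complex : \det J = 1.
Proof.
have e1 : (\det (1%:M + J)) ^+ 2 = 64 * \det J.
  rewrite expr2 -det_mulmx mulmxDl !mulmxDr mul1mx mulmx1 mul1mx almost_complex_square.
  have -> : 1%:M + J + (J - 1%:M) = 2 *: J.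
    by rewrite addrC addrA subrK scaler_nat mulr2n.
  by rewrite detZ; congr (_ * _); ring.
have e2 : (\det J) ^+ 2 = 1.
  rewrite expr2 -det_mulmx almost_complex_square -scaleN1r detZ det1 mulr1.
  by rewrite -signr_odd expr0.
have : (\det J - 1) * (\det J + 1) = 0 by rewrite -subr_sqr e2 expr1n subrr.
move/eqP; rewrite mulf_eq0 => /orP[]; first by rewrite subr_eq0 => /eqP.
rewrite addr_eq0 => /eqP h; have := sqr_ge0 (\det (1%:M + J)); rewrite e1 h; lra.
Qed.

Lemma det_metric : \det g = pfaffian w ^+ 2.
Proof. by rewrite det_mulmx det_almost_complex mulr1 form_mx_comp det_skew. Qed.

Lemma volume_pfaffian : orient om * Num.sqrt (\det g) = pfaffian w.
Proof. by rewrite orientE det_metric sqrtr_sqr -numEsg. Qed.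

(** This is star phi; see [hodge_starE]. *)
Definition dual_form i j k : R := - insert1 J p i j k.

Lemma dual_form_alt : alternating3 dual_form.
Proof.
have [h1 h2] := almost_complex_type.
by split=> i j k; rewrite /dual_form; [rewrite (h1 i j)|rewrite (h2 i j)].
Qed.

(** The inverse metric is the inverse of omega composed with J, and J in all
    three slots of phi gives star phi. *)
Lemma raise_formE a b c : raise_indices g ph [tuple a; b; c] = insert123 V^T dual_form a b c.
Proof.
transitivity (insert123 (V *m J^T)^T p a b c).
  rewrite /raise_indices big_tuple3 /insert123 /insert1 /insert2 /insert3.
  apply: eq_bigr => i _; rewrite mulr_sumr; apply: eq_bigr => j _.
  rewrite mulrA mulr_sumr; apply: eq_bigr => k _.
  rewrite !big_ord_recl big_ord0 mulr1 metric_inv.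
  set G := V *m J^T; have GT x y : G^T x y = G y x by rewrite [LHS]mxE.
  by rewrite !GT -!mulrA.
rewrite trmx_mul trmxK -insert123M; apply: eq_insert123 => i j k.
by rewrite insert123_type//; [exact: almost_complex_square|exact: almost_complex_type].
Qed.

Let r a b c := raise_indices g ph [tuple a; b; c].

(** The J of star phi is moved to the slot that is not contracted. *)
Lemma dual_form_primitive k : \sum_i \sum_j V i j * dual_form i j k = 0.
Proof.
transitivity (\sum_m (- J m k) * \sum_i \sum_j V i j * p i j m); last first.
  by rewrite big1// => m _; rewrite primitive_comp mulr0.
rewrite -sum2_pull; apply: eq_bigr => i _; apply: eq_bigr => j _; congr (_ * _).
rewrite /dual_form -(insert3_type altp almost_complex_type) -sumrN.
by apply: eq_bigr => m _; rewrite mulNr.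
Qed.

Lemma raise_lower d e f : sum3 (fun a b c => r a b c * (w a d * (w b e * w c f))) =
  - dual_form d e f.
Proof.
transitivity (insert123 W r d e f).
  apply: eq_bigr => a _; rewrite /insert2 mulr_sumr; apply: eq_bigr => b _.
  rewrite mulrA /insert3 mulr_sumr; apply: eq_bigr => c _.
  by rewrite !form_mxE; ring.
rewrite (eq_insert123 _ _ _ _ raise_formE) insert123M.
have -> : V^T *m W = (-1)%:M.
  by rewrite form_inv_skew mulNmx /form_inv mulVmx// -scaleN1r scalemx1.
by rewrite insert123_scalar; ring.
Qed.

(** Contracting the raised form with omega is contracting star phi with the
    inverse of omega. *)
Lemma raise_trace c : \sum_a \sum_b w a b * r a b c = 0.
Proof.
pose q x y := insert3 V^T dual_form x y c.
have q0 : \sum_x \sum_y V x y * q x y = 0.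
  transitivity (\sum_z V^T z c * \sum_x \sum_y V x y * dual_form x y z); last first.
    by rewrite big1// => z _; rewrite dual_form_primitive mulr0.
  by rewrite -sum2_pull.
transitivity (\sum_b insert1 W r b b c).
  rewrite exchange_big; apply: eq_bigr => b _; apply: eq_bigr => a _.
  by rewrite form_mxE.
transitivity (\sum_b \sum_y (- V^T y b) * q b y).
  apply: eq_bigr => b _; rewrite (eq_insert1 _ _ _ _ raise_formE) insert1M.
  have -> : V^T *m W = (-1)%:M.
    by rewrite form_inv_skew mulNmx /form_inv mulVmx// -scaleN1r scalemx1.
  by rewrite insert1_scalar /insert2 mulr_sumr; apply: eq_bigr => y _; rewrite /q; ring.
transitivity (- \sum_x \sum_y V x y * q x y); last by rewrite q0 oppr0.
rewrite -sumrN; apply: eq_bigr => x _; rewrite -sumrN; apply: eq_bigr => y _.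
by rewrite [V^T _ _]mxE mulNr.
Qed.

Let r_alt : alternating3 r.
Proof.
have [h1 h2] := insert123_alt V^T dual_form_alt.
by split=> i j k; rewrite /r !raise_formE.
Qed.

(** The volume form is the sum of the fifteen matchings of Pf omega. Those that
    pair two of the raised slots a, b, c vanish because the raised form is
    primitive; the six others lower the raised indices again, and agree up to
    sign. *)
Lemma hodge_starE d e f : hodge_star om g ph [tuple d; e; f] = dual_form d e f.
Proof.
transitivity (6^-1 * sum3 (fun a b c => r a b c * pfaffian6 w a b c d e f)).
  rewrite /hodge_star big_tuple3; congr (_ * _); apply: eq_sum3 => a b c.
  rewrite /vol_form volume_pfaffian; congr (_ * _); rewrite pfaffian6_levi_civita//.
  by congr (_ * levi_civita _); exact: val_inj.
have z1 (F : ord -> R) : sum3 (fun a b c => r a b c * (w a b * F c)) = 0.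
  transitivity (\sum_c F c * \sum_a \sum_b w a b * r a b c); last first.
    by rewrite big1// => c _; rewrite raise_trace mulr0.
  by rewrite -sum2_pull; do 2 (apply: eq_bigr => ? _); rewrite mulr_sumr;
    apply: eq_bigr => c _; ring.
have z2 (F : ord -> R) : sum3 (fun a b c => r a b c * (w a c * F b)) = 0.
  rewrite -sum3_swap23 -[RHS](mulr0 (-1)) -(z1 F) -sum3Z; apply: eq_sum3 => a b c.
  by rewrite (r_alt.2 a b c); ring.
have z3 (F : ord -> R) : sum3 (fun a b c => r a b c * (w b c * F a)) = 0.
  rewrite -sum3_swap12 -[RHS](mulr0 (-1)) -(z2 F) -sum3Z; apply: eq_sum3 => a b c.
  by rewrite (r_alt.1 a b c); ring.
pose X d e f := sum3 (fun a b c => r a b c * (w a d * (w b e * w c f))).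
(* The matchings that contain ab, ac or bc, and then the six others. *)
rewrite (@eq_sum3 _ _ (fun a b c =>
   r a b c * (w a b * pfaffian4 w c d e f) + -1 * (r a b c * (w a c * pfaffian4 w b d e f))
   + (r a b c * (w b c * (w a d * w e f - w a e * w d f + w a f * w d e))
   + (-1 * (r a b c * (w a d * (w b e * w c f))) + r a b c * (w a d * (w b f * w c e))
   + r a b c * (w a e * (w b d * w c f)) + -1 * (r a b c * (w a e * (w b f * w c d)))
   + -1 * (r a b c * (w a f * (w b d * w c e))) + r a b c * (w a f * (w b e * w c d)))))); last first.
  by move=> a b c; rewrite /pfaffian6 /pfaffian4; ring.
rewrite !sum3D !sum3Z z1 z2 (z3 (fun a => w a d * w e f - w a e * w d f + w a f * w d e)).
rewrite !raise_lower.
have [h1 h2] := dual_form_alt.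
have e1 := h2 d e f; have e2 := h1 d e f; have e3 := h2 e d f; have e4 := h1 d f e.
have e5 := h2 f d e; lra.
Qed.

End PointwiseStructure.

(** * Invariance of the norm under linear changes of coordinates *)

Section Pullback.
Variable R : realType.
Local Notation ord := 'I_6.

Definition pullback (P : 'M[R]_6) k (al : tensor R k) : tensor R k := fun I =>
  \sum_(J : k.-tuple ord) (\prod_(m < k) P (tnth I m) (tnth J m)) * al J.

Variable P : 'M[R]_6.

Lemma pullback2E (al : tensor R 2) i j :
  comp2 (pullback P al) i j = \sum_a P i a * \sum_b P j b * comp2 al a b.
Proof.
rewrite /comp2 /pullback big_tuple2; apply: eq_bigr => a _; rewrite mulr_sumr.
by apply: eq_bigr => b _; rewrite !big_ord_recl big_ord0 mulr1 -mulrA.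
Qed.

Lemma pullback3E (al : tensor R 3) i j k :
  comp3 (pullback P al) i j k = insert123 P^T (comp3 al) i j k.
Proof.
rewrite insert123E /comp3 /pullback big_tuple3; do 3 (apply: eq_bigr => ? _).
by rewrite !big_ord_recl big_ord0 mulr1 -!mulrA !mxE.
Qed.

Definition pull6 (F : ord -> ord -> ord -> ord -> ord -> ord -> R) c0 c1 c2 c3 c4 c5 : R :=
  \sum_j0 P c0 j0 * \sum_j1 P c1 j1 * \sum_j2 P c2 j2 * \sum_j3 P c3 j3 *
  \sum_j4 P c4 j4 * \sum_j5 P c5 j5 * F j0 j1 j2 j3 j4 j5.

Lemma top6_pull6 F : top6 (pull6 F) = \det P * top6 F.
Proof.
rewrite /top6 -top_pullback; apply: eq_bigr => I _; congr (_ * _).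
rewrite /curry6 /pull6 big_tuple_cons; apply: eq_bigr => j0 _.
rewrite big_tuple_cons mulr_sumr; apply: eq_bigr => j1 _.
rewrite big_tuple_cons !mulr_sumr; apply: eq_bigr => j2 _.
rewrite big_tuple3 !mulr_sumr; apply: eq_bigr => j3 _; rewrite !mulr_sumr.
apply: eq_bigr => j4 _; rewrite !mulr_sumr; apply: eq_bigr => j5 _.
by rewrite big_ord6 /= !mulrA; congr (_ * _ * _ * _ * _ * _ * F _ _ _ _ _ _).
Qed.

Lemma top6_pullback222 (w w' : ord -> ord -> R) :
  (forall i j, w i j = \sum_a P i a * \sum_b P j b * w' a b) ->
  top6 (fun a b c d e f => w a b * (w c d * w e f)) =
  \det P * top6 (fun a b c d e f => w' a b * (w' c d * w' e f)).
Proof.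
move=> h; rewrite -top6_pull6; apply: eq_top6 => a b c d e f; rewrite !h /pull6.
rewrite mulr_suml; apply: eq_bigr => j0 _; rewrite -mulrA; congr (_ * _).
rewrite mulr_suml; apply: eq_bigr => j1 _; rewrite -mulrA; congr (_ * _).
rewrite mulr_suml mulr_sumr; apply: eq_bigr => j2 _; rewrite -mulrA mulrCA; congr (_ * _).
rewrite mulr_suml mulr_sumr; apply: eq_bigr => j3 _; rewrite -mulrA mulrCA; congr (_ * _).
rewrite !mulr_sumr; apply: eq_bigr => j4 _; rewrite [X in _ * X = _]mulrCA [LHS]mulrCA; congr (_ * _).
rewrite !mulr_sumr; apply: eq_bigr => j5 _; ring.
Qed.

Lemma top6_pullback123 (x x' : ord -> R) (y y' : ord -> ord -> R) (z z' : ord -> ord -> ord -> R) :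
  (forall i, x i = \sum_a P i a * x' a) ->
  (forall i j, y i j = \sum_a P i a * \sum_b P j b * y' a b) ->
  (forall i j k, z i j k = \sum_a P i a * \sum_b P j b * \sum_c P k c * z' a b c) ->
  top6 (fun a b c d e f => x a * (y b c * z d e f)) =
  \det P * top6 (fun a b c d e f => x' a * (y' b c * z' d e f)).
Proof.
move=> hx hy hz; rewrite -top6_pull6; apply: eq_top6 => a b c d e f; rewrite hx hy hz /pull6.
rewrite mulr_suml; apply: eq_bigr => j0 _; rewrite -mulrA; congr (_ * _).
rewrite mulr_suml mulr_sumr; apply: eq_bigr => j1 _; rewrite -mulrA mulrCA; congr (_ * _).
rewrite mulr_suml mulr_sumr; apply: eq_bigr => j2 _; rewrite -mulrA mulrCA; congr (_ * _).
rewrite !mulr_sumr; apply: eq_bigr => j3 _; rewrite [X in _ * X = _]mulrCA [LHS]mulrCA; congr (_ * _).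
rewrite !mulr_sumr; apply: eq_bigr => j4 _; rewrite [X in _ * X = _]mulrCA [LHS]mulrCA; congr (_ * _).
rewrite !mulr_sumr; apply: eq_bigr => j5 _; ring.
Qed.

Variables (om' : tensor R 2) (ph' : tensor R 3).
Local Notation om := (pullback P om').
Local Notation ph := (pullback P ph').
Hypothesis alt_om : Defs.alternating om.
Hypotheses (alt_om' : Defs.alternating om') (alt_ph' : Defs.alternating ph').
Hypotheses (unit_om : form_mx om \in unitmx) (unit_om' : form_mx om' \in unitmx).
Hypothesis lambda'_lt0 : hitchin_lambda ph' < 0.

Lemma pullback_form_mx : form_mx om = P *m form_mx om' *m P^T.
Proof.
apply/matrixP => i j; rewrite mxE [LHS]pullback2E -mulmxA [RHS]mxE.
apply: eq_bigr => a _; congr (_ * _); rewrite [RHS]mxE; apply: eq_bigr => b _.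
by rewrite !mxE mulrC.
Qed.

Lemma pullback_unit : P \in unitmx.
Proof. by move: unit_om; rewrite pullback_form_mx !unitmx_mul => /andP[/andP[]]. Qed.

Lemma pullback_pfaffian : pfaffian (comp2 om) = \det P * pfaffian (comp2 om').
Proof.
have := top6_pullback222 (pullback2E om').
rewrite !top6_cube; [lra|exact: alternating_comp2..].
Qed.

(** K is a tensor with values in the top forms, hence the factor det P. *)
Lemma pullback_hitchin_K : P^T *m hitchin_K ph = \det P *: (hitchin_K ph' *m P^T).
Proof.
rewrite !hitchin_KE; apply/matrixP => a b.
pose y' c1 c2 := \sum_b' P b b' * comp3 ph' b' c1 c2.
pose x' c0 : R := (a == c0)%:R.
have E3 i j k : comp3 ph i j k = \sum_a P i a * \sum_b P j b * \sum_c P k c * comp3 ph' a b c.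
  rewrite pullback3E; apply: eq_bigr => i' _; rewrite mxE; congr (_ * _).
  by apply: eq_bigr => j' _; rewrite mxE; congr (_ * _); apply: eq_bigr => k' _; rewrite mxE.
have -> : (P^T *m stable_form (comp3 ph)) a b = - 12^-1 *
    top6 (fun c0 c1 c2 c3 c4 c5 => P c0 a * (comp3 ph b c1 c2 * comp3 ph c3 c4 c5)).
  rewrite mxE -(sum_K (comp3 ph) (P^~ a)); apply: eq_bigr => m _.
  by rewrite [P^T _ _]mxE.
rewrite (@top6_pullback123 _ x' _ y' _ _ _ _ E3); last 2 first.
- by move=> i; rewrite -[LHS](sum_delta a); apply: eq_bigr => c _; rewrite mulrC.
- move=> i j; rewrite E3 exchange_slots; apply: eq_bigr => c _; congr (_ * _).
  exact: exchange_slots.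
rewrite mxE mulrCA; congr (_ * _).
rewrite [RHS]mxE -top6Z.
under [RHS]eq_bigr do rewrite mxE -mulrA [top6 _ * _]mulrC -top6Z.
under [RHS]eq_bigr do rewrite -top6Z.
rewrite -top6_sum; apply: eq_top6 => c0 c1 c2 c3 c4 c5.
rewrite /y' /x' mulr_suml !mulr_sumr; apply: eq_bigr => m _.
by rewrite [P^T _ _]mxE; ring.
Qed.

Lemma pullback_lambda : hitchin_lambda ph = (\det P) ^+ 2 * hitchin_lambda ph'.
Proof.
have uP := pullback_unit; have uPT : P^T \in unitmx by rewrite unitmx_tr.
rewrite /hitchin_lambda mulrCA; congr (_ * _).
have -> : hitchin_K ph = \det P *: (invmx P^T *m hitchin_K ph' *m P^T).
  by rewrite -[LHS](mulKmx uPT) pullback_hitchin_K -scalemxAr mulmxA.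
rewrite -scalemxAl -scalemxAr scalerA -expr2 linearZ/=; congr (_ * _).
by rewrite !mulmxA (mulmxK uPT) mxtrace_mulC !mulmxA mulmxV// mul1mx.
Qed.

(** In the normalisation of K the orientation contributes the sign of det P and
    sqrt (- lambda) its absolute value, so that J is an honest tensor. *)
Lemma pullback_almost_complex :
  P^T *m almost_complex om ph = almost_complex om' ph' *m P^T.
Proof.
have d0 : \det P != 0 by have := pullback_unit; rewrite unitmxE unitfE.
rewrite /almost_complex -scalemxAr pullback_hitchin_K scalerA -scalemxAl; congr (_ *: _).
rewrite pullback_lambda !orientE// pullback_pfaffian sgrM.
rewrite -mulrN sqrtrM ?sqr_ge0// sqrtr_sqr mulrACA -numEsg.
rewrite invfM mulrAC mulVf// mul1r//.
Qed.

Lemma pullback_metric : metric om ph = P *m metric om' ph' *m P^T.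
Proof.
by rewrite /metric pullback_form_mx -!mulmxA pullback_almost_complex.
Qed.

Lemma sum3_insert123 (A : 'M[R]_6) (p q : ord -> ord -> ord -> R) :
  sum3 (fun i j k => insert123 A p i j k * q i j k) =
  sum3 (fun i j k => p i j k * insert123 A^T q i j k).
Proof.
have adj (B : 'M[R]_6) (f h : ord -> R) :
    \sum_i (\sum_m B m i * f m) * h i = \sum_i f i * \sum_m B^T m i * h m.
  under eq_bigr do rewrite mulr_suml.
  rewrite exchange_big; apply: eq_bigr => m _ /=; rewrite mulr_sumr.
  by apply: eq_bigr => i _; rewrite mxE; ring.
have a1 p' q' : sum3 (fun i j k => insert1 A p' i j k * q' i j k) =
    sum3 (fun i j k => p' i j k * insert1 A^T q' i j k).
  rewrite -sum3_swap12 -sum3_swap23 -[RHS]sum3_swap12 -[RHS]sum3_swap23.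
  do 2 (apply: eq_bigr => ? _); exact: adj.
have a2 p' q' : sum3 (fun i j k => insert2 A p' i j k * q' i j k) =
    sum3 (fun i j k => p' i j k * insert2 A^T q' i j k).
  rewrite -sum3_swap23 -[RHS]sum3_swap23.
  do 2 (apply: eq_bigr => ? _); exact: adj.
have a3 p' q' : sum3 (fun i j k => insert3 A p' i j k * q' i j k) =
    sum3 (fun i j k => p' i j k * insert3 A^T q' i j k).
  do 2 (apply: eq_bigr => ? _); exact: adj.
rewrite /insert123 a1 a2 a3; apply: eq_sum3 => i j k; congr (_ * _).
rewrite -insert23 /insert1.
transitivity (insert2 A^T (insert1 A^T (insert3 A^T q)) i j k); last by rewrite -insert12.
by apply: eq_insert2 => *; rewrite insert13.
Qed.

Lemma normsqE (o : tensor R 2) (f : tensor R 3) : normsq o f =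
  6^-1 * sum3 (fun i j k => comp3 f i j k * insert123 (invmx (metric o f))^T (comp3 f) i j k).
Proof.
rewrite /normsq /inner big_tuple3; congr (_ * _); apply: eq_sum3 => i j k; congr (_ * _).
rewrite insert123E /raise_indices big_tuple3; do 3 (apply: eq_bigr => ? _).
by rewrite !big_ord_recl big_ord0 mulr1 -!mulrA !mxE.
Qed.

Lemma normsq_pullback : normsq om ph = normsq om' ph'.
Proof.
have uP := pullback_unit; have uPT : P^T \in unitmx by rewrite unitmx_tr.
have ug := metric_unit alt_om' alt_ph' unit_om' lambda'_lt0.
rewrite !normsqE; congr (_ * _).
have gP := pullback_metric; move: (metric om' ph') (metric om ph) ug gP => g' g ug gP.
have gE : invmx g = invmx P^T *m invmx g' *m invmx P.
  have um : g \in unitmx by rewrite gP !unitmx_mul uP ug uPT.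
  apply: (can_inj (mulKmx um)); rewrite mulmxV// gP !mulmxA.
  by rewrite (mulmxK uPT) (mulmxK ug) mulmxV.
have pE i j k : comp3 ph i j k = insert123 P^T (comp3 ph') i j k := pullback3E ph' i j k.
transitivity (sum3 (fun i j k => insert123 P^T (comp3 ph') i j k *
    insert123 (invmx P) (insert123 (invmx g')^T (comp3 ph')) i j k)).
  apply: eq_sum3 => i j k; rewrite pE; congr (_ * _).
  rewrite (eq_insert123 _ _ _ _ pE) !insert123M gE !trmx_mul !trmx_inv trmxK !mulmxA.
  by rewrite mulmxV// mul1mx.
rewrite sum3_insert123 trmxK; apply: eq_sum3 => i j k; congr (_ * _).
by rewrite insert123M mulVmx// insert123_scalar; ring.
Qed.

End Pullback.

(** * Exterior derivatives of forms of type (3,0) *)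

Section Jets.
Variable R : realFieldType.
Local Notation ord := 'I_6.
Local Notation form3 := (ord -> ord -> ord -> R).
Local Notation jet3 := (ord -> ord -> ord -> ord -> R).

(** Exterior derivative of a three-form whose jet is d a i j k. *)
Definition jet_ext_d (d : jet3) i j k l := d i j k l - d j i k l + d k i j l - d l i j k.

(** Lambda of a four-form, with V in the place of the inverse of omega. *)
Definition contract_jet (V : 'M[R]_6) (D : jet3) k l : R :=
  2^-1 * \sum_i \sum_j V j i * D i j k l.

Definition alternating4 (D : jet3) := [/\ forall i j k l, D j i k l = - D i j k l,
  forall i j k l, D i k j l = - D i j k l & forall i j k l, D i j l k = - D i j k l].

Lemma jet_ext_d_alt d : (forall a, alternating3 (d a)) -> alternating4 (jet_ext_d d).
Proof.
move=> h; rewrite /jet_ext_d; split=> i j k l.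
- by rewrite ((h k).1 i j l) ((h l).1 i j k); ring.
- by rewrite ((h i).1 j k l) ((h l).2 i j k); ring.
- by rewrite ((h i).2 j k l) ((h j).2 i k l); ring.
Qed.

Section TypeEquation.
Variables (J : 'M[R]_6) (dJ : ord -> 'M[R]_6) (psi eta : form3) (dpsi deta : jet3).
Hypotheses (psiE : forall i j k, psi i j k = - insert1 J eta i j k)
  (etaE : forall i j k, eta i j k = insert1 J psi i j k).
Hypotheses (alt_psi : alternating3 psi) (alt_eta : alternating3 eta).
Hypotheses (alt_dpsi : forall a, alternating3 (dpsi a)) (alt_deta : forall a, alternating3 (deta a)).
Hypothesis dpsiE : forall a i j k,
  dpsi a i j k = - (insert1 (dJ a) eta i j k + insert1 J (deta a) i j k).
Hypothesis detaE : forall a i j k,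
  deta a i j k = insert1 (dJ a) psi i j k + insert1 J (dpsi a) i j k.

(** Four times the Nijenhuis tensor. *)
Definition nij4 m i j : R :=
  \sum_l (J l i * dJ l m j - J l j * dJ l m i + J m l * dJ j l i - J m l * dJ i l j).

Let moveA a j k l : \sum_b J b j * dpsi a b k l = deta a j k l - insert1 (dJ a) psi j k l.
Proof. by rewrite detaE addrC addKr. Qed.

Let moveB a j k l : \sum_b J b j * deta a b k l = - dpsi a j k l - insert1 (dJ a) eta j k l.
Proof. by rewrite dpsiE opprK addrC addKr. Qed.

Let altJpsi : alternating3 (insert1 J psi).
Proof. by split=> i j k; rewrite -!etaE; [exact: alt_eta.1|exact: alt_eta.2]. Qed.

Lemma psi_slot2 m i l : \sum_a J a i * psi m a l = eta m i l.
Proof. by rewrite etaE -(insert2_type alt_psi altJpsi). Qed.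

Lemma psi_slot3 m k i : \sum_a J a i * psi m k a = eta m k i.
Proof. by rewrite etaE -(insert3_type alt_psi altJpsi). Qed.

Let sum4 (f x y z u : ord -> R) : \sum_a f a * (x a - y a + z a - u a) =
  \sum_a f a * x a - \sum_a f a * y a + \sum_a f a * z a - \sum_a f a * u a.
Proof. by rewrite -sumrB -big_split -sumrB; apply: eq_bigr => a _ /=; ring. Qed.

(** For V, V' of type (0,1), a form Omega of type (3,0) satisfies
    dOmega(V, V', Y, Z) = - Omega([V, V'], Y, Z); this is the real part, with
    Omega = psi - i eta. *)
Lemma structure_equation i j k l :
  jet_ext_d dpsi i j k l
  - \sum_a J a i * (\sum_b J b j * jet_ext_d dpsi a b k l)
  + \sum_a J a i * jet_ext_d deta a j k l
  + \sum_b J b j * jet_ext_d deta i b k l = \sum_m nij4 m i j * psi m k l.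
Proof.
(* J is moved off a derivative by [moveA] and [moveB], that is by differentiating
   eta = psi(J, _, _) and psi = - eta(J, _, _). *)
have third k' l' : \sum_a J a i * (\sum_b J b j * dpsi k' a b l') =
    - dpsi k' i j l' - insert1 (dJ k') eta i j l' + insert1 (dJ k') eta j i l'.
  transitivity (\sum_a J a i * deta k' a j l' + \sum_a J a i * insert1 (dJ k') psi j a l').
    rewrite -big_split; apply: eq_bigr => a _ /=; rewrite -mulrDr; congr (_ * _).
    transitivity (- \sum_b J b j * dpsi k' b a l').
      by rewrite -sumrN; apply: eq_bigr => b _; rewrite ((alt_dpsi k').1 b a); ring.
    by rewrite moveA ((alt_deta k').1 a j); ring.
  rewrite moveB; congr (_ + _).
  by rewrite exchange_slots; apply: eq_bigr => m _; rewrite psi_slot2.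
have fourth k' l' : \sum_b J b j * deta k' i b l' = - dpsi k' i j l' + insert1 (dJ k') eta j i l'.
  transitivity (- \sum_b J b j * deta k' b i l').
    by rewrite -sumrN; apply: eq_bigr => b _; rewrite ((alt_deta k').1 b i); ring.
  by rewrite moveB ((alt_dpsi k').1 i j); ring.
have E1 : \sum_a J a i * (\sum_b J b j * jet_ext_d dpsi a b k l) =
    \sum_a J a i * deta a j k l - \sum_a J a i * insert1 (dJ a) psi j k l
    - (\sum_b J b j * deta b i k l - \sum_b J b j * insert1 (dJ b) psi i k l)
    + \sum_a J a i * (\sum_b J b j * dpsi k a b l)
    - \sum_a J a i * (\sum_b J b j * dpsi l a b k).
  rewrite /jet_ext_d; under eq_bigr do rewrite sum4.
  rewrite sum4; congr (_ - _ + _ - _).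
  - by rewrite -sumrB; apply: eq_bigr => a _; rewrite moveA mulrBr.
  - by rewrite -sumrB exchange_slots; apply: eq_bigr => a _; rewrite moveA mulrBr.
have E2 : \sum_m nij4 m i j * psi m k l = \sum_a J a i * insert1 (dJ a) psi j k l
    - \sum_b J b j * insert1 (dJ b) psi i k l + insert1 (dJ j) eta i k l
    - insert1 (dJ i) eta j k l.
  have F1 (M : 'M[R]_6) x : insert1 M eta x k l =
      \sum_m (\sum_l' J m l' * M l' x) * psi m k l.
    transitivity (insert1 M (insert1 J psi) x k l); first exact: eq_insert1.
    by rewrite insert1M; apply: eq_bigr => m _; rewrite mxE.
  have F2 x y : \sum_a J a x * insert1 (dJ a) psi y k l =
      \sum_m (\sum_l' J l' x * dJ l' m y) * psi m k l.
    rewrite /insert1; under eq_bigr do rewrite mulr_sumr.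
    rewrite exchange_big; apply: eq_bigr => m _ /=; rewrite mulr_suml.
    by apply: eq_bigr => a _; rewrite mulrA.
  rewrite !F1 !F2 -sumrB -big_split -sumrB; apply: eq_bigr => m _ /=.
  rewrite /nij4 !sumrB big_split /= sumrB; ring.
rewrite E1 E2 !third /jet_ext_d !sum4 !moveB !fourth; ring.
Qed.

Variable V : 'M[R]_6.
Hypotheses (JJ : J *m J = - 1%:M) (dJJ : forall a, dJ a *m J = - (J *m dJ a)).
Hypotheses (V_skew : V^T = - V) (JV_sym : (J *m V)^T = J *m V).

Let V_anti i j : V j i = - V i j.
Proof. by have /matrixP/(_ i j) := V_skew; rewrite !mxE. Qed.

Let contract13 (D : jet3) j l : alternating4 D ->
  \sum_i \sum_k V i k * D i j k l = 2 * contract_jet V D j l.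
Proof.
move=> [_ h _]; rewrite mulrA mulfV ?mul1r ?pnatr_eq0//.
by do 2 (apply: eq_bigr => ? _); rewrite h V_anti; ring.
Qed.

Let contract_sym (x : ord -> ord -> R) : (forall a k, x k a = - x a k) ->
  \sum_i \sum_k V i k * (\sum_a J a i * x a k) = 0.
Proof.
move=> h.
have S a k : (J *m V) k a = (J *m V) a k by have /matrixP/(_ a k) := JV_sym; rewrite mxE.
transitivity (\sum_a \sum_k (J *m V) a k * x a k).
  transitivity (\sum_i \sum_a \sum_k J a i * V i k * x a k).
    apply: eq_bigr => i _; rewrite exchange_big; apply: eq_bigr => k _.
    by rewrite mulr_sumr; apply: eq_bigr => a _; ring.
  rewrite exchange_big; apply: eq_bigr => a _ /=; rewrite exchange_big.
  by apply: eq_bigr => k _; rewrite mxE mulr_suml.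
set Y := \sum_a _; suff : Y = - Y by lra.
rewrite {2}/Y exchange_big -sumrN; apply: eq_bigr => a _.
by rewrite -sumrN; apply: eq_bigr => k _; rewrite S h; ring.
Qed.

Definition nij_contract j l := \sum_i \sum_k V i k * (\sum_m nij4 m i j * psi m k l).

(** Contracting the first and third slots of the structure equation with the
    inverse of omega: J V is symmetric, so two of the four terms vanish. *)
Lemma contract_structure j l : contract_jet V (jet_ext_d dpsi) j l =
  - (\sum_b J b j * contract_jet V (jet_ext_d deta) b l) + 2^-1 * nij_contract j l.
Proof.
have [p1 p2 p3] := jet_ext_d_alt alt_dpsi; have [e1 e2 e3] := jet_ext_d_alt alt_deta.
have z1 := @contract_sym (fun a k => \sum_b J b j * jet_ext_d dpsi a b k l).
have {}z1 := z1 ltac:(by move=> a k; rewrite -sumrN; apply: eq_bigr => b _;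
  rewrite -mulrN p2 p1 p2; ring).
have z2 := @contract_sym (fun a k => jet_ext_d deta a j k l).
have {}z2 := z2 ltac:(by move=> a k; rewrite e2 e1 e2; ring).
have z3 : \sum_i \sum_k V i k * (\sum_b J b j * jet_ext_d deta i b k l) =
    \sum_b J b j * (2 * contract_jet V (jet_ext_d deta) b l).
  by rewrite sum2_pull; apply: eq_bigr => b _; rewrite (contract13 _ _ (jet_ext_d_alt alt_deta)).
have : nij_contract j l = \sum_i \sum_k V i k * jet_ext_d dpsi i j k l
    - \sum_i \sum_k V i k * (\sum_a J a i * (\sum_b J b j * jet_ext_d dpsi a b k l))
    + \sum_i \sum_k V i k * (\sum_a J a i * jet_ext_d deta a j k l)
    + \sum_i \sum_k V i k * (\sum_b J b j * jet_ext_d deta i b k l).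
  rewrite -sumrB -!big_split; apply: eq_bigr => i _ /=.
  rewrite -sumrB -!big_split; apply: eq_bigr => k _ /=.
  by rewrite -structure_equation; ring.
rewrite z1 z2 z3 (contract13 _ _ (jet_ext_d_alt alt_dpsi)).
have -> : \sum_b J b j * (2 * contract_jet V (jet_ext_d deta) b l) =
    2 * \sum_b J b j * contract_jet V (jet_ext_d deta) b l.
  by rewrite mulr_sumr; apply: eq_bigr => b _; rewrite mulrCA.
lra.
Qed.

Let JJ_sum (f : ord -> R) j : \sum_p J p j * (\sum_b J b p * f b) = - f j.
Proof.
rewrite sum_mulmx JJ (bigD1 j)//= big1 ?addr0 => [|b bj]; rewrite !mxE.
  by rewrite eqxx mulN1r.
by rewrite (negbTE bj) oppr0 mul0r.
Qed.

Lemma nij4_swap m i j : nij4 m j i = - nij4 m i j.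
Proof. by rewrite /nij4 -sumrN; apply: eq_bigr => l _; ring. Qed.

(** N(X, J Y) = - J N(X, Y), a consequence of d(J^2) = 0. *)
Lemma nij4_J m i j : \sum_p J p j * nij4 m i p = - \sum_r J m r * nij4 r i j.
Proof.
have JJl (f : ord -> R) x : \sum_r J x r * (\sum_l J r l * f l) = - f x.
  under eq_bigr do rewrite mulr_sumr; rewrite exchange_big /=.
  transitivity (\sum_l (J *m J) x l * f l).
    by apply: eq_bigr => l _; rewrite mxE mulr_suml; apply: eq_bigr => r _; rewrite mulrA.
  rewrite JJ (bigD1 x)//= big1 ?addr0 => [|b bx]; rewrite !mxE.
    by rewrite eqxx mulN1r.
  by rewrite eq_sym (negbTE bx) oppr0 mul0r.
have dJE a x y : \sum_p J p y * dJ a x p = - \sum_p J x p * dJ a p y.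
  have /matrixP/(_ x y) := dJJ a; rewrite !mxE => <-.
  by apply: eq_bigr => p _; rewrite mulrC.
have split4 (f : ord -> R) (x y z u : ord -> ord -> R) :
    \sum_p f p * (\sum_l (x p l - y p l + z p l - u p l)) =
    \sum_p f p * (\sum_l x p l) - \sum_p f p * (\sum_l y p l) +
    \sum_p f p * (\sum_l z p l) - \sum_p f p * (\sum_l u p l).
  by rewrite -sum4; apply: eq_bigr => p _; rewrite sumrB big_split /= sumrB.
rewrite /nij4 !split4.
have -> : \sum_p J p j * (\sum_l J l i * dJ l m p) =
    - \sum_r J m r * (\sum_l J l i * dJ l r j).
  rewrite exchange_slots [in RHS]exchange_slots -sumrN; apply: eq_bigr => l _.
  by rewrite dJE mulrN.
have -> : \sum_p J p j * (\sum_l J l p * dJ l m i) = - dJ j m i by rewrite JJ_sum.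
have -> : \sum_p J p j * (\sum_l J m l * dJ p l i) =
    \sum_r J m r * (\sum_l J l j * dJ l r i) by rewrite exchange_slots.
have -> : \sum_p J p j * (\sum_l J m l * dJ i l p) = dJ i m j.
  rewrite exchange_slots -[RHS]opprK -(JJl (fun l => dJ i l j)) -sumrN.
  by apply: eq_bigr => l _; rewrite dJE mulrN.
by rewrite (JJl (fun l => dJ j l i)) (JJl (fun l => dJ i l j)); ring.
Qed.

(** Applying J to the second argument turns psi into eta; applying it to the
    first passes through N with a sign and turns eta into - psi. *)
Lemma nij_contract_J j l :
  \sum_p J p j * (\sum_q J q l * nij_contract p q) = nij_contract j l.
Proof.
have eJ r k l' : \sum_m J m r * eta m k l' = - psi r k l' by rewrite psiE opprK.
have step p : \sum_q J q l * nij_contract p q =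
    \sum_i \sum_k V i k * (\sum_m nij4 m i p * eta m k l).
  rewrite /nij_contract -sum2_pull; do 2 (apply: eq_bigr => ? _); congr (_ * _).
  by rewrite exchange_slots; apply: eq_bigr => m _; rewrite psi_slot3.
under eq_bigr do rewrite step.
rewrite -sum2_pull; apply: eq_bigr => i _; apply: eq_bigr => k _; congr (_ * _).
transitivity (\sum_m (- \sum_r J m r * nij4 r i j) * eta m k l).
  under eq_bigr do rewrite mulr_sumr; rewrite exchange_big; apply: eq_bigr => m _ /=.
  by rewrite -nij4_J mulr_suml; apply: eq_bigr => p _; rewrite mulrA.
transitivity (- \sum_r nij4 r i j * \sum_m J m r * eta m k l).
  rewrite -sumrN; under [RHS]eq_bigr do rewrite mulr_sumr -sumrN.
  rewrite [RHS]exchange_big; apply: eq_bigr => m _ /=.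
  by rewrite -sumrN mulr_suml; apply: eq_bigr => r _; ring.
by rewrite -sumrN; apply: eq_bigr => r _; rewrite eJ; ring.
Qed.

(** A contraction B of a form of type (3,0)+(0,3) with a vector has type
    (2,0)+(0,2), so B(J x, J y) = - B(x, y); here B is composed with J once
    more. *)
Lemma type_two_zero_cancel (u : ord -> R) (q : form3) (B : ord -> ord -> R) :
  alternating3 q -> alternating3 (insert1 J q) ->
  (forall b l, B b l = \sum_m u m * q m b l) -> forall j l,
  \sum_p J p j * (\sum_q J q l * (\sum_b J b p * B b q)) = - \sum_b J b j * B b l.
Proof.
move=> altq altJq BE j l.
rewrite exchange_slots.
transitivity (\sum_q J q l * - B j q).
  by apply: eq_bigr => b _; rewrite (JJ_sum (B^~ b)).
transitivity (- \sum_m u m * insert3 J q m j l).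
  rewrite /insert3 exchange_slots -sumrN; apply: eq_bigr => b _.
  by rewrite BE mulrN.
congr (- _); transitivity (\sum_m u m * insert2 J q m j l).
  by apply: eq_bigr => m _; rewrite (insert3_type altq altJq) (insert2_type altq altJq).
by rewrite /insert2 exchange_slots; apply: eq_bigr => b _; rewrite BE.
Qed.

(** In [contract_structure] the contraction of q with u has type (2,0)+(0,2) and
    cancels, while the Nijenhuis term has type (1,1). *)
Lemma type_11_part (u : ord -> R) (q : form3) j l :
  alternating3 q -> alternating3 (insert1 J q) ->
  (forall b l, contract_jet V (jet_ext_d deta) b l = \sum_m u m * q m b l) ->
  contract_jet V (jet_ext_d dpsi) j l +
  \sum_p J p j * (\sum_q J q l * contract_jet V (jet_ext_d dpsi) p q) = nij_contract j l.
Proof.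
move=> altq altJq BE; set B := contract_jet V (jet_ext_d deta) in BE.
have -> : \sum_p J p j * (\sum_q J q l * contract_jet V (jet_ext_d dpsi) p q) =
  - \sum_p J p j * (\sum_q J q l * (\sum_b J b p * B b q)) +
  2^-1 * \sum_p J p j * (\sum_q J q l * nij_contract p q).
  rewrite mulr_sumr -sumrN -big_split; apply: eq_bigr => p _ /=.
  rewrite mulrCA -mulrN -mulrDr; congr (_ * _).
  rewrite mulr_sumr -sumrN -big_split; apply: eq_bigr => q' _ /=.
  by rewrite contract_structure -/B; ring.
rewrite (type_two_zero_cancel altq altJq BE) nij_contract_J contract_structure -/B.
by field.
Qed.

Lemma raised_nij_contract (f : R) (q : form3) j k :
  alternating3 q -> alternating3 (insert1 J q) ->
  (forall i j k, psi i j k = - (f * insert1 J q i j k)) ->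
  f * \sum_m \sum_l (\sum_s 4^-1 * nij4 m j s * (V *m J^T) s l) * q m k l =
  - (4^-1 * nij_contract j k).
Proof.
move=> altq altJq psiq; have [_ hJ] := altJq.
transitivity (\sum_m \sum_s 4^-1 * nij4 m j s * (f * (\sum_l (V *m J^T) s l * q m k l))).
  rewrite mulr_sumr; apply: eq_bigr => m _.
  transitivity (\sum_l \sum_s 4^-1 * nij4 m j s * (f * ((V *m J^T) s l * q m k l))).
    rewrite mulr_sumr; apply: eq_bigr => l _.
    by rewrite mulr_suml mulr_sumr; apply: eq_bigr => s _; ring.
  rewrite exchange_big; apply: eq_bigr => s _ /=.
  by rewrite !mulr_sumr.
transitivity (\sum_m \sum_s 4^-1 * nij4 m j s * \sum_b V s b * psi m b k).
  apply: eq_bigr => m _; apply: eq_bigr => s _; congr (_ * _).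
  transitivity (f * \sum_b V s b * insert3 J q m k b).
    congr (_ * _).
    transitivity (\sum_l \sum_b V s b * (J l b * q m k l)).
      apply: eq_bigr => l _; rewrite mxE mulr_suml; apply: eq_bigr => b _.
      by rewrite mxE mulrA.
    by rewrite exchange_big; apply: eq_bigr => b _ /=; rewrite -mulr_sumr.
  rewrite mulr_sumr; apply: eq_bigr => b _.
  by rewrite (insert3_type altq altJq) psiq (hJ m b k); ring.
rewrite exchange_big /nij_contract mulr_sumr -sumrN; apply: eq_bigr => s _ /=.
rewrite mulr_sumr -sumrN.
under eq_bigr do rewrite mulr_sumr; rewrite exchange_big; apply: eq_bigr => b _ /=.
rewrite !mulr_sumr -sumrN; apply: eq_bigr => m _.
by rewrite (nij4_swap m s j); ring.
Qed.

End TypeEquation.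

(** * The symplectic codifferential *)

Section SymplecticCodifferential.
Variables (V : 'M[R]_6) (dW dV : ord -> 'M[R]_6) (psi : form3) (dpsi : jet3).
Hypotheses (V_skew : V^T = - V) (dW_skew : forall a, (dW a)^T = - dW a).
Hypothesis dW_closed : forall i j k, dW i j k + dW j k i + dW k i j = 0.
Hypothesis dVE : forall a, dV a = - (V *m dW a *m V).
Hypothesis alt_psi : alternating3 psi.
(* The derivative of the primitivity of psi. *)
Hypothesis dprim : forall a k,
  \sum_i \sum_j (dV a i j * psi i j k + V i j * dpsi a i j k) = 0.

Let V_anti i j : V j i = - V i j.
Proof. by have /matrixP/(_ i j) := V_skew; rewrite !mxE. Qed.

Let dW_anti a i j : dW a j i = - dW a i j.
Proof. by have /matrixP/(_ i j) := dW_skew a; rewrite !mxE. Qed.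

Let dV_entry a i j : dV a i j = - \sum_q \sum_p V i p * dW a p q * V q j.
Proof.
rewrite dVE mxE; congr (- _); rewrite mxE; apply: eq_bigr => q _.
by rewrite mxE mulr_suml.
Qed.

(* psi with its first two indices raised. *)
Let Psi c j q := \sum_a \sum_b V j a * V q b * psi a b c.

Let Psi_anti c j q : Psi c q j = - Psi c j q.
Proof.
rewrite /Psi exchange_big -sumrN; apply: eq_bigr => a _; rewrite -sumrN.
by apply: eq_bigr => b _; rewrite (alt_psi.1 a b c); ring.
Qed.

Let dV_trace p c : \sum_j \sum_q dW p j q * Psi c j q = \sum_a \sum_b dV p a b * psi a b c.
Proof.
transitivity (\sum_j \sum_q \sum_a \sum_b V j a * dW p j q * V q b * psi a b c).
  do 2 (apply: eq_bigr => ? _); rewrite mulr_sumr; apply: eq_bigr => a _.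
  by rewrite mulr_sumr; apply: eq_bigr => b _; ring.
transitivity (\sum_a \sum_b \sum_q \sum_j V j a * dW p j q * V q b * psi a b c).
  under eq_bigr do rewrite exchange_big /=; rewrite exchange_big; apply: eq_bigr => a _ /=.
  under eq_bigr do rewrite exchange_big /=; rewrite exchange_big; apply: eq_bigr => b _ /=.
  exact: exchange_big.
apply: eq_bigr => a _; apply: eq_bigr => b _.
rewrite dV_entry mulNr mulr_suml -sumrN; apply: eq_bigr => q _.
rewrite mulr_suml -sumrN; apply: eq_bigr => j _.
by rewrite (V_anti a j); ring.
Qed.

Let Z p c := \sum_j \sum_q dW j p q * Psi c j q.

(** Closedness of omega turns the derivative along a contracted slot into the
    derivative along the free one. *)
Let ZE p c : Z p c = - (2^-1 * \sum_a \sum_b V a b * dpsi p a b c).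
Proof.
have h1 : \sum_j \sum_q dW q j p * Psi c j q = Z p c.
  rewrite exchange_big /=; do 2 (apply: eq_bigr => ? _).
  by rewrite Psi_anti dW_anti; ring.
have h2 : \sum_j \sum_q dW p q j * Psi c j q = - \sum_j \sum_q dW p j q * Psi c j q.
  rewrite -sumrN; apply: eq_bigr => j _; rewrite -sumrN; apply: eq_bigr => q _.
  by rewrite dW_anti mulNr.
have : \sum_j \sum_q (dW j p q + dW p q j + dW q j p) * Psi c j q = 0.
  by rewrite big1// => j _; rewrite big1// => q _; rewrite dW_closed mul0r.
have -> : \sum_j \sum_q (dW j p q + dW p q j + dW q j p) * Psi c j q =
    Z p c + \sum_j \sum_q dW p q j * Psi c j q + \sum_j \sum_q dW q j p * Psi c j q.
  rewrite -!big_split; apply: eq_bigr => j _; rewrite -!big_split; apply: eq_bigr => q _ /=.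
  ring.
rewrite h1 h2 dV_trace.
have : \sum_a \sum_b dV p a b * psi a b c + \sum_a \sum_b V a b * dpsi p a b c = 0.
  rewrite -[RHS](dprim p c) -big_split; apply: eq_bigr => a _ /=.
  by rewrite [RHS]big_split.
lra.
Qed.

Let Y k c := \sum_j \sum_a \sum_b V j a * dV j k b * psi a b c.

Let YE k c : Y k c = 2^-1 * \sum_p V k p * \sum_a \sum_b V a b * dpsi p a b c.
Proof.
transitivity (- \sum_p V k p * Z p c); last first.
  rewrite -sumrN mulr_sumr; apply: eq_bigr => p _; rewrite ZE; ring.
rewrite -sumrN.
transitivity (\sum_p \sum_j \sum_a \sum_b \sum_q - (V k p * (V j a * dW j p q * V q b * psi a b c))).
  rewrite [RHS]exchange_big; apply: eq_bigr => j _ /=.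
  rewrite [RHS]exchange_big; apply: eq_bigr => a _ /=.
  rewrite [RHS]exchange_big; apply: eq_bigr => b _ /=.
  rewrite dV_entry mulrN mulNr mulr_sumr mulr_suml -sumrN.
  rewrite [RHS]exchange_big; apply: eq_bigr => q _ /=.
  rewrite mulr_sumr mulr_suml -sumrN; apply: eq_bigr => p _; ring.
apply: eq_bigr => p _; rewrite /Z mulr_sumr -sumrN; apply: eq_bigr => j _.
rewrite mulr_sumr -sumrN.
under eq_bigr do rewrite exchange_big /=; rewrite exchange_big; apply: eq_bigr => q _ /=.
rewrite /Psi !mulr_sumr -sumrN; apply: eq_bigr => a _.
rewrite !mulr_sumr -sumrN; apply: eq_bigr => b _; ring.
Qed.

Let contractE p q : contract_jet V (jet_ext_d dpsi) p q =
  - (\sum_i \sum_j V i j * dpsi i j p q + 2^-1 * \sum_i \sum_j V i j * dpsi p i j q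
     - 2^-1 * \sum_i \sum_j V i j * dpsi q i j p).
Proof.
rewrite /contract_jet.
have e1 : \sum_i \sum_j V j i * dpsi i j p q = - \sum_i \sum_j V i j * dpsi i j p q.
  by rewrite -sumrN; apply: eq_bigr => i _; rewrite -sumrN; apply: eq_bigr => j _;
    rewrite V_anti mulNr.
have e2 : \sum_i \sum_j V j i * dpsi j i p q = \sum_i \sum_j V i j * dpsi i j p q.
  exact: exchange_big.
have e3 x y : \sum_i \sum_j V j i * dpsi x i j y = - \sum_i \sum_j V i j * dpsi x i j y.
  by rewrite -sumrN; apply: eq_bigr => i _; rewrite -sumrN; apply: eq_bigr => j _;
    rewrite V_anti mulNr.
have -> : \sum_i \sum_j V j i * jet_ext_d dpsi i j p q =
    \sum_i \sum_j V j i * dpsi i j p q - \sum_i \sum_j V j i * dpsi j i p q +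
    \sum_i \sum_j V j i * dpsi p i j q - \sum_i \sum_j V j i * dpsi q i j p.
  rewrite -sumrB -big_split -sumrB; apply: eq_bigr => i _ /=.
  rewrite -sumrB -big_split -sumrB; apply: eq_bigr => j _ /=.
  by rewrite /jet_ext_d; ring.
by rewrite e1 e2 !e3; field.
Qed.

(** The divergence of psi with raised indices, where the factor omega^{-1} of the
    first index is treated as divergence free. By [YE] the derivatives of the
    two other factors become the terms of Lambda d psi in which two slots of psi
    are contracted. *)
Lemma symplectic_codifferential k l :
  \sum_j \sum_a V j a * \sum_b \sum_c (dV j k b * V l c * psi a b c +
    V k b * dV j l c * psi a b c + V k b * V l c * dpsi j a b c) =
  - \sum_p \sum_q V k p * V l q * contract_jet V (jet_ext_d dpsi) p q.
Proof.
transitivity (\sum_c V l c * Y k c - \sum_b V k b * Y l b +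
  \sum_p \sum_q V k p * V l q * (\sum_i \sum_j V i j * dpsi i j p q)).
  transitivity (\sum_j \sum_a \sum_b \sum_c V j a * dV j k b * V l c * psi a b c +
    \sum_j \sum_a \sum_b \sum_c V j a * V k b * dV j l c * psi a b c +
    \sum_j \sum_a \sum_b \sum_c V j a * V k b * V l c * dpsi j a b c).
    rewrite -!big_split; apply: eq_bigr => j _; rewrite -!big_split; apply: eq_bigr => a _ /=.
    rewrite mulr_sumr -!big_split; apply: eq_bigr => b _ /=.
    rewrite mulr_sumr -!big_split; apply: eq_bigr => c _ /=; ring.
  congr (_ + _ + _).
  - rewrite /Y; under [RHS]eq_bigr do rewrite mulr_sumr.
    rewrite [RHS]exchange_big; apply: eq_bigr => j _ /=.
    under [RHS]eq_bigr do rewrite mulr_sumr; rewrite [RHS]exchange_big; apply: eq_bigr => a _ /=.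
    under [RHS]eq_bigr do rewrite mulr_sumr; rewrite [RHS]exchange_big; apply: eq_bigr => b _ /=.
    by apply: eq_bigr => c _; ring.
  - rewrite /Y -sumrN; under [RHS]eq_bigr do rewrite mulr_sumr -sumrN.
    rewrite [RHS]exchange_big; apply: eq_bigr => j _ /=.
    under [RHS]eq_bigr do rewrite mulr_sumr -sumrN; rewrite [RHS]exchange_big.
    apply: eq_bigr => a _ /=; apply: eq_bigr => b _.
    rewrite mulr_sumr -sumrN; apply: eq_bigr => c _.
    by rewrite (alt_psi.2 a b c); ring.
  - transitivity (\sum_j \sum_a \sum_p \sum_q V k p * V l q * (V j a * dpsi j a p q)).
      by do 4 (apply: eq_bigr => ? _); ring.
    under eq_bigr do rewrite exchange_big /=; rewrite exchange_big; apply: eq_bigr => p _ /=.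
    under eq_bigr do rewrite exchange_big /=; rewrite exchange_big; apply: eq_bigr => q _ /=.
    by rewrite mulr_sumr; apply: eq_bigr => j _; rewrite mulr_sumr.
have split3 : \sum_p \sum_q V k p * V l q * contract_jet V (jet_ext_d dpsi) p q =
    - (\sum_p \sum_q V k p * V l q * (\sum_i \sum_j V i j * dpsi i j p q)
     + \sum_q V l q * (2^-1 * \sum_p V k p * \sum_i \sum_j V i j * dpsi p i j q)
     - \sum_p V k p * (2^-1 * \sum_q V l q * \sum_i \sum_j V i j * dpsi q i j p)).
  have -> : \sum_q V l q * (2^-1 * \sum_p V k p * \sum_i \sum_j V i j * dpsi p i j q) =
      \sum_p \sum_q V k p * V l q * (2^-1 * \sum_i \sum_j V i j * dpsi p i j q).
    rewrite exchange_big; apply: eq_bigr => q _ /=; rewrite !mulr_sumr.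
    by apply: eq_bigr => p _; ring.
  have -> : \sum_p V k p * (2^-1 * \sum_q V l q * \sum_i \sum_j V i j * dpsi q i j p) =
      \sum_p \sum_q V k p * V l q * (2^-1 * \sum_i \sum_j V i j * dpsi q i j p).
    by apply: eq_bigr => p _; rewrite !mulr_sumr; apply: eq_bigr => q _; ring.
  rewrite -big_split -sumrB -sumrN; apply: eq_bigr => p _ /=.
  rewrite -big_split -sumrB -sumrN; apply: eq_bigr => q _ /=.
  by rewrite contractE; ring.
have y1 : \sum_q V l q * (2^-1 * \sum_p V k p * \sum_i \sum_j V i j * dpsi p i j q) =
    \sum_c V l c * Y k c by apply: eq_bigr => c _; rewrite YE.
have y2 : \sum_p V k p * (2^-1 * \sum_q V l q * \sum_i \sum_j V i j * dpsi q i j p) =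
    \sum_b V k b * Y l b by apply: eq_bigr => c _; rewrite YE.
rewrite split3 y1 y2; ring.
Qed.

End SymplecticCodifferential.
End Jets.

(** * Smooth functions on open sets *)
Section Smoothness.
Variables (R : realType) (n : nat).
Implicit Types (U : set 'rV[R]_n) (f g : 'rV[R]_n -> R).

(** The chain rule along a line, by reduction to functions of one variable. *)
Lemma is_derive_comp (p : R -> R) f (x v : 'rV[R]_n) a :
  is_derive (f x) (1 : R) p a -> derivable f x v ->
  is_derive x v (fun y => p (f y)) (a * 'D_v f x).
Proof.
move=> dp df.
have E g w : (fun h : R => h^-1 *: ((g \o shift x) (h *: w) - g x)) =
   (fun h => h^-1 *: (((fun k : R => g (k *: w + x)) \o shift 0) (h *: 1) - g (0 *: w + x))) :> (R -> R).
  by apply/funext => h /=; rewrite addr0 scale0r add0r [_%:A]mulr1.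
have dg : is_derive (0 : R) (1 : R) (fun k : R => f (k *: v + x) : R) ('D_v f x).
  apply: DeriveDef; first by move/derivable1P: df.
  by rewrite /derive E.
have dp' : is_derive (f ((0 : R) *: v + x)) (1 : R) p a by rewrite scale0r add0r.
have [d1 d2] := is_derive1_comp dp' dg.
apply: DeriveDef; first by apply/derivable1P.
by rewrite /derive (E (fun y => p (f y))); exact: d2.
Qed.

Lemma Ck_mono k U f : Ck k.+1 U f -> Ck k U f.
Proof.
elim: k f => [|k IH] f [cf h]; first by split.
by split=> // i; have [d c] := h i; split=> //; exact: IH.
Qed.

Lemma partial_eq_on U f g i x : open U -> (forall y, U y -> f y = g y) -> U x ->
  partial i f x = partial i g x.
Proof.
move=> oU fg Ux; apply: near_eq_derive.
by apply: filterS (open_nbhs_nbhs (conj oU Ux)) => y /fg.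
Qed.

Lemma continuous_eq_on U f g x : open U -> (forall y, U y -> f y = g y) -> U x ->
  {for x, continuous f} -> {for x, continuous g}.
Proof.
move=> oU fg Ux cf; rewrite /prop_for/continuous_at -(fg _ Ux).
apply: cvg_trans cf; apply: (@near_eq_cvg _ _ (nbhs x)).
by apply: filterS (open_nbhs_nbhs (conj oU Ux)) => y Uy; exact: fg.
Qed.

Lemma Ck_eq_on k U f g : open U -> (forall y, U y -> f y = g y) ->
  Ck k U f -> Ck k U g.
Proof.
move=> oU; elim: k f g => [|k IH] f g fg [cf h]; split=> //.
- by move=> x Ux; apply: (continuous_eq_on oU fg Ux); exact: cf.
- by move=> x Ux; apply: (continuous_eq_on oU fg Ux); exact: cf.
- move=> i; have [d c] := h i; split.
    move=> x Ux; apply: near_eq_derivable (d x Ux).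
    by apply: filterS (open_nbhs_nbhs (conj oU Ux)) => y /fg.
  by apply: IH c => y Uy; exact: partial_eq_on Uy.
Qed.

Lemma Ck_sub k U V f : U `<=` V -> Ck k V f -> Ck k U f.
Proof.
move=> UV; elim: k f => [|k IH] f [cf h]; split=> //; try by move=> x /UV; exact: cf.
by move=> i; have [d c] := h i; split; [move=> x /UV; exact: d|exact: IH].
Qed.

Lemma Ck_cst k U c : open U -> Ck k U (fun=> c).
Proof.
move=> oU; elim: k c => [|k IH] c; split => //; try by move=> x _; exact: cst_continuous.
move=> i; split; first by move=> x _; exact: derivable_cst.
by apply: Ck_eq_on (IH 0) => // y Uy; rewrite /partial derive_cst.
Qed.

Lemma CkD k U f g : open U -> Ck k U f -> Ck k U g -> Ck k U (fun x => f x + g x).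
Proof.
move=> oU; elim: k f g => [|k IH] f g [cf hf] [cg hg]; split => //;
  try by move=> x Ux; apply: continuousD; [exact: cf|exact: cg].
move=> i; have [df pf] := hf i; have [dg pg] := hg i; split.
  by move=> x Ux; apply: derivableD; [exact: df|exact: dg].
apply: Ck_eq_on (IH _ _ pf pg) => // y Uy.
by rewrite /partial [RHS]deriveD//; [exact: df|exact: dg].
Qed.

Lemma CkM k U f g : open U -> Ck k U f -> Ck k U g -> Ck k U (fun x => f x * g x).
Proof.
move=> oU; elim: k f g => [|k IH] f g cf cg; have [kf hf] := cf; have [kg hg] := cg;
  split => //; try by move=> x Ux; apply: continuousM; [exact: kf|exact: kg].
move=> i; have [df pf] := hf i; have [dg pg] := hg i; split.
  by move=> x Ux; apply: derivableM; [exact: df|exact: dg].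
apply: Ck_eq_on (CkD oU (IH _ _ (Ck_mono cf) pg) (IH _ _ (Ck_mono cg) pf)) => // y Uy.
by rewrite /partial [RHS]deriveM//; [exact: df|exact: dg].
Qed.

Lemma is_derive_inv (z : R) : z != 0 -> is_derive z (1 : R) (fun y => y^-1) (- z ^- 2).
Proof.
move=> z0; apply: is_derive_eq; first exact: is_deriveV.
by rewrite -[_ *: _]/(_ * _) mulr1.
Qed.

Lemma Ck_continuous_comp (p : R -> R) U f :
  (forall x, U x -> {for x, continuous f}) -> (forall x, U x -> {for f x, continuous p}) ->
  forall x, U x -> {for x, continuous (fun y => p (f y))}.
Proof. by move=> cf cp x Ux; apply: continuous_comp; [exact: cf|exact: cp]. Qed.

Lemma CkV k U f : open U -> (forall x, U x -> f x != 0) -> Ck k U f ->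
  Ck k U (fun x => (f x)^-1).
Proof.
move=> oU f0; elim: k => [|k IH] cf; have [kf hf] := cf;
  split => //; try by move=> x Ux; apply: continuousV; [exact: f0|exact: kf].
move=> i; have [df pf] := hf i; split.
  by move=> x Ux; apply: derivableV; [exact: f0|exact: df].
have IHk := IH (Ck_mono cf).
apply: Ck_eq_on (CkM oU (Ck_cst k (-1) oU) (CkM oU (CkM oU IHk IHk) pf)) => // y Uy.
have [_ E] := is_derive_comp (is_derive_inv (f0 _ Uy)) (df y Uy).
by rewrite {2}/partial E /partial; field; exact: f0.
Qed.

Lemma Ck_sqrt k U f : open U -> (forall x, U x -> 0 < f x) -> Ck k U f ->
  Ck k U (fun x => Num.sqrt (f x)).
Proof.
move=> oU f0; elim: k => [|k IH] cf; have [kf hf] := cf; split => //;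
  try by apply: Ck_continuous_comp => // x _; exact: sqrt_continuous.
move=> i; have [df pf] := hf i; split.
  by move=> x Ux; have [] := is_derive_comp (is_derive1_sqrt (f0 _ Ux)) (df x Ux).
have IHk := IH (Ck_mono cf).
have s0 x : U x -> 2 * Num.sqrt (f x) != 0.
  by move=> Ux; rewrite mulf_neq0// gt_eqF// sqrtr_gt0 f0.
apply: Ck_eq_on (CkM oU (CkV oU s0 (CkM oU (Ck_cst k 2 oU) IHk)) pf) => // y Uy.
by have [_ E] := is_derive_comp (is_derive1_sqrt (f0 _ Uy)) (df y Uy); rewrite {2}/partial E.
Qed.

Section OnOpen.
Variable U : set 'rV[R]_n.
Hypothesis oU : open U.

Lemma smooth_eq_on f g : (forall y, U y -> f y = g y) -> smooth_on U f -> smooth_on U g.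
Proof. by move=> fg sf k; apply: Ck_eq_on (sf k). Qed.

Lemma smooth_cst c : smooth_on U (fun=> c).
Proof. by move=> k; exact: Ck_cst. Qed.

Lemma smoothD f g : smooth_on U f -> smooth_on U g -> smooth_on U (fun x => f x + g x).
Proof. by move=> sf sg k; exact: CkD. Qed.

Lemma smoothM f g : smooth_on U f -> smooth_on U g -> smooth_on U (fun x => f x * g x).
Proof. by move=> sf sg k; exact: CkM. Qed.

Lemma smoothV f : (forall x, U x -> f x != 0) -> smooth_on U f ->
  smooth_on U (fun x => (f x)^-1).
Proof. by move=> f0 sf k; exact: CkV. Qed.

Lemma smooth_sqrt f : (forall x, U x -> 0 < f x) -> smooth_on U f ->
  smooth_on U (fun x => Num.sqrt (f x)).
Proof. by move=> f0 sf k; exact: Ck_sqrt. Qed.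

Lemma smoothN f : smooth_on U f -> smooth_on U (fun x => - f x).
Proof.
move=> sf; apply: smooth_eq_on (smoothM (smooth_cst (-1)) sf) => y _.
by rewrite mulN1r.
Qed.

Lemma smooth_sum (I : Type) (r : seq I) (P : pred I) (F : I -> 'rV[R]_n -> R) :
  (forall i, P i -> smooth_on U (F i)) -> smooth_on U (fun x => \sum_(i <- r | P i) F i x).
Proof.
move=> h; elim: r => [|i r IH].
  by apply: smooth_eq_on (smooth_cst 0) => y _; rewrite big_nil.
have [Pi|nPi] := boolP (P i).
  by apply: smooth_eq_on (smoothD (h i Pi) IH) => y _; rewrite big_cons Pi.
by apply: smooth_eq_on IH => y _; rewrite big_cons (negbTE nPi).
Qed.

Lemma smooth_prod (I : Type) (r : seq I) (P : pred I) (F : I -> 'rV[R]_n -> R) :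
  (forall i, P i -> smooth_on U (F i)) -> smooth_on U (fun x => \prod_(i <- r | P i) F i x).
Proof.
move=> h; elim: r => [|i r IH].
  by apply: smooth_eq_on (smooth_cst 1) => y _; rewrite big_nil.
have [Pi|nPi] := boolP (P i).
  by apply: smooth_eq_on (smoothM (h i Pi) IH) => y _; rewrite big_cons Pi.
by apply: smooth_eq_on IH => y _; rewrite big_cons (negbTE nPi).
Qed.

Lemma smooth_derivable f i x : smooth_on U f -> U x -> derivable f x (delta_mx 0 i).
Proof. by move=> /(_ 1%N)[_ /(_ i)[d _]] Ux; exact: d. Qed.

Lemma smooth_continuous f x : smooth_on U f -> U x -> {for x, continuous f}.
Proof. by move=> /(_ 0%N)[c _] Ux; exact: c. Qed.

Lemma smooth_partial f i : smooth_on U f -> smooth_on U (partial i f).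
Proof. by move=> sf k; have [_ /(_ i)[]] := sf k.+1. Qed.

Lemma partial_cst (c : R) i (x : 'rV[R]_n) : partial i (fun=> c) x = 0.
Proof. exact: derive_cst. Qed.

Lemma partialD f g i x : smooth_on U f -> smooth_on U g -> U x ->
  partial i (fun y => f y + g y) x = partial i f x + partial i g x.
Proof.
by move=> sf sg Ux; rewrite /partial -deriveD//; exact: smooth_derivable Ux.
Qed.

Lemma partialM f g i x : smooth_on U f -> smooth_on U g -> U x ->
  partial i (fun y => f y * g y) x = partial i f x * g x + f x * partial i g x.
Proof.
move=> sf sg Ux; rewrite /partial [LHS]deriveM; [|exact: smooth_derivable Ux..].
by rewrite addrC mulrC -![_ *: _]/(_ * _) [f x * _]mulrC [g x * _]mulrC.
Qed.

Lemma partialN f i x : smooth_on U f -> U x ->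
  partial i (fun y => - f y) x = - partial i f x.
Proof.
move=> sf Ux; rewrite (partial_eq_on (g := fun y => (-1) * f y) _ oU) //.
  by rewrite partialM ?partial_cst//; [ring|exact: smooth_cst].
by move=> y _; rewrite mulN1r.
Qed.

Lemma partial_sum (I : Type) (r : seq I) (P : pred I) (F : I -> 'rV[R]_n -> R) j x :
  (forall i, P i -> smooth_on U (F i)) -> U x ->
  partial j (fun y => \sum_(i <- r | P i) F i y) x = \sum_(i <- r | P i) partial j (F i) x.
Proof.
move=> h Ux; elim: r => [|i r IH].
  by rewrite big_nil -[RHS](partial_cst 0 j x); congr partial; apply/funext => y; rewrite big_nil.
have [Pi|nPi] := boolP (P i); rewrite big_cons ?Pi ?(negbTE nPi) -IH.
  rewrite -partialD//; [|exact: h|exact: smooth_sum].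
  by congr partial; apply/funext => y; rewrite big_cons Pi.
by congr partial; apply/funext => y; rewrite big_cons (negbTE nPi).
Qed.

End OnOpen.
End Smoothness.

(** * Smoothness of the derived tensor fields *)

Section SmoothMatrices.
Variables (R : realType) (d : nat) (U : set 'rV[R]_d).
Hypothesis oU : open U.

Definition smooth_mx m n (A : 'rV[R]_d -> 'M[R]_(m, n)) := forall i j, smooth_on U (fun x => A x i j).

Lemma smooth_mulmx m n p (A : 'rV[R]_d -> 'M[R]_(m, n)) (B : 'rV[R]_d -> 'M[R]_(n, p)) :
  smooth_mx A -> smooth_mx B -> smooth_mx (fun x => A x *m B x).
Proof.
move=> sA sB i j.
apply: (smooth_eq_on oU (f := fun x => \sum_k A x i k * B x k j)) => [x _|].
  by rewrite mxE.
by apply: smooth_sum => // k _; exact: smoothM.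
Qed.

Lemma smooth_det m (A : 'rV[R]_d -> 'M[R]_m) : smooth_mx A -> smooth_on U (fun x => \det (A x)).
Proof.
move=> sA; apply: smooth_sum => // s _; apply: smoothM => //; first exact: smooth_cst.
exact: smooth_prod.
Qed.

Lemma smooth_invmx m (A : 'rV[R]_d -> 'M[R]_m) : smooth_mx A ->
  (forall x, U x -> A x \in unitmx) -> smooth_mx (fun x => invmx (A x)).
Proof.
move=> sA uA i j.
apply: (smooth_eq_on oU (f := fun x => (\det (A x))^-1 * \adj (A x) i j)).
  by move=> x Ux; rewrite /invmx uA// [RHS]mxE.
apply: smoothM => //.
  apply: smoothV => //; last exact: smooth_det.
  by move=> x /uA; rewrite unitmxE unitfE.
apply: (smooth_eq_on oU (f := fun x => cofactor (A x) j i)) => [x _|]; first by rewrite mxE.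
apply: smoothM => //; first exact: smooth_cst.
apply: smooth_det => k l.
by apply: (smooth_eq_on oU (f := fun x => A x (lift j k) (lift i l))) => // x _; rewrite !mxE.
Qed.

Definition partial_mx m n (a : 'I_d) (A : 'rV[R]_d -> 'M[R]_(m, n)) x : 'M[R]_(m, n) :=
  \matrix_(i, j) partial a (fun y => A y i j) x.

Lemma partial_mx_eq_on m n a (A B : 'rV[R]_d -> 'M[R]_(m, n)) x :
  (forall y, U y -> A y = B y) -> U x -> partial_mx a A x = partial_mx a B x.
Proof.
move=> AB Ux; apply/matrixP => i j; rewrite !mxE.
by apply: (partial_eq_on _ oU) => // y /AB ->.
Qed.

Lemma partial_mxM m n p a (A : 'rV[R]_d -> 'M[R]_(m, n)) (B : 'rV[R]_d -> 'M[R]_(n, p)) x :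
  smooth_mx A -> smooth_mx B -> U x -> partial_mx a (fun y => A y *m B y) x =
  partial_mx a A x *m B x + A x *m partial_mx a B x.
Proof.
move=> sA sB Ux; apply/matrixP => i j; rewrite !mxE -big_split /=.
rewrite (partial_eq_on (g := fun y => \sum_k A y i k * B y k j) _ oU) //; last first.
  by move=> y _; rewrite mxE.
rewrite (partial_sum oU) //; last by move=> k _; exact: smoothM.
by apply: eq_bigr => k _; rewrite (partialM a (sA i k) (sB k j) Ux) !mxE.
Qed.

Lemma partial_mx_cst m n a (c : 'M[R]_(m, n)) x : partial_mx a (fun=> c) x = 0.
Proof. by apply/matrixP => i j; rewrite !mxE partial_cst. Qed.

End SmoothMatrices.

Section DerivedFields.
Variables (R : realType) (U : set 'rV[R]_6).
Hypothesis oU : open U.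
Variables (om : local_field R 2) (ph : local_field R 3).
Hypotheses (smooth_om : forall I, smooth_on U (fun x => om x I))
  (alt_om : forall x, U x -> Defs.alternating (om x))
  (unit_om : forall x, U x -> form_mx (om x) \in unitmx).
Hypotheses (smooth_ph : forall I, smooth_on U (fun x => ph x I))
  (alt_ph : forall x, U x -> Defs.alternating (ph x))
  (lambda_lt0 : forall x, U x -> hitchin_lambda (ph x) < 0).

Local Notation W := (fun x => form_mx (om x)).
Local Notation V := (fun x => form_inv (om x)).
Local Notation J := (fun x => almost_complex (om x) (ph x)).
Local Notation g := (fun x => metric (om x) (ph x)).
Local Notation pf := (fun x => pfaffian (comp2 (om x))).
Local Notation vol := (fun x => Num.sqrt (\det (metric (om x) (ph x)))).

Lemma smooth_form_mx : smooth_mx U W.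
Proof.
move=> i j; apply: (smooth_eq_on oU (f := fun x => om x [tuple i; j])) => // x _.
by rewrite mxE.
Qed.

Lemma smooth_form_inv : smooth_mx U V.
Proof. exact: smooth_invmx smooth_form_mx unit_om. Qed.

Lemma smooth_hitchin_K : smooth_mx U (fun x => hitchin_K (ph x)).
Proof.
move=> a b; apply: (smooth_eq_on oU (f := fun x => - 12^-1 *
  top6 (fun c0 c1 c2 c3 c4 c5 => (a == c0)%:R * (comp3 (ph x) b c1 c2 * comp3 (ph x) c3 c4 c5)))).
  by move=> x _; rewrite hitchin_KE mxE.
apply: smoothM => //; first exact: smooth_cst.
apply: smooth_sum => // I _; apply: smoothM => //; first exact: smooth_cst.
apply: smoothM => //; first exact: smooth_cst.
by apply: smoothM => //; exact: smooth_ph.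
Qed.

Lemma smooth_hitchin_lambda : smooth_on U (fun x => hitchin_lambda (ph x)).
Proof.
apply: smoothM => //; first exact: smooth_cst.
by apply: smooth_sum => // i _; apply: smooth_mulmx => //; exact: smooth_hitchin_K.
Qed.

Lemma smooth_pfaffian : smooth_on U pf.
Proof.
apply: (smooth_eq_on oU (f := fun x => 48^-1 * top6 (fun a b c d e f =>
    comp2 (om x) a b * (comp2 (om x) c d * comp2 (om x) e f)))).
  by move=> x Ux; rewrite top6_cube ?mulKf//; exact/alternating_comp2/alt_om.
apply: smoothM => //; first exact: smooth_cst.
apply: smooth_sum => // I _; apply: smoothM => //; first exact: smooth_cst.
by apply: smoothM => //; [exact: smooth_om|apply: smoothM => //; exact: smooth_om].
Qed.

Lemma pf_neq0 x : U x -> pf x != 0.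
Proof. by move=> Ux; apply: pfaffian_neq0; [exact: alt_om|exact: unit_om]. Qed.

(** The sign of the Pfaffian p is p / |p|, which is smooth where p does not vanish. *)
Lemma smooth_orient : smooth_on U (fun x => orient (om x)).
Proof.
apply: (smooth_eq_on oU (f := fun x => pf x * (Num.sqrt (pf x * pf x))^-1)).
  move=> x Ux; have p0 := pf_neq0 Ux.
  rewrite orientE; last exact: alt_om.
  by rewrite -expr2 sqrtr_sqr {1}[pf x]numEsg mulfK// normr_eq0.
apply: smoothM => //; first exact: smooth_pfaffian.
apply: smoothV => //.
  move=> x /pf_neq0 p0; rewrite -expr2 sqrtr_sqr normr_eq0 //.
apply: smooth_sqrt => //; last by apply: smoothM => //; exact: smooth_pfaffian.
by move=> x /pf_neq0 p0; rewrite -expr2 exprn_even_gt0.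
Qed.

Lemma smooth_almost_complex : smooth_mx U J.
Proof.
move=> i j.
apply: (smooth_eq_on oU (f := fun x =>
  (orient (om x) * Num.sqrt (- hitchin_lambda (ph x)))^-1 * hitchin_K (ph x) i j)).
  by move=> x _; rewrite /almost_complex [RHS]mxE.
apply: smoothM => //; last exact: smooth_hitchin_K.
apply: smoothV => //.
  move=> x Ux; rewrite mulf_neq0//.
    by rewrite orientE ?sgr_eq0 ?pf_neq0//; exact: alt_om.
  by rewrite gt_eqF// sqrtr_gt0 oppr_gt0 lambda_lt0.
apply: smoothM => //; first exact: smooth_orient.
apply: smooth_sqrt => //; first by move=> x Ux; rewrite oppr_gt0 lambda_lt0.
by apply: smoothN => //; exact: smooth_hitchin_lambda.
Qed.

Lemma smooth_metric : smooth_mx U g.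
Proof. exact: smooth_mulmx smooth_form_mx smooth_almost_complex. Qed.

Lemma metric_unit_on x : U x -> g x \in unitmx.
Proof. by move=> Ux; apply: metric_unit; [exact: alt_om|exact: alt_ph|exact: unit_om|exact: lambda_lt0]. Qed.

Lemma smooth_metric_inv : smooth_mx U (fun x => invmx (g x)).
Proof. exact: smooth_invmx smooth_metric metric_unit_on. Qed.

Lemma smooth_raise k (al : local_field R k) I : (forall I, smooth_on U (fun x => al x I)) ->
  smooth_on U (fun x => raise_indices (g x) (al x) I).
Proof.
move=> sal; apply: smooth_sum => // K _; apply: smoothM => //.
by apply: smooth_prod => // m _; exact: smooth_metric_inv.
Qed.

Lemma smooth_normsq : smooth_on U (fun x => normsq (om x) (ph x)).
Proof.
apply: smoothM => //; first exact: smooth_cst.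
apply: smooth_sum => // I _; apply: smoothM => //; exact: smooth_raise.
Qed.

Lemma det_metric_gt0 x : U x -> 0 < \det (g x).
Proof.
move=> Ux; rewrite det_metric; [|exact: alt_om|exact: alt_ph|exact: unit_om|exact: lambda_lt0].
by rewrite exprn_even_gt0 //= pf_neq0.
Qed.

Lemma smooth_vol : smooth_on U vol.
Proof.
apply: smooth_sqrt => //; first exact: det_metric_gt0.
exact: smooth_det smooth_metric.
Qed.

Lemma smooth_insert1 (A : 'rV[R]_6 -> 'M[R]_6) (p : 'rV[R]_6 -> 'I_6 -> 'I_6 -> 'I_6 -> R) i j k :
  smooth_mx U A -> (forall i j k, smooth_on U (fun x => p x i j k)) ->
  smooth_on U (fun x => insert1 (A x) (p x) i j k).
Proof. by move=> sA sp; apply: smooth_sum => // m _; exact: smoothM. Qed.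

Lemma smooth_dual_form i j k : smooth_on U (fun x => dual_form (om x) (ph x) i j k).
Proof.
apply: smoothN => //; apply: smooth_insert1 => [|a b c]; first exact: smooth_almost_complex.
exact: smooth_ph.
Qed.

End DerivedFields.

(** * The part of Lambda d (f star phi) invariant under J *)

Section WedgeContraction.
Variable R : realFieldType.
Local Notation ord := 'I_6.

Lemma jet_ext_d_scale (df : ord -> R) (q : ord -> ord -> ord -> R) (f : R)
    (d d' : ord -> ord -> ord -> ord -> R) i j k l :
  (forall a i j k, d' a i j k = df a * q i j k + f * d a i j k) ->
  jet_ext_d d' i j k l = df i * q j k l - df j * q i k l + df k * q i j l - df l * q i j k
    + f * jet_ext_d d i j k l.
Proof. by move=> h; rewrite /jet_ext_d !h; ring. Qed.

(** Lambda (df ^ q) for a primitive three-form q: the two terms that contract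
    two slots of q vanish. *)
Lemma contract_wedge1 (V : 'M[R]_6) (df : ord -> R) (q : ord -> ord -> ord -> R)
    (D : ord -> ord -> ord -> ord -> R) b l :
  (forall i j, V j i = - V i j) ->
  (forall k, \sum_i \sum_j V i j * q i j k = 0) ->
  (forall i j k l, D i j k l = df i * q j k l - df j * q i k l + df k * q i j l - df l * q i j k) ->
  contract_jet V D b l = \sum_m (\sum_i V m i * df i) * q m b l.
Proof.
move=> sk tr0 DE.
have tr c z : \sum_i \sum_j V j i * (z * q i j c) = 0.
  transitivity (- z * \sum_i \sum_j V i j * q i j c); last by rewrite tr0 mulr0.
  rewrite mulr_sumr; apply: eq_bigr => i _; rewrite mulr_sumr; apply: eq_bigr => j _.
  by rewrite sk; ring.
rewrite /contract_jet.
have -> : \sum_i \sum_j V j i * D i j b l =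
    \sum_i \sum_j V j i * (df i * q j b l) - \sum_i \sum_j V j i * (df j * q i b l)
    + \sum_i \sum_j V j i * (df b * q i j l) - \sum_i \sum_j V j i * (df l * q i j b).
  rewrite -sumrB -big_split -sumrB; apply: eq_bigr => i _ /=.
  rewrite -sumrB -big_split -sumrB; apply: eq_bigr => j _ /=.
  by rewrite DE; ring.
rewrite (tr l) (tr b).
have -> : \sum_i \sum_j V j i * (df i * q j b l) = \sum_m (\sum_i V m i * df i) * q m b l.
  rewrite exchange_big; apply: eq_bigr => m _ /=; rewrite mulr_suml.
  by apply: eq_bigr => i _; rewrite mulrA.
have -> : \sum_i \sum_j V j i * (df j * q i b l) = - \sum_m (\sum_i V m i * df i) * q m b l.
  rewrite -sumrN; apply: eq_bigr => m _ /=; rewrite mulr_suml -sumrN.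
  by apply: eq_bigr => i _; rewrite sk; ring.
by field.
Qed.

End WedgeContraction.

Section FieldJets.
Variables (R : realType) (U : set 'rV[R]_6).
Hypothesis oU : open U.
Local Notation form3_field := ('rV[R]_6 -> 'I_6 -> 'I_6 -> 'I_6 -> R).

Definition jet3_of (q : form3_field) (x : 'rV[R]_6) (a i j k : 'I_6) : R :=
  partial a (fun y => q y i j k) x.

Lemma jet3_eq_on (q q' : form3_field) x a i j k :
  (forall y, U y -> forall i j k, q y i j k = q' y i j k) -> U x ->
  jet3_of q x a i j k = jet3_of q' x a i j k.
Proof. by move=> h Ux; apply: (partial_eq_on _ oU) => // y Uy; exact: h. Qed.

Lemma jet3_alt (q : form3_field) x a : (forall i j k, smooth_on U (fun y => q y i j k)) ->
  (forall y, U y -> alternating3 (q y)) -> U x -> alternating3 (jet3_of q x a).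
Proof.
move=> sq alt Ux; split=> i j k; rewrite /jet3_of -(partialN oU)//;
  by apply: (partial_eq_on _ oU) => // y /alt[h1 h2].
Qed.

Lemma jet3_insert1 (A : 'rV[R]_6 -> 'M[R]_6) (q : form3_field) x a i j k :
  smooth_mx U A -> (forall i j k, smooth_on U (fun y => q y i j k)) -> U x ->
  partial a (fun y => insert1 (A y) (q y) i j k) x =
  insert1 (partial_mx a A x) (q x) i j k + insert1 (A x) (jet3_of q x a) i j k.
Proof.
move=> sA sq Ux; rewrite (partial_sum oU)//; last by move=> m _; exact: smoothM.
rewrite -big_split; apply: eq_bigr => m _ /=.
by rewrite (partialM a (sA m i) (sq m j k) Ux) mxE.
Qed.

Lemma ext_d_eq_on k (al be : local_field R k) x I :
  (forall y, U y -> forall I, al y I = be y I) -> U x -> ext_d al x I = ext_d be x I.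
Proof.
move=> h Ux; apply: eq_bigr => j _; congr (_ * _).
by apply: (partial_eq_on _ oU) => // y Uy; exact: h.
Qed.

Lemma ext_d3E (al : local_field R 3) x i j k l :
  ext_d al x [tuple i; j; k; l] = jet_ext_d (jet3_of (fun y => comp3 (al y)) x) i j k l.
Proof.
rewrite /ext_d !big_ord_recl big_ord0 !mktuple3 /jet_ext_d /jet3_of /comp3.
rewrite /= !exprS expr0 /tnth /=; ring.
Qed.

Lemma ext_d2E (al : local_field R 2) x i j k : ext_d al x [tuple i; j; k] =
  partial i (fun y => comp2 (al y) j k) x - partial j (fun y => comp2 (al y) i k) x
  + partial k (fun y => comp2 (al y) i j) x.
Proof.
rewrite /ext_d !big_ord_recl big_ord0 !mktuple2 /comp2.
rewrite /= !exprS expr0 /tnth /=; ring.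
Qed.

Lemma LambdaE (om : tensor R 2) (al : tensor R 4) k l :
  Lambda om al [tuple k; l] = contract_jet (form_inv om) (fun i j k l => al [tuple i; j; k; l]) k l.
Proof.
congr (_ * _); do 2 (apply: eq_bigr => ? _); congr (_ * al _); exact: val_inj.
Qed.

Lemma nijenhuis_compE (J : 'rV[R]_6 -> 'M[R]_6) x m i j :
  nijenhuis_comp J x m i j = 4^-1 * nij4 (J x) (fun a => partial_mx a J x) m i j.
Proof.
have JE y a b : (J y *m (delta_mx b 0 : 'cV_6)) a 0 = J y a b.
  by rewrite -colE mxE.
have pJ l a b : partial l (fun y => (J y *m (delta_mx b 0 : 'cV_6)) a 0) x =
    partial_mx l J x a b.
  by rewrite mxE; congr partial; apply/funext => y; rewrite JE.
have p0 l b a : partial l (fun y : 'rV[R]_6 => (delta_mx b 0 : 'cV[R]_6) a 0) x = 0.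
  exact: partial_cst.
have sumd (f : 'I_6 -> R) b : \sum_l (delta_mx b 0 : 'cV[R]_6) l 0 * f l = f b.
  rewrite -[RHS](sum_delta b); apply: eq_bigr => l _.
  by rewrite mxE eqxx andbT eq_sym.
pose e i : vector_field R := coord_field i.
have b1 a b m' : lie_bracket (fun y => J y *m e a y) (fun y => J y *m e b y) x m' 0 =
    \sum_l (J x l a * partial_mx l J x m' b - J x l b * partial_mx l J x m' a).
  by rewrite [LHS]mxE; apply: eq_bigr => l _; rewrite /e /coord_field !JE !pJ.
have b2 a b m' : lie_bracket (fun y => J y *m e a y) (e b) x m' 0 = - partial_mx b J x m' a.
  rewrite [LHS]mxE (eq_bigr (fun l => - ((delta_mx b 0 : 'cV[R]_6) l 0 * partial_mx l J x m' a))).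
    by rewrite sumrN sumd.
  by move=> l _; rewrite /e /coord_field p0 pJ; ring.
have b3 a b m' : lie_bracket (e a) (fun y => J y *m e b y) x m' 0 = partial_mx a J x m' b.
  rewrite [LHS]mxE (eq_bigr (fun l => (delta_mx a 0 : 'cV[R]_6) l 0 * partial_mx l J x m' b)).
    by rewrite sumd.
  by move=> l _; rewrite /e /coord_field p0 pJ; ring.
have b4 a b m' : lie_bracket (e a) (e b) x m' 0 = 0.
  by rewrite [LHS]mxE big1// => l _; rewrite /e /coord_field !p0; ring.
have eB (A B : 'cV[R]_6) a : (A - B) a 0 = A a 0 - B a 0 by rewrite !mxE.
rewrite /nijenhuis_comp /nijenhuis [LHS]mxE !eB b1 b4 subr0.
rewrite [(J x *m _) m 0]mxE [X in _ - X]mxE.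
under [X in _ - X - _]eq_bigr do rewrite b2.
under [X in _ - _ - X]eq_bigr do rewrite b3.
congr (_ * _); rewrite /nij4 -!sumrB; apply: eq_bigr => l _; ring.
Qed.

End FieldJets.

Section TypeOneOne.
Variables (R : realType) (U : set 'rV[R]_6).
Hypothesis oU : open U.
Variables (om : local_field R 2) (ph : local_field R 3).
Hypotheses (smooth_om : forall I, smooth_on U (fun x => om x I))
  (alt_om : forall x, U x -> Defs.alternating (om x))
  (unit_om : forall x, U x -> form_mx (om x) \in unitmx).
Hypotheses (smooth_ph : forall I, smooth_on U (fun x => ph x I))
  (alt_ph : forall x, U x -> Defs.alternating (ph x))
  (closed_ph : forall x, U x -> forall I, ext_d ph x I = 0)
  (prim : forall x, U x -> forall I, Lambda (om x) (ph x) I = 0)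
  (lambda_lt0 : forall x, U x -> hitchin_lambda (ph x) < 0).

Local Notation V := (fun x => form_inv (om x)).
Local Notation J := (fun x => almost_complex (om x) (ph x)).
Local Notation nsq := (fun x => normsq (om x) (ph x)).

(** Up to sign, this and [scaled_form] are the real and the imaginary part of a
    form of type (3,0). *)
Definition scaled_dual x i j k := nsq x * dual_form (om x) (ph x) i j k.
Definition scaled_form x i j k := nsq x * comp3 (ph x) i j k.

Let type_ph x : U x -> alternating3 (insert1 (J x) (comp3 (ph x))).
Proof. by move=> Ux; apply: almost_complex_type; exact: alt_ph. Qed.

Let JJ x : U x -> J x *m J x = - 1%:M.
Proof.
by move=> Ux; apply: almost_complex_square; [exact: alt_om|exact: alt_ph|exact: unit_om|exact: lambda_lt0].
Qed.

Lemma scaled_dualE x : U x -> forall i j k,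
  scaled_dual x i j k = - insert1 (J x) (scaled_form x) i j k.
Proof.
move=> Ux i j k; rewrite /scaled_dual /dual_form /scaled_form /insert1 mulrN mulr_sumr.
by congr (- _); apply: eq_bigr => m _; rewrite mulrCA.
Qed.

Lemma scaled_formE x : U x -> forall i j k,
  scaled_form x i j k = insert1 (J x) (scaled_dual x) i j k.
Proof.
move=> Ux i j k.
transitivity (nsq x * - insert1 (J x) (insert1 (J x) (comp3 (ph x))) i j k).
  rewrite insert1M JJ// (_ : - 1%:M = (-1)%:M); last by rewrite -scaleN1r scalemx1.
  by rewrite insert1_scalar /scaled_form; ring.
rewrite /scaled_dual /dual_form {1}/insert1 mulrN -mulNr mulr_sumr [RHS]/insert1.
by apply: eq_bigr => m _; ring.
Qed.

Lemma scaled_dual_alt x : U x -> alternating3 (scaled_dual x).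
Proof.
move=> Ux; have [h1 h2] := dual_form_alt (om x) (alt_ph Ux).
by split=> i j k; rewrite /scaled_dual; [rewrite (h1 i j)|rewrite (h2 i j)]; rewrite mulrN.
Qed.

Lemma scaled_form_alt x : U x -> alternating3 (scaled_form x).
Proof.
move=> Ux; have [h1 h2] := alternating_comp3 (alt_ph Ux).
by split=> i j k; rewrite /scaled_form; [rewrite (h1 i j)|rewrite (h2 i j)]; rewrite mulrN.
Qed.

Let smooth_nsq : smooth_on U nsq.
Proof. exact: smooth_normsq. Qed.

Lemma smooth_scaled_dual i j k : smooth_on U (fun x => scaled_dual x i j k).
Proof. by apply: smoothM => //; exact: smooth_dual_form. Qed.

Lemma smooth_scaled_form i j k : smooth_on U (fun x => scaled_form x i j k).
Proof. by apply: smoothM => //; exact: smooth_ph. Qed.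

Let smooth_J : smooth_mx U J.
Proof. exact: smooth_almost_complex. Qed.

Let primV x k : U x -> \sum_i \sum_j V x i j * comp3 (ph x) i j k = 0.
Proof. by move=> Ux; apply: primitive_comp; [exact: alt_ph|exact: prim]. Qed.

(** Since phi is closed, d(|phi|^2 phi) = d|phi|^2 ^ phi, and Lambda of it is a
    contraction of phi by primitivity. *)
Lemma contract_scaled_form x b l : U x ->
  contract_jet (V x) (jet_ext_d (jet3_of scaled_form x)) b l =
  \sum_m (\sum_i V x m i * partial i nsq x) * comp3 (ph x) m b l.
Proof.
move=> Ux; have sk i j : V x j i = - V x i j.
  by have /matrixP/(_ i j) := form_inv_skew (alt_om Ux) (unit_om Ux); rewrite !mxE.
apply: contract_wedge1 => // [|i j k l']; first by move=> k; exact: primV.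
rewrite (jet_ext_d_scale (df := fun i => partial i nsq x) (q := comp3 (ph x)) (f := nsq x)
  (d := jet3_of (fun y => comp3 (ph y)) x)); last first.
  move=> a i' j' k'.
  by rewrite /jet3_of (partialM a smooth_nsq (smooth_ph [tuple i'; j'; k']) Ux).
by rewrite -ext_d3E closed_ph// mulr0 addr0.
Qed.

Local Notation beta x := (contract_jet (V x) (jet_ext_d (jet3_of scaled_dual x))).

Let dJ x a := partial_mx a J x.

(** Here [type_11_part] is applied to the jets of f star phi and f phi; the
    derivative of J^2 = -1 provides dJ J = - J dJ, and the Nijenhuis term is
    compared with N^dagger through the inverse metric of [metric_inv]. *)
Lemma beta_type11 x k j : U x ->
  beta x k j + \sum_p J x p k * (\sum_q J x q j * beta x p q) =
  2 * (nsq x * N_dagger om ph x [tuple k; j]).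
Proof.
move=> Ux.
have sd := smooth_scaled_dual; have sf := smooth_scaled_form.
have alt_ds a : alternating3 (jet3_of scaled_dual x a).
  by apply: (jet3_alt oU) => // y; exact: scaled_dual_alt.
have alt_df a : alternating3 (jet3_of scaled_form x a).
  by apply: (jet3_alt oU) => // y; exact: scaled_form_alt.
have dE a i' j' k' : jet3_of scaled_dual x a i' j' k' =
    - (insert1 (dJ x a) (scaled_form x) i' j' k' +
       insert1 (J x) (jet3_of scaled_form x a) i' j' k').
  rewrite -(jet3_insert1 oU)// -(partialN oU)//; last exact: smooth_insert1.
  by apply: (partial_eq_on _ oU) => // y Uy; exact: scaled_dualE.
have fE a i' j' k' : jet3_of scaled_form x a i' j' k' =
    insert1 (dJ x a) (scaled_dual x) i' j' k' + insert1 (J x) (jet3_of scaled_dual x a) i' j' k'.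
  rewrite -(jet3_insert1 oU)//.
  by apply: (partial_eq_on _ oU) => // y Uy; exact: scaled_formE.
have dJJ a : dJ x a *m J x = - (J x *m dJ x a).
  apply/eqP; rewrite -addr_eq0 -(partial_mxM oU a smooth_J smooth_J Ux).
  by rewrite (@partial_mx_eq_on _ _ _ oU _ _ a _ (fun=> - 1%:M) x)// partial_mx_cst.
have Vs := form_inv_skew (alt_om Ux) (unit_om Ux).
have JVs : (J x *m V x)^T = J x *m V x.
  have := metric_inv (alt_om Ux) (alt_ph Ux) (unit_om Ux) (prim Ux) (lambda_lt0 Ux).
  move/(congr1 trmx); rewrite trmx_inv metric_sym; [|exact: alt_om|exact: alt_ph|exact: unit_om|exact: prim].
  rewrite metric_inv; [|exact: alt_om|exact: alt_ph|exact: unit_om|exact: prim|exact: lambda_lt0].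
  by rewrite !trmx_mul trmxK Vs mulmxN mulNmx => ->; rewrite opprK.
have alt_p := alternating_comp3 (alt_ph Ux); have typ := type_ph Ux.
have key j' l' := type_11_part (scaled_dualE Ux) (scaled_formE Ux) (scaled_dual_alt Ux)
  (scaled_form_alt Ux) alt_ds alt_df dE fE (JJ Ux) dJJ Vs JVs j' l' alt_p typ
  (fun b l => contract_scaled_form b l Ux).
have raised j' k' := raised_nij_contract (psi := scaled_dual x) (f := nsq x) (dJ x) (V x) j' k'
  alt_p typ.
have {}raised j' k' := raised j' k' ltac:(by move=> *; rewrite /scaled_dual /dual_form; ring).
have NE m j' l' : nijenhuis_raised J (metric (om x) (ph x)) x m j' l' =
    \sum_s 4^-1 * nij4 (J x) (dJ x) m j' s * (V x *m (J x)^T) s l'.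
  apply: eq_bigr => s _; rewrite nijenhuis_compE metric_inv//;
   [exact: alt_om|exact: alt_ph|exact: unit_om|exact: prim|exact: lambda_lt0].
have bskew a b : beta x b a = - beta x a b.
  rewrite /contract_jet -mulrN -sumrN; congr (_ * _); apply: eq_bigr => i _.
  rewrite -sumrN; apply: eq_bigr => i' _.
  by have [_ _ h] := jet_ext_d_alt alt_ds; rewrite (h i i' a b); ring.
set n := nij_contract (J x) (dJ x) (scaled_dual x) (V x) in key raised.
have nskew : n k j = - n j k.
  rewrite -!key opprD; congr (_ + _); first exact: bskew.
  rewrite exchange_slots -sumrN; apply: eq_bigr => p _.
  rewrite -mulrN -sumrN; congr (_ * _); apply: eq_bigr => q _.
  by rewrite -mulrN -bskew.
rewrite key /N_dagger /=.
have -> : nsq x * \sum_m \sum_l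
     (nijenhuis_raised J (metric (om x) (ph x)) x m j l * comp3 (ph x) m k l
      - nijenhuis_raised J (metric (om x) (ph x)) x m k l * comp3 (ph x) m j l) =
     - (4^-1 * n j k) + 4^-1 * n k j.
  rewrite -raised -[X in _ + X]opprK -raised -mulrBr; congr (_ * _).
  rewrite -sumrB; apply: eq_bigr => m _; rewrite -sumrB; apply: eq_bigr => l _.
  by rewrite !NE.
by rewrite nskew; field.
Qed.

End TypeOneOne.

(** * Iterated integrals of functions supported in a cube *)

Section BoxFunctions.
Variable R : realType.

(** A class of integrands that is stable under integrating out one coordinate,
    so that iterated integrals are treated by induction on the dimension. *)
Definition cube_supported n (L : R) (f : 'rV[R]_n -> R) : Prop :=
  [/\ forall e : R, 0 < e -> exists2 d : R, 0 < d &
        forall x y : 'rV[R]_n, `|x - y| <= d -> `|f x - f y| <= e,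
      forall (x : 'rV[R]_n) (i : 'I_n), L < `|x 0 i| -> f x = 0 &
      exists B : R, forall x : 'rV[R]_n, `|f x| <= B].

Definition slice n (f : 'rV[R]_n.+1 -> R) (t : R) (v : 'rV[R]_n) : R :=
  f (row_mx (t%:M : 'rV[R]_1) v).

Lemma rV_norm_le n (x : 'rV[R]_n) (e : R) :
  0 <= e -> (forall i, `|x 0 i| <= e) -> `|x| <= e.
Proof.
move=> e0 h; rewrite /Num.Def.normr/= mx_normrE; apply: bigmax_le => //.
by move=> [i j] _ /=; rewrite (ord1 i).
Qed.

Lemma rV_entry_le n (x : 'rV[R]_n) i : `|x 0 i| <= `|x|.
Proof.
rewrite /Num.Def.normr/= mx_normrE.
exact: (le_bigmax _ (fun ij : 'I_1 * 'I_n => `|x ij.1 ij.2|) (ord0, i)).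
Qed.

Lemma slice_tE n (t : R) (v : 'rV[R]_n) : (row_mx (t%:M : 'rV[R]_1) v) 0 ord0 = t.
Proof.
have -> : ord0 = lshift n (ord0 : 'I_1) by apply: val_inj.
by rewrite row_mxEl mxE eqxx mulr1n.
Qed.

Lemma slice_vE n (t : R) (v : 'rV[R]_n) i :
  (row_mx (t%:M : 'rV[R]_1) v) 0 (lift ord0 i) = v 0 i.
Proof.
have -> : lift ord0 i = rshift 1 i by apply: val_inj.
by rewrite row_mxEr.
Qed.

Lemma entryB n (x y : 'rV[R]_n) i : (x - y) 0 i = x 0 i - y 0 i.
Proof. by rewrite mxE [X in _ + X]mxE. Qed.

Lemma norm_slice_v n (t : R) (v w : 'rV[R]_n) :
  `|(row_mx (t%:M : 'rV[R]_1) v : 'rV_n.+1) - row_mx (t%:M : 'rV[R]_1) w| <= `|v - w|.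
Proof.
apply: rV_norm_le => // i; case: (unliftP ord0 i) => [j|] ->.
  by rewrite entryB !slice_vE -entryB rV_entry_le.
by rewrite entryB !slice_tE subrr normr0.
Qed.

Lemma norm_slice_t n (t s : R) (v : 'rV[R]_n) :
  `|(row_mx (t%:M : 'rV[R]_1) v : 'rV_n.+1) - row_mx (s%:M : 'rV[R]_1) v| <= `|t - s|.
Proof.
apply: rV_norm_le => // i; case: (unliftP ord0 i) => [j|] ->.
  by rewrite entryB !slice_vE subrr normr0.
by rewrite entryB !slice_tE.
Qed.

Lemma slice_cube n L (f : 'rV[R]_n.+1 -> R) t :
  cube_supported L f -> cube_supported L (slice f t).
Proof.
case=> uc su [B bd]; split.
- move=> e /uc[d d0 h]; exists d => // x y xy; apply: h.
  exact: le_trans (norm_slice_v _ _ _) xy.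
- by move=> x i Li; rewrite /slice; apply: (su _ (lift ord0 i)); rewrite slice_vE.
- by exists B => x; apply: bd.
Qed.

Lemma cube_lin n L (a : R) (f g : 'rV[R]_n -> R) :
  cube_supported L f -> cube_supported L g ->
  cube_supported L (fun x => a * f x + g x).
Proof.
case=> ucf suf [Bf bdf] [ucg sug [Bg bdg]]; split.
- move=> e e0.
  have a0 : 0 < 2 * (`|a| + 1) by have := normr_ge0 a; lra.
  have [d1 d10 h1] := ucf (e / (2 * (`|a| + 1))) (divr_gt0 e0 a0).
  have [d2 d20 h2] := ucg (e / 2) ltac:(lra).
  exists (Num.min d1 d2); first by rewrite lt_min d10 d20.
  move=> x y; rewrite le_min => /andP[/h1 k1 /h2 k2].
  have -> : a * f x + g x - (a * f y + g y) = a * (f x - f y) + (g x - g y) by ring.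
  apply: le_trans (ler_normD _ _) _; rewrite normrM.
  have : `|a| * `|f x - f y| <= e / 2.
    apply: (@le_trans _ _ ((`|a| + 1) * (e / (2 * (`|a| + 1))))).
      by apply: ler_pM => //; lra.
    rewrite le_eqVlt; apply/orP; left; apply/eqP; field.
    by have := normr_ge0 a; lra.
  lra.
- by move=> x i h; rewrite (suf x i h) (sug x i h) mulr0 addr0.
- exists (`|a| * Bf + Bg) => x; apply: le_trans (ler_normD _ _) _.
  by rewrite lerD// normrM ler_wpM2l.
Qed.

Lemma uc_continuous (F : R -> R) (C : R) : 0 <= C ->
  (forall e : R, 0 < e -> exists2 d : R, 0 < d &
        forall x y, `|x - y| <= d -> `|F x - F y| <= e * C) -> continuous F.
Proof.
move=> C0 uc x; apply/cvgrPdist_le => e e0.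
have e0' : 0 < e / (C + 1) by apply: divr_gt0 => //; lra.
have [d d0 h] := uc _ e0'; near=> y.
apply: le_trans (h _ _ _) _.
  by near: y; move: d d0 {h}; apply/cvgrPdist_le; exact: cvg_id.
rewrite -mulrA ler_piMr ?(ltW e0)// mulrC ler_pdivrMr; lra.
Unshelve. all: by end_near. Qed.

Lemma Rint_box (L : R) (F : R -> R) : (forall t, L < `|t| -> F t = 0) ->
  \int[@lebesgue_measure R]_t F t = \int[@lebesgue_measure R]_(t in `[-L, L]) F t.
Proof.
move=> h; rewrite [RHS]Rintegral_mkcond; congr (Rintegral _ _ _).
apply/funext => t; rewrite patchE; case: ifPn => // /negP tL.
apply: h; rewrite ltNge; apply/negP => tl; apply: tL.
by rewrite inE/= in_itv/= -ler_norml.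
Qed.

Lemma box_integrable (L : R) (F : R -> R) : continuous F ->
  (@lebesgue_measure R).-integrable `[-L, L] (EFin \o F).
Proof.
move=> cF; apply: continuous_compact_integrable; first exact: segment_compact.
exact: continuous_subspaceT.
Qed.

Lemma Rint_box_bound (L B : R) (F : R -> R) : 0 <= L -> continuous F ->
  (forall t, L < `|t| -> F t = 0) -> (forall t, `|F t| <= B) ->
  `|\int[@lebesgue_measure R]_t F t| <= B * (L *+ 2).
Proof.
move=> L0 cF sF bF; rewrite (Rint_box sF).
apply: le_trans (le_normr_Rintegral _ (box_integrable L cF)) _ => //.
have -> : B * (L *+ 2) = \int[@lebesgue_measure R]_(t in `[-L, L]) B.
  rewrite Rintegral_cst//= lebesgue_measure_itv/= lte_fin.
  case: ltP => [_|/= h]; first by rewrite opprK -mulr2n.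
  have -> : L = 0 by lra.
  by rewrite mul0rn mulr0.
apply: le_Rintegral => //.
- apply: (box_integrable L (F := fun t => `|F t|)) => t.
  by apply: continuous_comp; [exact: cF | exact: norm_continuous].
- apply: (box_integrable L (F := fun t => B)) => t; exact: cvg_cst.
Qed.

Lemma Rint_box_lin (L a : R) (F G : R -> R) : continuous F -> continuous G ->
  (forall t, L < `|t| -> F t = 0) -> (forall t, L < `|t| -> G t = 0) ->
  \int[@lebesgue_measure R]_t (a * F t + G t) =
  a * \int[@lebesgue_measure R]_t F t + \int[@lebesgue_measure R]_t G t.
Proof.
move=> cF cG sF sG; rewrite (Rint_box sF) (Rint_box sG) (Rint_box (L := L)); last first.
  by move=> t h; rewrite sF// sG// mulr0 addr0.
have iF := box_integrable L cF; have iG := box_integrable L cG.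
rewrite -RintegralZl// RintegralD//.
apply: (box_integrable L (F := fun t => a * F t)) => t.
by apply: continuousM; [exact: cst_continuous|exact: cF].
Qed.

Lemma integral_rVS n (f : 'rV[R]_n.+1 -> R) :
  integral_rV f = \int[@lebesgue_measure R]_t integral_rV (slice f t).
Proof. by []. Qed.

Lemma integral_rV0 n : integral_rV (fun _ : 'rV[R]_n => 0) = 0 :> R.
Proof.
elim: n => [//|n IH]; rewrite integral_rVS -[RHS](Rintegral_set0 (@lebesgue_measure R) (cst 0)).
rewrite [RHS]Rintegral_mkcond; congr (Rintegral _ _ _); apply/funext => t.
by rewrite /slice IH patchE in_set0.
Qed.

Lemma slice_integral_box n L : 0 <= L ->
  (forall (f : 'rV[R]_n -> R) B, cube_supported L f -> (forall x, `|f x| <= B) ->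
     `|integral_rV f| <= B * (L *+ 2) ^+ n) ->
  (forall a (f g : 'rV[R]_n -> R), cube_supported L f -> cube_supported L g ->
     integral_rV (fun x => a * f x + g x) = a * integral_rV f + integral_rV g) ->
  forall f : 'rV[R]_n.+1 -> R, cube_supported L f ->
  continuous (fun t => integral_rV (slice f t)) /\
  forall t, L < `|t| -> integral_rV (slice f t) = 0.
Proof.
move=> L0 bd lin f cf; have [uc sf _] := cf; split.
  apply: (@uc_continuous _ ((L *+ 2) ^+ n)); first by rewrite exprn_ge0// mulrn_wge0.
  move=> e /uc[d d0 h]; exists d => // t s ts.
  have -> : integral_rV (slice f t) - integral_rV (slice f s) =
      integral_rV (fun v => -1 * slice f s v + slice f t v).
    by rewrite lin; [ring|exact: slice_cube|exact: slice_cube].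
  apply: bd; first by apply: cube_lin; exact: slice_cube.
  move=> v; rewrite mulN1r addrC; apply: h.
  exact: le_trans (norm_slice_t _ _ _) ts.
move=> t Lt; rewrite -[RHS](integral_rV0 n); congr integral_rV.
by apply/funext => v; apply: (sf _ ord0); rewrite slice_tE.
Qed.

(** The bound and the linearity are proved together: linearity in dimension
    n + 1 needs the continuity of the inner integral, which follows from the
    bound in dimension n applied to a difference of slices. *)
Lemma integral_rV_bound_lin n L : 0 <= L ->
  (forall (f : 'rV[R]_n -> R) B, cube_supported L f -> (forall x, `|f x| <= B) ->
     `|integral_rV f| <= B * (L *+ 2) ^+ n) /\
  (forall a (f g : 'rV[R]_n -> R), cube_supported L f -> cube_supported L g ->
     integral_rV (fun x => a * f x + g x) = a * integral_rV f + integral_rV g).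
Proof.
move=> L0; elim: n => [|n [IHb IHl]].
  by split=> [f B _ /(_ 0)|//]; rewrite expr0 mulr1.
have inner := slice_integral_box L0 IHb IHl.
split=> [f B cf bf|a f g cf cg].
  have [c z] := inner f cf; rewrite exprSr mulrA integral_rVS; apply: Rint_box_bound => //.
  by move=> t; apply: IHb; [exact: slice_cube|move=> v; apply: bf].
have [c1 z1] := inner f cf; have [c2 z2] := inner g cg.
rewrite integral_rVS.
under eq_Rintegral do rewrite (IHl a _ _ (slice_cube _ cf) (slice_cube _ cg)).
exact: (@Rint_box_lin L).
Qed.

End BoxFunctions.

Section BoxIntegral.
Variable R : realType.

Lemma integral_rV_ge0 n (f : 'rV[R]_n -> R) : (forall x, 0 <= f x) -> 0 <= integral_rV f.
Proof.
elim: n f => [|n IH] f f0 /=; first exact: f0.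
by apply: Rintegral_ge0 => t _; apply: IH => v; exact: f0.
Qed.

Lemma Rint_box_gt0 (L : R) (F : R -> R) t0 : continuous F ->
  (forall t, L < `|t| -> F t = 0) -> (forall t, 0 <= F t) -> 0 < F t0 ->
  0 < \int[@lebesgue_measure R]_t F t.
Proof.
move=> cF sF F0 Ft0.
have [d /= d0 hd] : exists2 d : R, 0 < d & forall t, `|t0 - t| <= d -> F t0 / 2 <= F t.
  have /cvgrPdist_le/(_ (F t0 / 2)) := cF t0.
  case=> [|d /= d0 h]; first lra.
  exists (d / 2); first by lra.
  move=> t td; have := h t; rewrite /ball_/= => /(_ _)/ler_normlP.
  by case=> [|_]; lra.
pose D : set R := `[t0 - d, t0 + d]%classic.
have FE : (EFin \o F) \_ `[-L, L]%classic = EFin \o F.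
  apply/funext => t; rewrite patchE; case: ifPn => // /negP tL /=; rewrite sF//.
  rewrite ltNge; apply/negP => tl; apply: tL.
  by rewrite inE/= in_itv/= -ler_norml.
apply: (@lt_le_trans _ _ (\int[@lebesgue_measure R]_t (((cst (F t0 / 2)) \_ D) t))).
  rewrite -Rintegral_mkcond Rintegral_cst//=; last exact: measurable_itv.
  by rewrite lebesgue_measure_itv/= lte_fin ifT/= ?mulr_gt0//; lra.
apply: le_Rintegral => //.
- have -> : EFin \o ((cst (F t0 / 2)) \_ D) = (EFin \o cst (F t0 / 2)) \_ D.
    by apply/funext => t /=; rewrite !patchE; case: ifP.
  have mD : measurable (D : set (measurableTypeR R)) by exact: measurable_itv.
  have [h _] := @integrable_mkcond _ _ _ (@lebesgue_measure R) D (EFin \o cst (F t0 / 2)) mD.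
  apply: h; apply: continuous_compact_integrable; first exact: segment_compact.
  by apply: continuous_subspaceT => t; exact: cvg_cst.
- have [h _] := @integrable_mkcond _ _ _ (@lebesgue_measure R) `[-L, L]%classic (EFin \o F)
    (measurable_itv _).
  rewrite -FE; apply: h; exact: box_integrable.
move=> t _; rewrite patchE; case: ifPn => // tD; apply: hd.
by move: tD; rewrite inE /D/= in_itv/= ler_distlC.
Qed.

Lemma box_inner n L (f : 'rV[R]_n.+1 -> R) : 0 <= L -> cube_supported L f ->
  continuous (fun t => integral_rV (slice f t)) /\
  forall t, L < `|t| -> integral_rV (slice f t) = 0.
Proof. by move=> L0; have [bd lin] := integral_rV_bound_lin n L0; exact: slice_integral_box. Qed.

Lemma row_slice n (x : 'rV[R]_n.+1) : exists t v, x = row_mx (t%:M : 'rV[R]_1) v.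
Proof.
exists (x 0 ord0), (rsubmx (x : 'rV_(1 + n))).
apply/rowP => i; case: (unliftP ord0 i) => [j|] ->.
  rewrite slice_vE mxE; congr (x _ _); exact: val_inj.
by rewrite slice_tE.
Qed.

Lemma integral_rV_gt0 n L (f : 'rV[R]_n -> R) x0 : 0 <= L -> cube_supported L f ->
  (forall x, 0 <= f x) -> 0 < f x0 -> 0 < integral_rV f.
Proof.
move=> L0; elim: n f x0 => [|n IH] f x0 cf f0 fx0.
  by rewrite /= -(_ : x0 = 0)//; apply/rowP => -[].
have [t [v E]] := row_slice x0.
have [c s] := box_inner L0 cf.
rewrite integral_rVS; apply: (Rint_box_gt0 (t0 := t) c s).
  by move=> u; apply: integral_rV_ge0 => w; exact: f0.
apply: (IH _ v); [exact: slice_cube|by move=> w; exact: f0|].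
by rewrite /slice -E.
Qed.

Lemma quotient_slice_v n (f : 'rV[R]_n.+1 -> R) t v j :
  (fun h : R => h^-1 *: ((f \o shift (row_mx (t%:M : 'rV[R]_1) v : 'rV_n.+1))
      (h *: delta_mx 0 (lift ord0 j)) - f (row_mx (t%:M : 'rV[R]_1) v)) : R^o) =
  (fun h => h^-1 *: ((slice f t \o shift v) (h *: delta_mx 0 j) - slice f t v)).
Proof.
apply/funext => h; rewrite /slice/=; congr (_ *: (f _ - _)).
apply/rowP => i; rewrite mxE.
case: (unliftP ord0 i) => [k|] ->; rewrite ?slice_vE ?slice_tE !mxE.
  by rewrite (inj_eq lift_inj).
by rewrite /= mulr0 add0r.
Qed.

Lemma quotient_slice_t n (f : 'rV[R]_n.+1 -> R) t v :
  (fun h : R => h^-1 *: ((f \o shift (row_mx (t%:M : 'rV[R]_1) v : 'rV_n.+1))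
      (h *: delta_mx 0 ord0) - f (row_mx (t%:M : 'rV[R]_1) v)) : R^o) =
  (fun h => h^-1 *: (((fun u => slice f u v) \o shift t) (h *: 1) - slice f t v)).
Proof.
apply/funext => h; rewrite /slice/=; congr (_ *: (f _ - _)).
apply/rowP => i; rewrite mxE.
case: (unliftP ord0 i) => [k|] ->; rewrite ?slice_vE ?slice_tE !mxE.
  by rewrite /= mulr0 add0r.
by rewrite eqxx.
Qed.

(** For a coordinate of an inner integral this is the induction hypothesis. For
    the outermost one, uniform continuity of the derivative allows to
    differentiate under the integral sign, and the fundamental theorem of
    calculus applies. *)
Lemma integral_partial0 n L (f : 'rV[R]_n -> R) i : 0 <= L ->
  cube_supported L f -> cube_supported L (partial i f) ->
  (forall x, derivable f x (delta_mx 0 i)) -> integral_rV (partial i f) = 0.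
Proof.
move=> L0; elim: n f i => [|n IH] f i; first by case: i.
move=> cf cg df; case: (unliftP ord0 i) => [j|] ij; rewrite ij in cg df *.
  rewrite integral_rVS.
  have E t : slice (partial (lift ord0 j) f) t = partial j (slice f t).
    apply/funext => v; rewrite {1}/slice /partial /derive.
    by rewrite quotient_slice_v.
  have -> : (fun t => integral_rV (slice (partial (lift ord0 j) f) t)) = cst 0.
    apply/funext => t; rewrite E; apply: IH => //; [exact: slice_cube| |].
      by rewrite -E; exact: slice_cube.
    by move=> v; have := df (row_mx t%:M v); rewrite /derivable quotient_slice_v.
  by rewrite Rintegral_cst// mul0r.
set g := partial ord0 f; rewrite -/g in cg.
have dsl (t : R) (v : 'rV[R]_n) : is_derive t (1 : R) (fun u => slice f u v : R) (slice g t v).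
  have := df (row_mx t%:M v); rewrite /derivable quotient_slice_t => h.
  by apply: DeriveDef => //; rewrite /slice /g /partial /derive quotient_slice_t.
have [cG sG] := box_inner L0 cf; have [cH sH] := box_inner L0 cg.
have [bd lin] := integral_rV_bound_lin n L0.
set G := fun t => integral_rV (slice f t); set H := fun t => integral_rV (slice g t).
(* G is differentiable with derivative H: the mean value theorem in the first
   coordinate, uniformly in the others by uniform continuity of g. *)
have key e : 0 < e -> exists2 d : R, 0 < d & forall t s : R, `|t - s| <= d ->
    `|G t - G s - (t - s) * H s| <= `|t - s| * e * (L *+ 2) ^+ n.
  have [uc _ _] := cg; move=> /uc[d d0 h]; exists d => // t s ts.
  have -> : G t - G s - (t - s) * H s =
     integral_rV (fun v => - (t - s) * slice g s v + (-1 * slice f s v + slice f t v)).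
    rewrite lin; [|exact: slice_cube|by apply: cube_lin; exact: slice_cube].
    by rewrite lin /G /H; [ring|exact: slice_cube..].
  apply: bd; first by do 2 (apply: cube_lin; first exact: slice_cube); exact: slice_cube.
  move=> v.
  have mv a b : a <= b -> `|a - s| <= d -> `|b - s| <= d ->
     `|slice f b v - slice f a v - (b - a) * slice g s v| <= `|b - a| * e.
    move=> ab As bs.
    have [|c cab ->] := @MVT_segment R (fun u => slice f u v) (fun u => slice g u v) a b ab
      (fun u _ => dsl u v).
      apply: continuous_subspaceT => u; apply: differentiable_continuous.
      by apply/derivable1_diffP; have [] := dsl u v.
    rewrite mulrC -mulrBr normrM ler_wpM2l//; apply: h.
    apply: le_trans (norm_slice_t _ _ _) _.
    move: cab As bs; rewrite in_itv/= => /andP[] ac cb /ler_normlP[? ?] /ler_normlP[? ?].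
    by apply/ler_normlP; split; lra.
  have [ts'|ts'] := leP t s.
    rewrite -normrN (_ : - (- (t - s) * slice g s v + (-1 * slice f s v + slice f t v)) =
      slice f s v - slice f t v - (s - t) * slice g s v); last by ring.
    by rewrite (distrC t s); apply: mv; rewrite // subrr normr0 ltW.
  rewrite (_ : - (t - s) * slice g s v + (-1 * slice f s v + slice f t v) =
      slice f t v - slice f s v - (t - s) * slice g s v); last by ring.
  by apply: mv; rewrite // ?subrr ?normr0 ?ltW.
have dG (s : R) : is_derive s (1 : R) G (H s).
  suff cv : h^-1 *: ((G \o shift s) (h *: 1) - G s) @[h --> 0^'] --> H s.
    by apply: DeriveDef; [apply/cvg_ex; exists (H s)|exact: cvg_lim].
  apply/cvgrPdist_le => e e0; set C := (L *+ 2) ^+ n in key.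
  have C0 : 0 <= C by rewrite exprn_ge0// mulrn_wge0.
  have [|d d0 hd] := key (e / (C + 1)); first by apply: divr_gt0 => //; lra.
  near=> h.
  have h0 : h != 0 by near: h; exact: nbhs_dnbhs_neq.
  have := hd (h + s) s; rewrite addrK => /(_ _) hs.
  rewrite distrC /= -[h%:A]/(h * 1) mulr1.
  have -> : h^-1 *: (G (h + s) - G s) - H s = h^-1 * (G (h + s) - G s - h * H s).
    by rewrite -[_ *: _]/(_ * _); field.
  rewrite normrM normfV ler_pdivrMl ?normr_gt0//.
  apply: le_trans (hs _) _.
    by near: h; apply: dnbhs0_le.
  rewrite -mulrA ler_wpM2l// -mulrA ler_piMr ?(ltW e0)// mulrC ler_pdivrMr; lra.
rewrite integral_rVS.
(* The cube is enlarged so that G vanishes at the ends of the interval. *)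
have sH' t : L + 1 < `|t| -> H t = 0 by move=> h; apply: sH; lra.
rewrite (Rint_box sH') /Rintegral (@continuous_FTC2 _ H G).
- have L1 : L < `|L + 1| by rewrite ger0_norm; lra.
  by rewrite /G !sG ?normrN//= subrr.
- lra.
- exact: continuous_subspaceT.
- split.
  + by move=> x _; have [] := dG x.
  + exact/cvg_at_right_filter/cG.
  + exact/cvg_at_left_filter/cG.
- by move=> x _; rewrite derive1E; have [_] := dG x.
Unshelve. all: by end_near. Qed.

End BoxIntegral.

(** * Compact supports and bump functions *)
Section CompactSupport.
Variables (R : realType) (n : nat).
Implicit Types (U K : set 'rV[R]_n) (f : 'rV[R]_n -> R).

Lemma continuous_off_compact U K f : open U -> compact K -> K `<=` U ->
  (forall x, U x -> {for x, continuous f}) -> (forall x, ~ K x -> f x = 0) ->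
  continuous f.
Proof.
move=> oU cK KU cf f0 x; have [Kx|nKx] := pselect (K x); first exact/cf/KU.
have oK : open (~` K) by apply: closed_openC; apply: compact_closed cK; exact: norm_hausdorff.
apply: (@continuous_eq_on _ _ _ (fun=> 0) _ _ oK _ nKx); last exact: cst_continuous.
by move=> y /f0 ->.
Qed.

(** A continuous function of compact support is uniformly continuous, by
    compactness of its support. *)
Lemma compact_cube_supported U K : open U -> compact K -> K `<=` U ->
  exists2 L : R, 0 <= L & forall f, (forall x, U x -> {for x, continuous f}) ->
    (forall x, ~ K x -> f x = 0) -> cube_supported L f.
Proof.
move=> oU cK KU.
have [L L0 hL] := pinfty_ex_gt0 (compact_bounded cK).
exists L; first exact: ltW.
move=> f cf f0; have cont := continuous_off_compact oU cK KU cf f0; split.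
- move=> e e0.
  pose P (d : R) (x : 'rV[R]_n) := forall y, `|x - y| <= d -> `|f x - f y| <= e.
  have /compact_near_coveringP/(_ R (0^'+) P) := cK.
  case/(_ _ _) => [x Kx|d /= d0 hd].
    have e20 : 0 < e / 2 by lra.
    have /nbhs_ballP[d /= d0 hd] : nbhs x [set t | `|f x - f t| <= e / 2].
      by have /cvgrPdist_le/(_ _ e20) := cont x.
    exists (ball x (d / 2), [set r | r < d / 2]) => /=.
      split; first by apply: nbhsx_ballx; lra.
      by apply: nbhs_right_lt; lra.
    move=> [z r] /= [xz rd] y zy.
    have h1 : `|f x - f z| <= e / 2.
      by apply: hd; apply: le_ball xz; lra.
    have h2 : `|f x - f y| <= e / 2.
      apply: hd; rewrite mx_norm_ball/=.
      move: xz; rewrite mx_norm_ball/= => xz.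
      have -> : x - y = (x - z) + (z - y) by rewrite addrA subrK.
      apply: le_lt_trans (ler_normD _ _) _; lra.
    have -> : f z - f y = (f x - f y) - (f x - f z) by ring.
    by apply: le_trans (ler_normB _ _) _; lra.
  exists (d / 2); first by lra.
  have hP x y : K x -> `|x - y| <= d / 2 -> `|f x - f y| <= e.
    move=> Kx; apply: (hd (d / 2)) => //=; last by lra.
    by rewrite sub0r normrN ger0_norm; lra.
  move=> x y xy; have [Kx|nKx] := pselect (K x); first exact: hP.
  have [Ky|nKy] := pselect (K y); first by rewrite distrC; apply: hP; rewrite // distrC.
  by rewrite !f0// subrr normr0 ltW.
- move=> x i Lx; apply: f0 => Kx; have /= := hL _ Kx.
  by rewrite leNgt; apply/negP/negPn; exact: lt_le_trans Lx (rV_entry_le _ _).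
- have /compact_bounded/pinfty_ex_gt0[B B0 hB] : compact (f @` K).
    by apply: continuous_compact => //; exact: continuous_subspaceT.
  exists B => x; have [Kx|nKx] := pselect (K x); first by apply: hB; exists x.
  by rewrite f0// normr0 ltW.
Qed.

End CompactSupport.

Section Bump.
Variable R : realType.

(** The functions p(1/t) e^{-1/t}, continued by zero to t <= 0: a family closed
    under differentiation, hence consisting of smooth functions. *)
Definition flat (p : {poly R}) (t : R) : R :=
  if 0 < t then p.[t^-1] * expR (- t^-1) else 0.

Lemma flat_poly_le (p : {poly R}) : exists2 C : R, 0 <= C &
  forall t, 0 < t -> t <= 1 -> `|flat p t| <= C * t.
Proof.
pose d := size p; pose C0 := \sum_(i < d) `|p`_i|.
exists (C0 * (d.+1)`!%:R); first by rewrite mulr_ge0// sumr_ge0.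
move=> t t0 t1; rewrite /flat t0 normrM (ger0_norm (expR_ge0 _)).
have s1 : 1 <= t^-1 by rewrite invf_ge1.
have s0 : 0 < t^-1 by rewrite invr_gt0.
have h1 : `|p.[t^-1]| <= C0 * t^-1 ^+ d.
  rewrite horner_coef mulr_suml; apply: le_trans (ler_norm_sum _ _ _) _.
  apply: ler_sum => i _; rewrite normrM ler_wpM2l// normrX (ger0_norm (ltW s0)).
  by rewrite ler_weXn2l// ltnW.
(* The exponential dominates the term of degree d + 1 of its series. *)
have h2 : t^-1 ^+ d.+1 / (d.+1)`!%:R <= expR t^-1.
  by apply: le_trans (expR_ge1Dxn d (ltW s0)); rewrite lerDr.
have f0 : 0 < (d.+1)`!%:R :> R by rewrite ltr0n fact_gt0.
have h3 : t^-1 ^+ d * expR (- t^-1) <= (d.+1)`!%:R * t.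
  rewrite expRN ler_pdivrMr ?expR_gt0//.
  have : (d.+1)`!%:R * t * (t^-1 ^+ d.+1 / (d.+1)`!%:R) <= (d.+1)`!%:R * t * expR t^-1.
    by rewrite ler_wpM2l// mulr_ge0// ltW.
  apply: le_trans; rewrite le_eqVlt; apply/orP; left; apply/eqP.
  by rewrite exprS; field; rewrite !gt_eqF.
apply: (@le_trans _ _ (C0 * t^-1 ^+ d * expR (- t^-1))).
  by rewrite ler_wpM2r ?expR_ge0.
by rewrite -!mulrA ler_wpM2l// sumr_ge0.
Qed.

Definition flat_deriv (p : {poly R}) : {poly R} := 'X^2 * (p - p^`()).

Lemma is_derive_flat p (t : R) : is_derive t (1 : R) (flat p) (flat (flat_deriv p) t).
Proof.
have [t0|t0|t0] := ltgtP t 0.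
- rewrite {2}/flat ltNge (ltW t0)/=.
  apply: (@near_eq_is_derive _ _ _ (cst (0 : R))).
  by near=> s; rewrite /flat ltNge ltW//; near: s; exact: lt_nbhsl.
- rewrite {2}/flat t0.
  have dV := is_derive_inv (lt0r_neq0 t0).
  have d1 : is_derive t (1 : R) (fun s => p.[s^-1]) (p^`().[t^-1] * (- t ^- 2)).
    exact: (is_derive1_comp (is_derive_poly p t^-1) dV).
  have d2 : is_derive t (1 : R) (fun s => expR (- s^-1)) (expR (- t^-1) * (- (- t ^- 2))).
    have dN : is_derive t (1 : R) (fun s : R => - s^-1) (- (- t ^- 2)) by exact: is_deriveN.
    exact: (@is_derive1_comp R expR (fun s => - s^-1) t _ _ (is_derive_expR _) dN).
  have d3 := is_deriveM d1 d2.
  apply: is_derive_eq (@near_eq_is_derive _ _ _ _ (flat p) t 1 _ _ d3) _.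
    by near=> s; rewrite /flat ifT//; near: s; exact: lt_nbhsr.
  change (p.[t^-1] * (expR (- t^-1) * (- - t ^- 2)) +
    expR (- t^-1) * (p^`().[t^-1] * (- t ^- 2)) =
    (flat_deriv p).[t^-1] * expR (- t^-1)).
  have -> : (flat_deriv p).[t^-1] = t^-1 ^+ 2 * (p.[t^-1] - p^`().[t^-1]).
    by rewrite /flat_deriv !hornerE.
  field; exact: lt0r_neq0.
- rewrite t0 {2}/flat ltxx.
  (* The difference quotient flat p h / h is flat ('X * p) h, which is O(h). *)
  have [C C0 hC] := flat_poly_le ('X * p).
  suff cv : h^-1 *: ((flat p \o shift 0) (h *: 1) - flat p 0) @[h --> 0^'] --> (0 : R).
    by apply: DeriveDef; [apply/cvg_ex; exists 0|exact: cvg_lim].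
  apply/cvgrPdist_le => e e0; near=> h.
  have h0 : h != 0 by near: h; exact: nbhs_dnbhs_neq.
  rewrite sub0r normrN /= addr0 {2}/flat ltxx subr0 -[_%:A]/(h * 1) mulr1.
  have [hp|hn] := ltP 0 h; last by rewrite /flat ltNge hn/= scaler0 normr0 ltW.
  have -> : h^-1 *: flat p h = flat ('X * p) h.
    by rewrite /flat hp -[_ *: _]/(_ * _) hornerM hornerX mulrA.
  have hs : `|h| <= Num.min 1 (e / (C + 1)).
    by near: h; apply: dnbhs0_le; rewrite lt_min ltr01 divr_gt0//; lra.
  move: hs; rewrite le_min (gtr0_norm hp) => /andP[h1 he].
  apply: le_trans (hC _ hp h1) _.
  apply: (@le_trans _ _ (C * (e / (C + 1)))); first by rewrite ler_wpM2l.
  rewrite mulrA ler_pdivrMr; nra.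
Unshelve. all: by end_near. Qed.

Lemma flat_continuous p : continuous (flat p).
Proof.
move=> t; apply: differentiable_continuous; apply/derivable1_diffP.
by have [] := is_derive_flat p t.
Qed.

Variable n : nat.
Implicit Types (x c : 'rV[R]_n).

Lemma is_derive_affine a b i j x :
  is_derive x (delta_mx 0 j) (fun y : 'rV[R]_n => a * y 0 i + b) (a * (i == j)%:R).
Proof.
have E : (fun h : R => h^-1 *: (((fun y : 'rV[R]_n => a * y 0 i + b) \o shift x) (h *: delta_mx 0 j)
   - (a * x 0 i + b))) @ 0^' --> (a * (i == j)%:R : R).
  apply: cvg_near_cst; near=> h.
  have h0 : h != 0 by near: h; exact: nbhs_dnbhs_neq.
  by rewrite /= !mxE eqxx/= -[_ *: _]/(_ * _); field.
by apply: DeriveDef; [apply/cvg_ex; eexists; exact: E|exact: cvg_lim].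
Unshelve. all: by end_near. Qed.

Lemma smooth_flat_affine p a b i :
  smooth_on setT (fun y : 'rV[R]_n => flat p (a * y 0 i + b)).
Proof.
move=> k; elim: k p => [|k IH] p; split => //;
  try by move=> x _; apply: (continuous_comp (g := flat p)); [|exact: flat_continuous];
    apply: continuousD; [apply: continuousM; [|exact: coord_continuous]|]; exact: cst_continuous.
have dc x j := is_derive_comp (is_derive_flat p (a * x 0 i + b))
  (@ex_derive _ _ _ _ _ _ _ (is_derive_affine a b i j x)).
move=> j; split; first by move=> x _; have [] := dc x j.
apply: Ck_eq_on (CkM openT (IH (flat_deriv p)) (Ck_cst k (a * (i == j)%:R) openT)) => //.
  exact: openT.
move=> x _; rewrite /partial; have [_ ->] := dc x j.
by have [_ ->] := is_derive_affine a b i j x.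
Qed.

Definition bump c (r : R) x : R :=
  \prod_(i < n) (flat 1 (1 * x 0 i + (r - c 0 i)) * flat 1 (-1 * x 0 i + (r + c 0 i))).

Lemma smooth_bump c r : smooth_on setT (bump c r).
Proof.
by apply: smooth_prod => [|i _]; [exact: openT|apply: smoothM; [exact: openT|exact: smooth_flat_affine..]].
Qed.

Lemma flat1_ge0 t : 0 <= flat 1 t.
Proof. by rewrite /flat; case: ifP => // _; rewrite hornerE mul1r expR_ge0. Qed.

Lemma flat1_gt0 t : (0 < flat 1 t) = (0 < t).
Proof. by rewrite /flat; case: ifP; rewrite ?ltxx// hornerE mul1r expR_gt0. Qed.

Lemma bump_ge0 c r x : 0 <= bump c r x.
Proof. by apply: prodr_ge0 => i _; rewrite mulr_ge0 ?flat1_ge0. Qed.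

Lemma bump_gt0 c r : 0 < r -> 0 < bump c r c.
Proof.
move=> r0; apply: prodr_gt0 => i _.
by rewrite mulr_gt0// flat1_gt0; lra.
Qed.

Lemma bump_eq0 c r x : 0 <= r -> r < `|x - c| -> bump c r x = 0.
Proof.
move=> r0 h; apply/eqP; apply: contraTT h => /prodf_neq0 nz; rewrite -leNgt.
apply: rV_norm_le => // i; have := nz i isT; rewrite entryB mulf_eq0 negb_or /flat.
case: ifPn => [h1|_]; last by rewrite eqxx.
case: ifPn => [h2 _|_ /andP[]]; rewrite ?eqxx//.
by apply/ler_normlP; split; lra.
Qed.

End Bump.

(** * Weak divergences *)
Section WeakDivergence.
Variables (R : realType) (n : nat).
Implicit Types (U K : set 'rV[R]_n).

Lemma integral_rV_sum L (I : Type) (r : seq I) (F : I -> 'rV[R]_n -> R) : 0 <= L ->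
  (forall i, cube_supported L (F i)) ->
  cube_supported L (fun x => \sum_(i <- r) F i x) /\
  integral_rV (fun x => \sum_(i <- r) F i x) = \sum_(i <- r) integral_rV (F i).
Proof.
move=> L0 cF; have [_ lin] := integral_rV_bound_lin n L0.
elim: r => [|i r [c IH]].
  have -> : (fun x : 'rV[R]_n => \sum_(i <- [::]) F i x) = (fun=> 0).
    by apply/funext => x; rewrite big_nil.
  rewrite integral_rV0 big_nil; split=> //; split=> //.
    by move=> e e0; exists 1 => // x y _; rewrite subrr normr0 ltW.
  by exists 0 => x; rewrite normr0.
have -> : (fun x => \sum_(j <- i :: r) F j x) = (fun x => 1 * F i x + \sum_(j <- r) F j x).
  by apply/funext => x; rewrite big_cons mul1r.
by split; [exact: cube_lin|rewrite lin// IH big_cons mul1r].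
Qed.

(** The fundamental lemma of the calculus of variations. Let D be the difference
    of the two sides. Integrating by parts, the integral of eta D vanishes for
    every test function eta; if D were nonzero at x0, it would keep its sign on
    a small ball, and a bump function on that ball would give a nonzero
    integral. *)
Lemma weak_divergence U (B : 'I_n -> 'rV[R]_n -> R) (C : 'rV[R]_n -> R) : open U ->
  (forall j, smooth_on U (B j)) -> smooth_on U C ->
  (forall (eta : 'rV[R]_n -> R) K, smooth_on setT eta -> compact K -> K `<=` U ->
     (forall x, ~ K x -> eta x = 0) ->
     integral_rV (fun x => \sum_j partial j eta x * B j x) =
     integral_rV (fun x => eta x * C x)) ->
  forall x, U x -> C x = - \sum_j partial j (B j) x.
Proof.
move=> oU sB sC weak x0 Ux0.
pose D x := C x + \sum_j partial j (B j) x.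
have sD : smooth_on U D.
  by apply: smoothD => //; apply: smooth_sum => // j _; exact: smooth_partial.
suff : D x0 = 0 by move/eqP; rewrite addr_eq0 => /eqP.
apply/eqP/negPn/negP => D0; have nD0 : 0 < `|D x0| by rewrite normr_gt0.
have [r r0 hr] : exists2 r : R, 0 < r & forall x, `|x0 - x| <= r ->
    U x /\ `|D x0 - D x| < `|D x0|.
  have : nbhs x0 (U `&` [set x | `|D x0 - D x| < `|D x0|]).
    apply: filterI; first exact: open_nbhs_nbhs.
    by have /cvgrPdist_lt/(_ _ nD0) := smooth_continuous sD Ux0.
  move=> /nbhs_ballP[r /= r0 hr]; exists (r / 2); first lra.
  by move=> x xr; apply: hr; rewrite mx_norm_ball/=; apply: le_lt_trans xr _; lra.
pose K := closed_ball x0 r.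
have KE x : K x <-> `|x0 - x| <= r by rewrite /K closed_ballE.
have KU : K `<=` U by move=> x /KE/hr[].
have cK : compact K.
  apply: bounded_closed_compact; last exact: closed_ball_closed.
  exists (`|x0| + r); split; first exact: num_real.
  move=> M lM x /KE /= xr; apply: ltW; apply: le_lt_trans lM.
  have -> : x = x0 - (x0 - x) by rewrite opprB addrC subrK.
  by apply: le_trans (ler_normB _ _) _; rewrite lerD2l.
have sh := smooth_bump x0 r; set eta := bump x0 r in sh.
have eta0 x : ~ K x -> eta x = 0.
  by move=> nK; apply: bump_eq0; [exact: ltW|rewrite distrC ltNge; apply/negP => /KE].
have deta0 j x : ~ K x -> partial j eta x = 0.
  move=> nK; rewrite -(partial_cst 0 j x).
  have oK : open (~` K) by apply: closed_openC; exact: closed_ball_closed.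
  by apply: (partial_eq_on _ oK) => // y /eta0.
have shU : smooth_on U eta by move=> k; apply: Ck_sub (sh k).
have [L L0 hL] := compact_cube_supported oU cK KU.
have [_ lin] := integral_rV_bound_lin n L0.
have cub f g : smooth_on U f -> smooth_on U g -> (forall x, ~ K x -> f x = 0) ->
    cube_supported L (fun x => f x * g x).
  move=> sf sg f0; apply: hL => [x Ux|x /f0 ->]; last by rewrite mul0r.
  by apply: smooth_continuous Ux; exact: smoothM.
have sdB j : smooth_on U (partial j (B j)) by exact: smooth_partial.
have sdh j : smooth_on U (partial j eta) by exact: smooth_partial.
have int0 j : integral_rV (fun x => partial j eta x * B j x) +
    integral_rV (fun x => eta x * partial j (B j) x) = 0.
  have c1 := cub _ _ (sdh j) (sB j) (deta0 j).
  have c2 := cub _ _ shU (sdB j) eta0.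
  rewrite -[X in X + _]mul1r -lin//.
  have E : (fun x => 1 * (partial j eta x * B j x) + eta x * partial j (B j) x) =
      partial j (fun x => eta x * B j x).
    apply/funext => x; rewrite mul1r; have [Ux|nU] := pselect (U x).
      by rewrite (partialM j shU (sB j) Ux).
    have nK : ~ K x by move=> /KU.
    have oK : open (~` K) by apply: closed_openC; exact: closed_ball_closed.
    rewrite eta0// deta0// !mul0r addr0 (@partial_eq_on _ _ _ _ (fun=> 0) _ _ oK) ?partial_cst//.
    by move=> y /eta0 ->; rewrite mul0r.
  rewrite E; apply: (integral_partial0 L0); first exact: cub.
    by rewrite -E; exact: cube_lin.
  move=> x; have [Ux|nU] := pselect (U x).
    by apply: smooth_derivable Ux; exact: smoothM.
  have nK : ~ K x by move=> /KU.
  have oK : open (~` K) by apply: closed_openC; exact: closed_ball_closed.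
  apply: (@near_eq_derivable _ _ _ (cst 0)); last exact: derivable_cst.
  by apply: filterS (open_nbhs_nbhs (conj oK nK)) => y /eta0 ->; rewrite mul0r.
have cubD : cube_supported L (fun x => eta x * D x) by exact: cub.
have intD : integral_rV (fun x => eta x * D x) = 0.
  have -> : (fun x => eta x * D x) =
      (fun x => 1 * (eta x * C x) + \sum_j eta x * partial j (B j) x).
    by apply/funext => x; rewrite mul1r /D mulrDr mulr_sumr.
  have [cS ->] : cube_supported L (fun x => \sum_j eta x * partial j (B j) x) /\
      integral_rV (fun x => 1 * (eta x * C x) + \sum_j eta x * partial j (B j) x) =
      integral_rV (fun x => eta x * C x) + \sum_j integral_rV (fun x => eta x * partial j (B j) x).
    have [|cS iS] := @integral_rV_sum L _ (index_enum 'I_n)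
       (fun j x => eta x * partial j (B j) x) L0; first by move=> j; exact: cub.
    by split=> //; rewrite lin ?mul1r ?iS//; exact: cub.
  rewrite -(weak eta K sh cK KU eta0).
  have [|_ ->] := @integral_rV_sum L _ (index_enum 'I_n) (fun j x => partial j eta x * B j x) L0.
    by move=> j; exact: cub (deta0 j).
  by rewrite -big_split big1// => j _; exact: int0.
have cub2 := cube_lin (D x0) cubD (cub _ _ shU (smooth_cst oU 0) eta0).
(* On the ball D x0 * D x >= 0, since D x is closer to D x0 than 0 is. *)
have : 0 < integral_rV (fun x => D x0 * (eta x * D x) + eta x * 0).
  apply: (integral_rV_gt0 (x0 := x0) L0 cub2) => [x|]; last first.
    by rewrite mulr0 addr0 mulrCA pmulr_rgt0 ?bump_gt0// -expr2 exprn_even_gt0.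
  rewrite mulr0 addr0 mulrCA; have [Kx|/eta0 ->] := pselect (K x); last by rewrite mul0r.
  rewrite mulr_ge0 ?bump_ge0//; have /KE/hr[_] := Kx.
  move: (D x0) (D x) => a b; case: (ger0P a) => a0; rewrite ltr_norml => /andP[h1 h2].
    by apply: mulr_ge0 => //; lra.
  by apply: mulr_le0; lra.
rewrite lin//; last by apply: cub => //; exact: smooth_cst.
rewrite intD mulr0 add0r; under [X in integral_rV X]funext do rewrite mulr0.
by rewrite integral_rV0 ltxx.
Qed.

End WeakDivergence.

(** * The divergence of the raised form *)

Section OmegaSquareDivergence.
Variable R : realFieldType.
Local Notation ord := 'I_6.

(** The contraction of d(omega ^ omega) = 0: each of the two terms is a third of
    its sum over the cyclic permutations that make up d omega. *)
Lemma omega_square_divergence (w : ord -> ord -> R) (dw : ord -> ord -> ord -> R) a :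
  (forall i j k, dw i j k + dw j k i + dw k i j = 0) ->
  top6 (fun c0 c1 c2 c3 c4 c5 =>
    (a == c1)%:R * (dw c0 c2 c3 * w c4 c5 + w c2 c3 * dw c0 c4 c5)) = 0.
Proof.
move=> cl; set F := fun c0 c1 c2 c3 c4 c5 => (a == c1)%:R * (dw c0 c2 c3 * w c4 c5).
have s02 G : top6 (fun a b c d e f => G c b a d e f) = - top6 G :> R.
  rewrite (top6_s01 (fun a b c d e f => G c a b d e f)).
  by rewrite (top6_s12 (fun a b c d e f => G b a c d e f)) (top6_s01 G) !opprK.
have c1 : top6 (fun c0 c1 c2 c3 c4 c5 => F c2 c1 c3 c0 c4 c5) = top6 F.
  rewrite (s02 (fun c0 c1 c2 c3 c4 c5 => F c0 c1 c3 c2 c4 c5)).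
  by rewrite (top6_s23 F) opprK.
have c2 : top6 (fun c0 c1 c2 c3 c4 c5 => F c3 c1 c0 c2 c4 c5) = top6 F.
  rewrite (top6_s23 (fun c0 c1 c2 c3 c4 c5 => F c2 c1 c0 c3 c4 c5)).
  by rewrite (s02 F) opprK.
have c3 : top6 (fun c0 c1 c2 c3 c4 c5 => F c0 c1 c4 c5 c2 c3) = top6 F.
  rewrite (top6_s34 (fun c0 c1 c2 c3 c4 c5 => F c0 c1 c3 c5 c2 c4)).
  rewrite (top6_s23 (fun c0 c1 c2 c3 c4 c5 => F c0 c1 c2 c5 c3 c4)).
  rewrite (top6_s45 (fun c0 c1 c2 c3 c4 c5 => F c0 c1 c2 c4 c3 c5)).
  by rewrite (top6_s34 F) !opprK.
have F0 : top6 F = 0.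
  have : top6 (fun c0 c1 c2 c3 c4 c5 => F c0 c1 c2 c3 c4 c5 + F c2 c1 c3 c0 c4 c5
      + F c3 c1 c0 c2 c4 c5) = 0.
    transitivity (0 * top6 F); last by rewrite mul0r.
    rewrite -top6Z; apply: eq_top6 => *; rewrite /F mul0r -!mulrDr -!mulrDl cl.
    by rewrite mul0r mulr0.
  by rewrite !top6D c1 c2; lra.
transitivity (top6 F + top6 (fun c0 c1 c2 c3 c4 c5 => F c0 c1 c4 c5 c2 c3)).
  by rewrite -top6D; apply: eq_top6 => *; rewrite /F; ring.
by rewrite c3 F0 addr0.
Qed.

End OmegaSquareDivergence.

Section RaisedDivergence.
Variables (R : realType) (U : set 'rV[R]_6).
Hypothesis oU : open U.
Variables (om : local_field R 2) (ph : local_field R 3).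
Hypotheses (smooth_om : forall I, smooth_on U (fun x => om x I))
  (alt_om : forall x, U x -> Defs.alternating (om x))
  (closed_om : forall x, U x -> forall I, ext_d om x I = 0)
  (unit_om : forall x, U x -> form_mx (om x) \in unitmx).
Hypotheses (smooth_ph : forall I, smooth_on U (fun x => ph x I))
  (alt_ph : forall x, U x -> Defs.alternating (ph x))
  (prim : forall x, U x -> forall I, Lambda (om x) (ph x) I = 0)
  (lambda_lt0 : forall x, U x -> hitchin_lambda (ph x) < 0).

Local Notation W := (fun x => form_mx (om x)).
Local Notation V := (fun x => form_inv (om x)).
Local Notation nsq := (fun x => normsq (om x) (ph x)).
Local Notation vol := (fun x => Num.sqrt (\det (metric (om x) (ph x)))).
Local Notation orientation := (fun x => orient (om x)).
Local Notation Q := (fun x => omega_square (comp2 (om x))).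
Local Notation psi := (scaled_dual om ph).
Local Notation beta x := (contract_jet (form_inv (om x)) (jet_ext_d (jet3_of psi x))).

Lemma orient_sqr x : U x -> orient (om x) * orient (om x) = 1.
Proof.
move=> Ux; rewrite -expr2 orientE ?sqr_sg ?(pf_neq0 alt_om unit_om)//.
exact: alt_om.
Qed.

(** Differentiate o^2 = 1. *)
Lemma partial_orient x c : U x -> partial c orientation x = 0.
Proof.
move=> Ux; have so := smooth_orient oU smooth_om alt_om unit_om.
have := partialM c so so Ux.
rewrite (@partial_eq_on _ _ _ _ (fun=> 1) c _ oU) ?partial_cst//; last exact: orient_sqr.
move=> h; have : orient (om x) * (2 * partial c orientation x) = 0.
  by rewrite mulr2n mulrDl !mul1r mulrDr {1}[orient (om x) * _]mulrC; exact/esym.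
move/(congr1 (fun z => orient (om x) * z)); rewrite mulrA orient_sqr// mul1r mulr0 => /eqP.
by rewrite mulf_eq0 pnatr_eq0 => /eqP.
Qed.

Lemma volume_inverse x i j : U x ->
  vol x * V x i j = - 8^-1 * (orient (om x) * Q x i j).
Proof.
move=> Ux; have aw := alternating_comp2 (alt_om Ux).
have QE : Q x = (- 8 * pfaffian (comp2 (om x))) *: V x.
  rewrite -[LHS](mulKmx (unit_om Ux)) omega_square_inverse// mul_mx_scalar top6_cube//.
  by congr (_ *: _); field.
have vE : vol x = orient (om x) * pfaffian (comp2 (om x)).
  rewrite -(volume_pfaffian (alt_om Ux) (alt_ph Ux) (unit_om Ux) (lambda_lt0 Ux)).
  by rewrite mulrA orient_sqr// mul1r.
by rewrite QE mxE vE; field.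
Qed.

Lemma smooth_Q i j : smooth_on U (fun x => Q x i j).
Proof.
apply: (smooth_eq_on oU (f := fun x => top6 (fun c0 c1 c2 c3 c4 c5 =>
   (i == c0)%:R * ((j == c1)%:R * (comp2 (om x) c2 c3 * comp2 (om x) c4 c5))))).
  by move=> x _; rewrite mxE.
apply: smooth_sum => // I _; do 3 (apply: smoothM => //; first exact: smooth_cst).
by apply: smoothM => //; exact: smooth_om.
Qed.

(** By [volume_inverse] the density is a locally constant multiple of
    omega ^ omega, which is closed. *)
Lemma poisson_divergence x a : U x ->
  \sum_j partial j (fun y => vol y * V y j a) x = 0.
Proof.
move=> Ux; have so := smooth_orient oU smooth_om alt_om unit_om.
pose dw i j k := partial i (fun y => comp2 (om y) j k) x.
have cl i j k : dw i j k + dw j k i + dw k i j = 0.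
  have := closed_om Ux [tuple i; j; k]; rewrite ext_d2E => <-.
  rewrite /dw (@partial_eq_on _ _ _ (fun y => comp2 (om y) k i) (fun y => - comp2 (om y) i k) j x oU)//.
    by rewrite (partialN oU)//; exact: smooth_om.
  by move=> y Uy; exact: (alternating_comp2 (alt_om Uy)).
have dQ j c : partial c (fun y => Q y j a) x = top6 (fun c0 c1 c2 c3 c4 c5 =>
    (j == c0)%:R * ((a == c1)%:R * (dw c c2 c3 * comp2 (om x) c4 c5 + comp2 (om x) c2 c3 * dw c c4 c5))).
  rewrite (@partial_eq_on _ _ _ _ (fun y => top6 (fun c0 c1 c2 c3 c4 c5 =>
     (j == c0)%:R * ((a == c1)%:R * (comp2 (om y) c2 c3 * comp2 (om y) c4 c5)))) c _ oU)//; last first.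
    by move=> y _; rewrite mxE.
  have sm I : smooth_on U (fun y => curry6 (fun c0 c1 c2 c3 c4 c5 =>
     (j == c0)%:R * ((a == c1)%:R * (comp2 (om y) c2 c3 * comp2 (om y) c4 c5))) I).
    do 2 (apply: smoothM => //; first exact: smooth_cst).
    by apply: smoothM => //; exact: smooth_om.
  rewrite (partial_sum oU)//; last by move=> I _; apply: smoothM => //; exact: smooth_cst.
  apply: eq_bigr => I _.
  rewrite (partialM c (smooth_cst oU _) (sm I) Ux) partial_cst mul0r add0r; congr (_ * _).
  rewrite /curry6.
  have sm2 : smooth_on U (fun y => comp2 (om y) (tnth I o2) (tnth I o3) * comp2 (om y) (tnth I o4) (tnth I o5)).
    by apply: smoothM => //; exact: smooth_om.
  have sm1 := smoothM oU (smooth_cst oU (a == tnth I o1)%:R) sm2.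
  rewrite (partialM c (smooth_cst oU _) sm1 Ux) partial_cst mul0r add0r; congr (_ * _).
  rewrite (partialM c (smooth_cst oU _) sm2 Ux) partial_cst mul0r add0r; congr (_ * _).
  by rewrite (partialM c (smooth_om [tuple tnth I o2; tnth I o3]) (smooth_om [tuple tnth I o4; tnth I o5]) Ux).
transitivity (\sum_j (- 8^-1 * orient (om x)) * partial j (fun y => Q y j a) x).
  apply: eq_bigr => j _.
  rewrite (@partial_eq_on _ _ _ _ (fun y => - 8^-1 * (orient (om y) * Q y j a)) j _ oU)//; last first.
    by move=> y Uy; exact: volume_inverse.
  rewrite (partialM j (smooth_cst oU _) (smoothM oU so (smooth_Q j a)) Ux) partial_cst.
  by rewrite (partialM j so (smooth_Q j a) Ux) partial_orient//; ring.
rewrite -mulr_sumr; under eq_bigr do rewrite dQ.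
rewrite -top6_sum -[RHS](mulr0 (- 8^-1 * orient (om x))); congr (_ * _).
rewrite -[RHS](omega_square_divergence (comp2 (om x)) a cl); apply: eq_top6 => c0 c1 c2 c3 c4 c5.
rewrite -[RHS](sum_delta c0 (fun j => (a == c1)%:R * (dw j c2 c3 * comp2 (om x) c4 c5 + comp2 (om x) c2 c3 * dw j c4 c5))).
by apply: eq_bigr => j _; rewrite eq_sym.
Qed.

(** The density-weighted first slot is differentiated by [poisson_divergence],
    and the rest is [symplectic_codifferential]. *)
Lemma raised_divergence x k l : U x ->
  \sum_j partial j (fun y => vol y * insert123 (V y)^T (psi y) j k l) x =
  - (vol x * \sum_p \sum_q V x k p * V x l q * beta x p q).
Proof.
move=> Ux.
have sV := smooth_form_inv oU smooth_om unit_om.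
have sp := smooth_scaled_dual oU smooth_om alt_om unit_om smooth_ph alt_ph lambda_lt0.
have svol := smooth_vol oU smooth_om alt_om unit_om smooth_ph alt_ph lambda_lt0.
pose M a y := \sum_b \sum_c V y k b * V y l c * psi y a b c.
have sMt a b c : smooth_on U (fun y => V y k b * V y l c * psi y a b c).
  by apply: smoothM => //; exact: smoothM.
have sM a : smooth_on U (M a) by do 2 (apply: smooth_sum => // ? _).
have svV j a : smooth_on U (fun y => vol y * V y j a) by exact: smoothM.
pose dV a := partial_mx a V x.
have dM j a : partial j (M a) x = \sum_b \sum_c (dV j k b * V x l c * psi x a b c +
    V x k b * dV j l c * psi x a b c + V x k b * V x l c * jet3_of psi x j a b c).
  rewrite (partial_sum oU)//; last by move=> b _; apply: smooth_sum => // c _.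
  apply: eq_bigr => b _; rewrite (partial_sum oU)//; apply: eq_bigr => c _.
  rewrite (partialM j (smoothM oU (sV k b) (sV l c)) (sp a b c) Ux).
  rewrite (partialM j (sV k b) (sV l c) Ux) /dV !mxE /jet3_of; ring.
transitivity (\sum_j \sum_a partial j (fun y => vol y * V y j a * M a y) x).
  apply: eq_bigr => j _; rewrite -(partial_sum oU)//; last by move=> a _; exact: smoothM.
  apply: (partial_eq_on _ oU) => // y _; rewrite insert123E /sum3 mulr_sumr.
  apply: eq_bigr => a _; rewrite -mulrA; congr (_ * _); rewrite mulr_sumr.
  apply: eq_bigr => b _; rewrite mulr_sumr; apply: eq_bigr => c _.
  by rewrite !mxE; ring.
transitivity (\sum_j \sum_a (partial j (fun y => vol y * V y j a) x * M a x +
   vol x * (V x j a * partial j (M a) x))).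
  do 2 (apply: eq_bigr => ? _); rewrite (partialM _ (svV _ _) (sM _) Ux); ring.
transitivity (\sum_a (\sum_j partial j (fun y => vol y * V y j a) x) * M a x +
   vol x * \sum_j \sum_a V x j a * partial j (M a) x).
  rewrite exchange_big mulr_sumr [X in _ = _ + X](_ : _ = \sum_a \sum_j vol x * (V x j a * partial j (M a) x)); last first.
    by rewrite exchange_big; apply: eq_bigr => j _ /=; rewrite mulr_sumr.
  rewrite -big_split; apply: eq_bigr => a _ /=.
  by rewrite mulr_suml -big_split.
rewrite big1 ?add0r => [|a _]; last by rewrite poisson_divergence// mul0r.
rewrite -mulrN; congr (_ * _).
have Vs := form_inv_skew (alt_om Ux) (unit_om Ux).
pose dW a := partial_mx a W x.
have sW := smooth_form_mx oU smooth_om.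
have VW y : U y -> V y *m W y = 1%:M by move=> Uy; rewrite /form_inv mulVmx// unit_om.
have dVE a : dV a = - (V x *m dW a *m V x).
  have := partial_mxM oU a sV sW Ux.
  rewrite (@partial_mx_eq_on _ _ _ oU _ _ a _ (fun=> 1%:M) x)// partial_mx_cst => /esym/eqP.
  rewrite addr_eq0 => /eqP /(congr1 (mulmx^~ (V x))).
  by rewrite -mulmxA /form_inv mulmxV ?unit_om// mulmx1 mulNmx.
have dWs a : (dW a)^T = - dW a.
  apply/matrixP => i j; rewrite !mxE -(partialN oU)//; apply: (partial_eq_on _ oU) => // y Uy.
  by have /matrixP/(_ i j) := form_mx_skew (alt_om Uy); rewrite !mxE.
have dWc i j m : dW i j m + dW j m i + dW m i j = 0.
  have := closed_om Ux [tuple i; j; m]; rewrite ext_d2E => <-.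
  have pW a b c : dW a b c = partial a (fun y => comp2 (om y) b c) x.
    by rewrite mxE; apply: (partial_eq_on _ oU) => // y _; rewrite mxE.
  rewrite !pW (@partial_eq_on _ _ _ (fun y => comp2 (om y) m i) (fun y => - comp2 (om y) i m) j x oU)//.
    by rewrite (partialN oU)//; exact: smooth_om.
  by move=> y Uy; exact: (alternating_comp2 (alt_om Uy)).
have dp a m : \sum_i \sum_j (dV a i j * psi x i j m + V x i j * jet3_of psi x a i j m) = 0.
  rewrite -[RHS](partial_cst (0 : R) a x).
  rewrite -(@partial_eq_on _ _ _ (fun y => \sum_i \sum_j V y i j * psi y i j m) _ a x oU)//; last first.
    move=> y Uy; have pr := dual_form_primitive (alt_ph Uy) (prim Uy) m.
    transitivity (nsq y * \sum_i \sum_j V y i j * dual_form (om y) (ph y) i j m); last by rewrite pr mulr0.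
    rewrite mulr_sumr; apply: eq_bigr => i _.
    by rewrite mulr_sumr; apply: eq_bigr => j _; rewrite /scaled_dual mulrCA.
  have st i j : smooth_on U (fun y => V y i j * psi y i j m) by exact: smoothM.
  rewrite (partial_sum oU)//; last by move=> i _; apply: smooth_sum.
  apply: eq_bigr => i _; rewrite (partial_sum oU)//; apply: eq_bigr => j _.
  by rewrite (partialM a (sV i j) (sp i j m) Ux) mxE.
have := symplectic_codifferential Vs dWs dWc dVE (scaled_dual_alt om alt_ph Ux) dp k l.
move=> <-; do 2 (apply: eq_bigr => ? _); by rewrite dM.
Qed.

End RaisedDivergence.

(** * The codifferential *)

Section ElementaryTwoForm.
Variable R : realFieldType.
Local Notation ord := 'I_6.

(** The components of dx^k ^ dx^l. *)
Definition elementary2 (k l i j : ord) : R :=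
  (i == k)%:R * (j == l)%:R - (i == l)%:R * (j == k)%:R.

Lemma sum_elementary2 k l (F : ord -> ord -> R) :
  \sum_i \sum_j elementary2 k l i j * F i j = F k l - F l k.
Proof.
have pick (a b : ord) : \sum_i \sum_j (i == a)%:R * (j == b)%:R * F i j = F a b.
  rewrite -[RHS](sum_delta a (fun i => F i b)); apply: eq_bigr => i _.
  rewrite -(sum_delta b (F i)) mulr_sumr; apply: eq_bigr => j _.
  by rewrite mulrA !(eq_sym i) !(eq_sym j).
rewrite -(pick k l) -(pick l k) -sumrB; apply: eq_bigr => i _.
by rewrite -sumrB; apply: eq_bigr => j _; rewrite /elementary2 mulrBl.
Qed.

Lemma sum_wedge_elementary2 k l (d : ord -> R) (r : ord -> ord -> ord -> R) :
  alternating3 r ->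
  6^-1 * \sum_i \sum_j \sum_m (d i * elementary2 k l j m - d j * elementary2 k l i m
    + d m * elementary2 k l i j) * r i j m = \sum_i d i * r i k l.
Proof.
case=> r1 r2; pose S := \sum_i d i * r i k l.
have scale (F : ord -> ord -> ord -> R) (c : R) : (forall i, F i k l - F i l k = c * r i k l) ->
    \sum_i \sum_a \sum_b d i * elementary2 k l a b * F i a b = c * S.
  move=> FE; rewrite mulr_sumr; apply: eq_bigr => i _.
  rewrite mulrCA -FE -sum_elementary2 mulr_sumr; apply: eq_bigr => a _.
  by rewrite mulr_sumr; apply: eq_bigr => b _; rewrite mulrA.
transitivity (6^-1 * (\sum_i \sum_j \sum_m d i * elementary2 k l j m * r i j m
   + \sum_i \sum_j \sum_m d i * elementary2 k l j m * - r j i m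
   + \sum_i \sum_j \sum_m d i * elementary2 k l j m * r j m i)).
  congr (_ * _); rewrite [X in _ = _ + X + _]exchange_big /=.
  rewrite [X in _ = _ + _ + X](_ : _ = \sum_i \sum_j \sum_m d m * elementary2 k l i j * r i j m).
    rewrite -!big_split; apply: eq_bigr => i _; rewrite -!big_split; apply: eq_bigr => j _.
    by rewrite -!big_split; apply: eq_bigr => m _ /=; ring.
  by rewrite exchange_big; apply: eq_bigr => i _; rewrite exchange_big.
rewrite (scale (fun i a b => r i a b) 2); last by move=> i; rewrite (r2 i k l); ring.
rewrite (scale (fun i a b => - r a i b) 2); last first.
  by move=> i; rewrite (r1 i k l) (r1 i l k) (r2 i k l); ring.
rewrite (scale (fun i a b => r a b i) 2); last first.
  by move=> i; rewrite (r2 k i l) (r1 i k l) (r2 l i k) (r1 i l k) (r2 i k l); ring.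
by rewrite /S; field.
Qed.

End ElementaryTwoForm.

Section TestForms.
Variable R : realType.
Local Notation ord := 'I_6.

(** As a determinant, dx^k ^ dx^l is visibly alternating. *)
Lemma elementary2_det k l (I : 2.-tuple ord) :
  elementary2 R k l (tnth I ord0) (tnth I ord_max) =
  \det (\matrix_(r < 2, c < 2) (tnth I r == tnth [tuple k; l] c)%:R).
Proof.
rewrite (expand_det_row _ ord0) !big_ord_recl big_ord0 /cofactor !det_mx11 !mxE /=.
rewrite /elementary2 addr0 expr0 expr1 mul1r mulN1r mulrN.
have -> : lift ord0 ord0 = ord_max :> 'I_2 by exact: val_inj.
have -> : lift ord_max ord0 = ord0 :> 'I_2 by exact: val_inj.
by [].
Qed.

Lemma elementary2_alternating (c : R) k l : Defs.alternating (fun I : 2.-tuple ord =>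
  c * elementary2 R k l (tnth I ord0) (tnth I ord_max)).
Proof.
move=> s I; rewrite !elementary2_det mulrCA; congr (_ * _).
rewrite -(det_perm R s) -det_mulmx -row_permE; congr (\det _).
by apply/matrixP => r d; rewrite !mxE tnth_mktuple.
Qed.

End TestForms.

Section Codifferential.
Variables (R : realType) (U : set 'rV[R]_6).
Hypothesis oU : open U.
Variables (om : local_field R 2) (ph : local_field R 3).
Hypotheses (smooth_om : forall I, smooth_on U (fun x => om x I))
  (alt_om : forall x, U x -> Defs.alternating (om x))
  (closed_om : forall x, U x -> forall I, ext_d om x I = 0)
  (unit_om : forall x, U x -> form_mx (om x) \in unitmx).
Hypotheses (smooth_ph : forall I, smooth_on U (fun x => ph x I))
  (alt_ph : forall x, U x -> Defs.alternating (ph x))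
  (prim : forall x, U x -> forall I, Lambda (om x) (ph x) I = 0)
  (lambda_lt0 : forall x, U x -> hitchin_lambda (ph x) < 0).

Local Notation V := (fun x => form_inv (om x)).
Local Notation J := (fun x => almost_complex (om x) (ph x)).
Local Notation g := (fun x => metric (om x) (ph x)).
Local Notation nsq := (fun x => normsq (om x) (ph x)).
Local Notation vol := (fun x => Num.sqrt (\det (metric (om x) (ph x)))).
Local Notation psi := (scaled_dual om ph).
Local Notation beta x := (contract_jet (form_inv (om x)) (jet_ext_d (jet3_of psi x))).

Variable ga : local_field R 2.
Hypotheses (smooth_ga : forall I, smooth_on U (fun x => ga x I))
  (alt_ga : forall x, U x -> Defs.alternating (ga x)).
Hypothesis adjoint : forall al : local_field R 2,
  (forall I, smooth_on setT (fun x => al x I)) ->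
  (forall x, Defs.alternating (al x)) ->
  (exists2 K : set 'rV[R]_6, compact K /\ K `<=` U & forall x I, ~ K x -> al x I = 0) ->
  integral_rV (fun x => inner (g x) (ext_d al x) (fun I => nsq x * ph x I) * vol x) =
  integral_rV (fun x => inner (g x) (al x) (ga x) * vol x).

Local Notation B k l := (fun j x => vol x * insert123 (V x)^T (psi x) j k l).
Local Notation C k l := (fun x => vol x *
  (2^-1 * (raise_indices (g x) (ga x) [tuple k; l] - raise_indices (g x) (ga x) [tuple l; k]))).

Lemma raise_scaled_form x a b c : U x ->
  raise_indices (g x) (fun I => nsq x * ph x I) [tuple a; b; c] =
  insert123 (V x)^T (psi x) a b c.
Proof.
move=> Ux; have h := raise_formE (alt_om Ux) (alt_ph Ux) (unit_om Ux) (prim Ux) (lambda_lt0 Ux) a b c.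
transitivity (nsq x * raise_indices (g x) (ph x) [tuple a; b; c]).
  by rewrite /raise_indices mulr_sumr; apply: eq_bigr => I _; rewrite mulrCA.
rewrite h !insert123E !mulr_sumr; apply: eq_bigr => i _; rewrite mulr_sumr.
apply: eq_bigr => j _; rewrite mulr_sumr; apply: eq_bigr => k _.
by rewrite /scaled_dual; ring.
Qed.

Lemma smooth_raised_density k l j : smooth_on U (B k l j).
Proof.
apply: smoothM => //; first exact: smooth_vol.
apply: (smooth_eq_on oU (f := fun x =>
  raise_indices (g x) (fun I => nsq x * ph x I) [tuple j; k; l])).
  by move=> x Ux; rewrite raise_scaled_form.
apply: smooth_raise => // I; apply: smoothM => //; exact: smooth_normsq.
Qed.

Lemma smooth_codifferential_density k l : smooth_on U (C k l).
Proof.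
apply: smoothM => //; first exact: smooth_vol.
apply: smoothM => //; first exact: smooth_cst.
by apply: smoothD => //; [|apply: smoothN => //]; exact: smooth_raise.
Qed.

(** Adjointness against the test forms eta dx^k ^ dx^l, for all bump functions
    eta. *)
Lemma codifferential_divergence k l x : U x -> C k l x = - \sum_j partial j (B k l j) x.
Proof.
apply: (weak_divergence (B := B k l) (C := C k l) oU); [exact: smooth_raised_density|exact: smooth_codifferential_density|].
move=> eta K seta cK KU eta0.
pose al : local_field R 2 := fun y I => eta y * elementary2 R k l (tnth I ord0) (tnth I ord_max).
have cK' : closed K by apply: compact_closed => //; exact: norm_hausdorff.
have oK : open (~` K) by exact: closed_openC.
have deta j y : ~ K y -> partial j eta y = 0.
  by move=> nK; rewrite (@partial_eq_on _ _ _ _ (fun=> 0) _ _ oK) ?partial_cst//.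
have smooth_al I : smooth_on setT (fun y => al y I).
  exact: (smoothM openT seta (smooth_cst openT _)).
have dal j y a b : partial j (fun z => comp2 (al z) a b) y = partial j eta y * elementary2 R k l a b.
  have := partialM (x := y) j seta (smooth_cst openT (elementary2 R k l a b)) Logic.I.
  by rewrite partial_cst mulr0 addr0.
have adj : exists2 K : set 'rV[R]_6, compact K /\ K `<=` U & forall x I, ~ K x -> al x I = 0.
  by exists K => // y I /eta0; rewrite /al => ->; rewrite mul0r.
have {}adj := adjoint smooth_al (fun y => @elementary2_alternating R (eta y) k l) adj.
transitivity (integral_rV (fun y => inner (g y) (ext_d al y) (fun I => nsq y * ph y I) * vol y)).
  congr integral_rV; apply/funext => y; rewrite /inner big_tuple3.
  have [Ky|nK] := pselect (K y); last first.
    have d0 i j m : ext_d al y [tuple i; j; m] = 0.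
      by rewrite ext_d2E (dal i) (dal j) (dal m) (deta i y nK) (deta j y nK) (deta m y nK) !mul0r subrr addr0.
    rewrite [LHS]big1 => [|j _]; last by rewrite (deta j y nK) mul0r.
    rewrite [X in _ = _ * X * _]big1 => [|i _]; first by rewrite mulr0 mul0r.
    by apply: big1 => j _; apply: big1 => m _; rewrite d0 mul0r.
  have Uy := KU _ Ky.
  transitivity ((\sum_j partial j eta y * insert123 (V y)^T (psi y) j k l) * vol y).
    by rewrite mulr_suml; apply: eq_bigr => j _; rewrite [LHS]mulrCA [RHS]mulrC.
  congr (_ * _); rewrite -sum_wedge_elementary2; last first.
    by apply: insert123_alt; exact: scaled_dual_alt Uy.
  have -> : 3`!%:R = 6 :> R by [].
  congr (_ * _).
  apply: eq_bigr => i _; apply: eq_bigr => j _; apply: eq_bigr => m _.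
  by rewrite (raise_scaled_form i j m Uy) ext_d2E (dal i) (dal j) (dal m).
rewrite adj; congr integral_rV; apply/funext => y; rewrite /inner big_tuple2.
rewrite [LHS]mulrC [RHS]mulrCA; congr (_ * _).
have -> : 2`!%:R = 2 :> R by [].
rewrite [RHS]mulrCA; congr (_ * _).
rewrite -(sum_elementary2 k l (fun i j => raise_indices (g y) (ga y) [tuple i; j])).
rewrite !mulr_sumr; apply: eq_bigr => i _; rewrite !mulr_sumr; apply: eq_bigr => j _.
by rewrite /al /tnth /=; ring.
Qed.

(** By [raised_divergence] the codifferential raised with g is Lambda d psi raised
    with omega, and the two ways to raise an index differ by J. *)
Lemma codifferentialE x k l : U x ->
  ga x [tuple k; l] = \sum_p J x p k * (\sum_q J x q l * beta x p q).
Proof.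
move=> Ux; pose Ga := form_mx (ga x); pose Be := \matrix_(p, q) beta x p q.
have raisedE i j : raise_indices (g x) (ga x) [tuple i; j] =
    (invmx (g x) *m Ga *m (invmx (g x))^T) i j.
  rewrite /raise_indices big_tuple2 mxE exchange_big; apply: eq_bigr => b _.
  rewrite mxE mulr_suml; apply: eq_bigr => a _.
  by rewrite !big_ord_recl big_ord0 mulr1 !mxE /tnth /=; ring.
have skew : Ga^T = - Ga by exact: form_mx_skew (alt_ga Ux).
have skew2 : (invmx (g x) *m Ga *m (invmx (g x))^T)^T = - (invmx (g x) *m Ga *m (invmx (g x))^T).
  by move: (invmx (g x)) => G; rewrite !trmx_mul trmxK skew mulNmx mulmxN mulmxA.
have v0 : vol x != 0.
  by rewrite gt_eqF// sqrtr_gt0 (det_metric_gt0 alt_om unit_om alt_ph lambda_lt0).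
(* With g^-1 = V J^T this gives J^T Ga J = Be, and J^2 = -1 inverts it. *)
have E : invmx (g x) *m Ga *m (invmx (g x))^T = V x *m Be *m (V x)^T.
  apply/matrixP => i j; apply: (mulfI v0).
  have /matrixP/(_ j i) sk := skew2; move: sk; rewrite mxE [RHS]mxE => sk.
  have h2 := raised_divergence oU smooth_om alt_om closed_om unit_om smooth_ph alt_ph prim
    lambda_lt0 i j Ux.
  have h := etrans (codifferential_divergence i j Ux) (etrans (congr1 -%R h2) (opprK _)).
  rewrite !raisedE in h.
  transitivity (vol x * (2^-1 * ((invmx (g x) *m Ga *m (invmx (g x))^T) i j
     - (invmx (g x) *m Ga *m (invmx (g x))^T) j i))).
    rewrite {}sk; congr (_ * _); move: (fun_of_matrix _ j i) => b; by field.
  apply: (etrans h); congr (_ * _); rewrite [RHS]mxE exchange_big; apply: eq_bigr => q _.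
  rewrite mxE mulr_suml; apply: eq_bigr => p _; rewrite !mxE; ring.
have GE := metric_inv (alt_om Ux) (alt_ph Ux) (unit_om Ux) (prim Ux) (lambda_lt0 Ux).
have JJ := almost_complex_square (alt_om Ux) (alt_ph Ux) (unit_om Ux) (lambda_lt0 Ux).
have uV : V x \in unitmx by rewrite /form_inv unitmx_inv unit_om.
rewrite GE trmx_mul trmxK in E.
have {}E : (J x)^T *m Ga *m J x = Be.
  have uVT : (V x)^T \in unitmx by rewrite unitmx_tr.
  apply: (can_inj (mulKmx uV)); apply: (can_inj (mulmxK uVT)).
  by rewrite -E !mulmxA.
have : Ga = (J x)^T *m Be *m J x.
  rewrite -E !mulmxA -trmx_mul JJ -!mulmxA JJ.
  by rewrite linearN /= trmx1 mulNmx mul1mx !mulmxN mulmx1 opprK.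
move/matrixP/(_ k l); rewrite mxE => ->; rewrite mxE.
under eq_bigr do rewrite mxE mulr_suml.
rewrite exchange_big; apply: eq_bigr => p _; rewrite mulr_sumr; apply: eq_bigr => q _.
by rewrite !mxE; ring.
Qed.

End Codifferential.

(** * The identity of the two flows *)

Section LocalIdentity.
Variables (R : realType) (U : set 'rV[R]_6).
Hypothesis oU : open U.

Lemma ext_d_combination k (a b : local_field R k) x I :
  (forall I, smooth_on U (fun y => a y I)) -> (forall I, smooth_on U (fun y => b y I)) -> U x ->
  ext_d (fun y I => - a y I + 2 * b y I) x I = - ext_d a x I + 2 * ext_d b x I.
Proof.
move=> sa sb Ux; rewrite /ext_d mulr_sumr -sumrN -big_split; apply: eq_bigr => j _ /=.
set K := [tuple _ | _ < _].
have sa' := smoothN oU (sa K); have sb' := smoothM oU (smooth_cst oU 2) (sb K).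
rewrite (partialD _ sa' sb' Ux) (partialN oU)// (partialM _ (smooth_cst oU 2) (sb K) Ux).
by rewrite partial_cst; ring.
Qed.

Variables (om : local_field R 2) (ph : local_field R 3).
Hypotheses (smooth_om : forall I, smooth_on U (fun x => om x I))
  (alt_om : forall x, U x -> Defs.alternating (om x))
  (closed_om : forall x, U x -> forall I, ext_d om x I = 0)
  (unit_om : forall x, U x -> form_mx (om x) \in unitmx).
Hypotheses (smooth_ph : forall I, smooth_on U (fun x => ph x I))
  (alt_ph : forall x, U x -> Defs.alternating (ph x))
  (closed_ph : forall x, U x -> forall I, ext_d ph x I = 0)
  (prim : forall x, U x -> forall I, Lambda (om x) (ph x) I = 0)
  (lambda_lt0 : forall x, U x -> hitchin_lambda (ph x) < 0).

Local Notation psi := (scaled_dual om ph).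
Local Notation beta x := (contract_jet (form_inv (om x)) (jet_ext_d (jet3_of psi x))).
Local Notation star_field := (fun y I =>
  normsq (om y) (ph y) * hodge_star (om y) (metric (om y) (ph y)) (ph y) I).
Local Notation N_field := (fun y I => normsq (om y) (ph y) * N_dagger om ph y I).

Lemma smooth_contract_dpsi k l : smooth_on U (fun x => beta x k l).
Proof.
have sV := smooth_form_inv oU smooth_om unit_om.
have sp := smooth_scaled_dual oU smooth_om alt_om unit_om smooth_ph alt_ph lambda_lt0.
apply: smoothM => //; first exact: smooth_cst.
apply: smooth_sum => // i _; apply: smooth_sum => // j _; apply: smoothM => //.
have sd a b c d : smooth_on U (fun x => jet3_of psi x a b c d) by exact: smooth_partial.
rewrite /jet_ext_d; do 3 (apply: smoothD => //; try apply: smoothN => //).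
Qed.

Lemma Lambda_d_star x k l : U x -> Lambda (om x) (ext_d star_field x) [tuple k; l] = beta x k l.
Proof.
move=> Ux; rewrite LambdaE; congr (_ * _); apply: eq_bigr => i _; apply: eq_bigr => j _.
congr (_ * _); rewrite ext_d3E.
have E a b c d : jet3_of (fun y => comp3 (star_field y)) x a b c d = jet3_of psi x a b c d.
  apply: (jet3_eq_on oU) => // y Uy b' c' d'; congr (_ * _).
  exact: (hodge_starE (alt_om Uy) (alt_ph Uy) (unit_om Uy) (prim Uy) (lambda_lt0 Uy)).
by rewrite /jet_ext_d !E.
Qed.

Variable ga : local_field R 2.
Hypotheses (smooth_ga : forall I, smooth_on U (fun x => ga x I))
  (alt_ga : forall x, U x -> Defs.alternating (ga x)).
Hypothesis adjoint : forall al : local_field R 2,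
  (forall I, smooth_on setT (fun x => al x I)) ->
  (forall x, Defs.alternating (al x)) ->
  (exists2 K : set 'rV[R]_6, compact K /\ K `<=` U & forall x I, ~ K x -> al x I = 0) ->
  integral_rV (fun x => inner (metric (om x) (ph x)) (ext_d al x)
     (fun I => normsq (om x) (ph x) * ph x I) * Num.sqrt (\det (metric (om x) (ph x)))) =
  integral_rV (fun x => inner (metric (om x) (ph x)) (al x) (ga x) *
     Num.sqrt (\det (metric (om x) (ph x)))).

Lemma contract_dpsi_codifferential x I : U x ->
  beta x (tnth I ord0) (tnth I ord_max) + ga x I = 2 * N_field x I.
Proof.
move=> Ux; rewrite [in ga x I](tuple2E I) [in N_dagger _ _ _ I](tuple2E I).
have h1 := codifferentialE oU smooth_om alt_om closed_om unit_om smooth_ph alt_ph prim lambda_lt0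
  smooth_ga alt_ga adjoint (tnth I ord0) (tnth I ord_max) Ux.
have h2 := beta_type11 oU smooth_om alt_om unit_om smooth_ph alt_ph closed_ph prim lambda_lt0
  (tnth I ord0) (tnth I ord_max) Ux.
by rewrite h1; exact: h2.
Qed.

(** Rather than from the definition of N, smoothness is read off the identity
    with beta and the codifferential, both of which are smooth. *)
Lemma smooth_N_field I : smooth_on U (fun x => N_field x I).
Proof.
apply: (smooth_eq_on oU (f := fun x => 2^-1 * (beta x (tnth I ord0) (tnth I ord_max) + ga x I))).
  by move=> x Ux; rewrite contract_dpsi_codifferential// mulKf// pnatr_eq0.
apply: smoothM => //; first exact: smooth_cst.
by apply: smoothD => //; exact: smooth_contract_dpsi.
Qed.

Lemma d_Lambda_d_star x I : U x ->
  ext_d (fun y => Lambda (om y) (ext_d star_field y)) x I =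
  - ext_d ga x I + 2 * ext_d N_field x I.
Proof.
move=> Ux; rewrite -(ext_d_combination _ smooth_ga smooth_N_field Ux).
apply: (ext_d_eq_on oU) => // y Uy K.
rewrite [X in Lambda _ _ X](tuple2E K) Lambda_d_star//.
by rewrite -contract_dpsi_codifferential// addrC addrK.
Qed.

End LocalIdentity.

Section Global.
Variables (R : realType) (M : topologicalType) (A : atlas R M).
Variables (om : tensor_field A 2) (ph : tensor_field A 3).
Hypotheses (om_symplectic : symplectic om) (ph_form : is_form ph)
  (ph_positive : positive_form om ph).

Lemma overlap_img (c c' : chart_index A) x : chart_overlap c c' x ->
  chart_img c x /\ chart_img c' (transition c c' x).
Proof.
case=> p [cp c'p] <-; split; first by exists p.
by exists p => //; rewrite /transition chartK.
Qed.

(** The transformation matrix of the components is the Jacobian matrix of the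
    transition map, and |phi|^2 is unchanged by [normsq_pullback]. *)
Lemma normsq_mul_form : is_form (normsq_mul om ph ph).
Proof.
case: om_symplectic => -[som aom tom] _ uom; case: ph_form => sph aph tph.
have lph c x : chart_img c x -> hitchin_lambda (ph c x) < 0 by case/ph_positive.
split=> [c I|c x Ux|c c' x I Ox].
- apply: smoothM; [exact: chart_img_open| |exact: sph].
  apply: smooth_normsq; [exact: chart_img_open|exact: som|exact: aom|exact: uom|exact: sph|exact: aph|exact: lph].
- by move=> s I; rewrite /normsq_mul aph// mulrCA.
have [Ux Ux'] := overlap_img Ox.
pose P := \matrix_(i, a) partial i (fun y => transition c c' y 0 a) x.
have pullE k (al : tensor R k) J : pullback P al J = \sum_(K : k.-tuple 'I_6)
    (\prod_(m < k) partial (tnth J m) (fun y => transition c c' y 0 (tnth K m)) x) * al K.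
  by apply: eq_bigr => K _; congr (_ * _); apply: eq_bigr => m _; rewrite mxE.
have omE : om c x = pullback P (om c' (transition c c' x)).
  by apply/funext => J; rewrite pullE; exact: tom.
have phE : ph c x = pullback P (ph c' (transition c c' x)).
  by apply/funext => J; rewrite pullE; exact: tph.
rewrite /normsq_mul; transitivity (normsq (om c' (transition c c' x)) (ph c' (transition c c' x)) * ph c x I).
  congr (_ * _); rewrite omE phE; apply: normsq_pullback.
  + by rewrite -omE; exact: aom.
  + exact: aom.
  + exact: aph.
  + by rewrite -omE; exact: uom.
  + exact: uom.
  + exact: lph.
by rewrite (tph _ _ _ _ Ox) mulr_sumr; apply: eq_bigr => K _; rewrite mulrCA.
Qed.

Hypotheses (ph_primitive : primitive_form om ph) (ph_closed : closed_form ph).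
Variable D : tensor_field A 3 -> tensor_field A 2.
Hypothesis D_adjoint : adjoint_of_d (metric_of om ph) D.

Lemma flow_identity c x I : chart_img c x ->
  d_form (Lambda_form om (d_form (normsq_mul om ph (star_form om ph)))) c x I =
  - d_form (D (normsq_mul om ph ph)) c x I
  + 2 * d_form (normsq_mul om ph (N_dagger_form om ph)) c x I.
Proof.
move=> Ux; have [[sD aD _] adj] := D_adjoint normsq_mul_form.
case: om_symplectic => -[som aom _] com uom; case: ph_form => sph aph _.
have lph y : chart_img c y -> hitchin_lambda (ph c y) < 0 by case/ph_positive.
apply: (d_Lambda_d_star (@chart_img_open _ _ A c) (som c) (aom c) (com c) (uom c) (sph c) (aph c)
  (@ph_closed c) (@ph_primitive c) lph (sD c) (aD c)); last exact: Ux.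
by move=> al sal aal [K cK al0]; apply: adj; split; [exact: sal|exact: aal|exists K].
Qed.

End Global.

Theorem theorem1 (R : realType) (M : topologicalType) (A : atlas R M)
    (M_hausdorff : hausdorff_space M) (M_compact : compact [set: M])
    (om : tensor_field A 2) (om_symplectic : symplectic om)
    (T : set R) (T_open : open T) (T_interval : is_interval T)
    (rho : R -> tensor_field A 3) (rho_form : forall t, T t -> is_form (rho t))
    (ph : R -> tensor_field A 3)
    (ph_form : forall t, T t -> is_form (ph t))
    (ph_positive : forall t, T t -> positive_form om (ph t))
    (ph_primitive : forall t, T t -> primitive_form om (ph t))
    (ph_closed : forall t, T t -> closed_form (ph t))
    (codiff : R -> tensor_field A 3 -> tensor_field A 2)
    (codiff_adjoint : forall t, T t ->
      adjoint_of_d (metric_of om (ph t)) (codiff t)) :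
  type_IIA_flow T om rho ph <-> rewritten_flow T om rho ph codiff.
Proof.
have E t (Tt : T t) c x (Ux : chart_img c x) I :=
  flow_identity om_symplectic (ph_form t Tt) (ph_positive t Tt) (ph_primitive t Tt) (ph_closed t Tt)
    (codiff_adjoint t Tt) I Ux.
by split=> flow t Tt c x Ux I; have := flow t Tt c x Ux I; rewrite /= (E t Tt c x Ux I).
Qed.
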